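(* Let $X$ be a projective (not necessarily simplicial) toric variety of dimension $n$ with fan $\Sigma$, let $F_0,\dots,F_n$ be the generic homogeneous polynomials of ample degrees $\alpha_0,\dots,\alpha_n$ in its homogeneous coordinate ring $S$, and let $\bar\sigma=(\{0\}\subset\sigma_1\subset\cdots\subset\sigma_n)$ be a complete flag of cones of $\Sigma$ with $\dim\sigma_i=i$. For $i=1,\dots,n$ let $z_i$ be the product of all variables $x_j$ with $\eta_j\in\sigma_i$ but $\eta_j\notin\sigma_{i-1}$ (where $\sigma_0=\{0\}$), and let $z_{n+1}=\prod_{\eta_j\notin\sigma_n}x_j$. Write $F_j=\sum_{i=1}^{n+1}A_{ij}z_i$ for $j=0,\dots,n$ with $A_{ij}\in S$ homogeneous of degree $\alpha_j-\deg(z_i)$, and let $\Delta_{\bar\sigma}=\det(A_{ij})\in S_\rho$, where $\rho=\sum_i\alpha_i-\beta_0$. Then $$\mathrm{Residue}_F(\Delta_{\bar\sigma})=\pm1.$$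
   Context: Setting. $X$ is a projective toric variety of dimension $n$ with fan $\Sigma\subset\mathbb{R}^n$ (lattice $\mathbb{Z}^n$). Let $\eta_0,\dots,\eta_{s-1}$ be the primitive generators of the $1$-dimensional cones of $\Sigma$ and $D_0,\dots,D_{s-1}$ the corresponding torus-invariant divisors. Let $\alpha_0,\dots,\alpha_n\in A_{n-1}(X)$ (the Chow group) be ample classes, and $\beta_0=[\sum_i D_i]$. A monomial $x^a=\prod x_i^{a_i}$ has degree $\deg(a)=[\sum a_iD_i]\in A_{n-1}(X)$. Put $\mathcal{A}_i=\{a\in\mathbb{N}^s:\deg(a)=\alpha_i\}$, $\mathbb{A}=\mathbb{Q}[u_{ia};\ i=0,\dots,n,\ a\in\mathcal{A}_i]$ with fraction field $Q(\mathbb{A})$, and $S=\mathbb{A}[x_0,\dots,x_{s-1}]$, graded by $A_{n-1}(X)$; $S_\gamma$ is the free $\mathbb{A}$-module spanned by the monomials of degree $\gamma$. The generic polynomials are $F_i=\sum_{a\in\mathcal{A}_i}u_{ia}x^a\in S_{\alpha_i}$, $i=0,\dots,n$. The critical degree is $\rho=\sum_i\alpha_i-\beta_0$. Expressions $F_j=\sum_i A_{ij}z_i$ as in the claim exist (they are not unique). Toric residue. For an $n$-element subset $I=\{i_1,\dots,i_n\}$ of $\{0,\dots,s-1\}$ put $\det(\eta_I)=\det(\langle e_l,\eta_{i_j}\rangle)_{1\le l,j\le n}$ ($e_l$ the standard basis), $dx_I=dx_{i_1}\wedge\cdots\wedge dx_{i_n}$, $\hat x_I=\prod_{j\notin I}x_j$,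 and $\Omega=\sum_{|I|=n}\det(\eta_I)\,\hat x_I\,dx_I$. Working over the field $Q(\mathbb{A})$, the generic $F_i$ have no common zero on $X$, so the sets $U_i=\{x\in X: F_i(x)\ne0\}$ form an open cover of $X$. For $g\in S_\rho$, the form $\omega_g=\frac{g\,\Omega}{F_0\cdots F_n}$ is a Čech $n$-cocycle for this cover and defines a class $[\omega_g]\in H^n(X,\Omega_X^n)$, where $\Omega_X^n\cong\mathcal{O}(-\beta_0)$ is the canonical sheaf. Define $\mathrm{Residue}_F(g)=\mathrm{Tr}_X([\omega_g])\in Q(\mathbb{A})$, with $\mathrm{Tr}_X$ the trace map of duality theory. *)

(* Defs.v *)
(* Built on the Mathematical Components library. *)
From mathcomp Require Import all_boot all_order all_algebra.
From mathcomp Require Import fraction mpoly.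

Set Implicit Arguments.
Unset Strict Implicit.
Unset Printing Implicit Defensive.

Import GRing.Theory Num.Theory.
Local Open Scope ring_scope.

(* A fan in R^n is given by the matrix eta whose row j is the generator eta_j
   and by the collection Sigma of its cones, a cone being recorded as the set
   of indices of the rays it contains. *)
Section Fan.

Variables (R : realFieldType) (n s : nat) (eta : 'M[int]_(s, n)).
Implicit Types (Sigma : {set {set 'I_s}}) (J I : {set 'I_s}).

Definition etaR : 'M[R]_(s, n) := map_mx intr eta.

Definition in_cone J (v : 'rV[R]_n) : Prop :=
  exists c : 'I_s -> R,
    (forall j, 0 <= c j) /\ v = \sum_(j in J) c j *: row j etaR.

Definition is_face J I : Prop :=
  exists m : 'cV[R]_n,
    (forall j, j \in J -> 0 <= (etaR *m m) j 0) /\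
    I = [set j in J | (etaR *m m) j 0 == 0].

Definition cone_dim J : nat :=
  \rank (\matrix_(j < s, l < n) (if j \in J then etaR j l else 0)).

(* Together, the axioms imply that the eta_j are pairwise distinct, that they
   generate exactly the 1-dimensional cones, and that j \in J if and only
   if eta_j lies in the cone J. *)
Record complete_fan Sigma : Prop := CompleteFan {
  fan_primitive : forall j (d : int),
    (forall l, (d %| eta j l)%Z) -> d = 1 \/ d = -1;
  fan_ray : forall j, [set j] \in Sigma;
  fan_strongly_convex : forall J v,
    J \in Sigma -> in_cone J v -> in_cone J (- v) -> v = 0;
  fan_face : forall J I, J \in Sigma -> is_face J I -> I \in Sigma;
  fan_cap : forall J J', J \in Sigma -> J' \in Sigma ->
    is_face J (J :&: J') /\
    (forall v, in_cone J v -> in_cone J' v -> in_cone (J :&: J') v);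
  fan_cover : forall v, exists2 J, J \in Sigma & in_cone J v
}.

(* With H_j the torus-invariant prime divisor of the ray eta_j, a class in
   A_{n-1}(X) is represented by D in Z^s, standing for \sum_j D_j H_j, up to the
   relations div(chi^m) = \sum_j <m, eta_j> H_j for m in M = Z^n. *)
Definition lin_eq (D E : 'cV[int]_s) : Prop :=
  exists m : 'cV[int]_n, D - E = eta *m m.

(* The divisor \sum_j D_j H_j is Cartier, its support function being <m_J, _> on
   the maximal cone J, and this support function, whose value at eta_j is
   - D_j, is strictly convex. *)
Definition ample Sigma (D : 'cV[int]_s) : Prop :=
  exists m : {set 'I_s} -> 'cV[int]_n,
    forall J, J \in Sigma -> cone_dim J = n -> forall j,
      if j \in J then (eta *m m J) j 0 = - D j 0
      else - D j 0 < (eta *m m J) j 0.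

Definition projective_fan Sigma : Prop :=
  complete_fan Sigma /\ exists D, ample Sigma D.

(* sg lists sigma_0, ..., sigma_n. *)
Definition complete_flag Sigma (sg : n.+1.-tuple {set 'I_s}) : Prop :=
  (forall i : 'I_n.+1,
     tnth sg i \in Sigma /\ cone_dim (tnth sg i) = i) /\
  (forall i, (i < n)%N -> nth setT sg i \subset nth setT sg i.+1).

End Fan.

(* The rays defining z_{i+1}, for 0 <= i <= n. The default value setT of nth
   stands for sigma_{n+1}, so that the last set is the complement of
   sigma_n. *)
Definition flag_step n s (sg : n.+1.-tuple {set 'I_s}) (i : 'I_n.+1)
    : {set 'I_s} :=
  nth setT sg i.+1 :\: nth setT sg i.

Definition flag_z (R : comNzRingType) n s (sg : n.+1.-tuple {set 'I_s})
    (i : 'I_n.+1) : {mpoly R[s]} :=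
  \prod_(j in flag_step sg i) 'X_j.

Definition flag_z_deg n s (sg : n.+1.-tuple {set 'I_s}) (i : 'I_n.+1)
    : 'cV[int]_s :=
  \col_j (j \in flag_step sg i)%:R.

Section Grading.

Variables (n s : nat) (eta : 'M[int]_(s, n)).

Definition mdiv (a : 'X_{1..s}) : 'cV[int]_s := \col_j (a j)%:Z.

Definition beta0 : 'cV[int]_s := const_mx 1.

Definition is_homog (R : nzRingType) (g : {mpoly R[s]}) (D : 'cV[int]_s)
    : Prop :=
  forall a, a \in msupp g -> lin_eq eta (mdiv a) D.

End Grading.

(* Let K be the ground field. All rings of sections are realized inside the
   fraction field of the Cox ring K[x_0, ..., x_{s-1}], and n-forms are written
   in the basis dx_I: a form is the alternating function sending
   (i_1, ..., i_n) to its value on the coordinate vector fields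
   d/dx_{i_1}, ..., d/dx_{i_n}. *)
Notation rational_fun K s := {fraction {mpoly K[s]}}.
Notation nform K n s :=
  {ffun {ffun 'I_n -> 'I_s} -> (rational_fun K s)^o}.

(* Cochains of the Cech complex on all tuples of indices; the ones on m open
   sets with q = p.+1 form the term of degree p. *)
Notation cech_cochain K n s m q := {ffun {ffun 'I_q -> 'I_m} -> nform K n s}.

Section Cohomology.

Variables (K : fieldType) (n s : nat).
Variables (eta : 'M[int]_(s, n)) (Sigma : {set {set 'I_s}}).

Local Notation S := {mpoly K[s]}.
Local Notation ratfun := (rational_fun K s).
Local Notation form := (nform K n s).
Local Notation cochain m q := (cech_cochain K n s m q).

Definition of_poly (g : S) : ratfun := tofrac g.

(* Omega = \sum_I det(eta_I) \hat x_I dx_I. *)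
Definition Omega : form :=
  [ffun t : {ffun 'I_n -> 'I_s} =>
     \det (\matrix_(l < n, k < n) ((eta (t k) l)%:~R : ratfun)) *
     \prod_(j | j \notin codom t) of_poly 'X_j].

(* phi lies in the graded piece of degree D of the localization S_f. *)
Definition in_loc (f : S) (D : 'cV[int]_s) (phi : ratfun) : Prop :=
  exists (k : nat) (E : 'cV[int]_s) (g : S),
    [/\ is_homog eta f E, is_homog eta g (D + E *+ k)
      & phi = of_poly g / of_poly f ^+ k].

(* Sections of the canonical sheaf over {f <> 0}. *)
Definition canonical_section (f : S) (w : form) : Prop :=
  exists2 phi, in_loc f (- beta0 s) phi & w = phi *: Omega.

(* The open sets {f_i <> 0} cover X: they cover the complement, in affine
   s-space, of the zero set of the irrelevant ideal, which is generated by the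
   products of the variables outside a cone. *)
Definition is_cover m (f : 'I_m -> S) : Prop :=
  (forall i, f i != 0 /\ exists D, is_homog eta (f i) D) /\
  (forall J, J \in Sigma ->
     exists (k : nat) (c : 'I_m -> S),
       (\prod_(j | j \notin J) 'X_j) ^+ k = \sum_i c i * f i).

Definition is_cochain m q (f : 'I_m -> S) (c : cochain m q) : Prop :=
  forall t : {ffun 'I_q -> 'I_m}, canonical_section (\prod_k f (t k)) (c t).

Definition cech_d m q (c : cochain m q) : cochain m q.+1 :=
  [ffun t : {ffun 'I_q.+1 -> 'I_m} =>
     \sum_(i < q.+1) (-1) ^+ i *: c [ffun k => t (lift i k)]].

Definition is_cocycle m q (f : 'I_m -> S) (c : cochain m q) : Prop :=
  is_cochain f c /\ cech_d c = 0.

Definition cech_pull m m' q (r : 'I_m' -> 'I_m) (c : cochain m q)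
    : cochain m' q :=
  [ffun t : {ffun 'I_q -> 'I_m'} => c [ffun k => r (t k)]].

(* The character chi^{m_l} of the torus, m_l being column l of P. *)
Definition torus_char (P : 'M[int]_n) (l : 'I_n) : ratfun :=
  \prod_j of_poly 'X_j ^ (eta *m P) j l.

(* The numerator of chi^{m_l} - 1. *)
Definition torus_hyp (P : 'M[int]_n) (l : 'I_n) : S :=
  \prod_(j | 0 <= (eta *m P) j l) 'X_j ^+ `|(eta *m P) j l|%N -
  \prod_(j | (eta *m P) j l < 0) 'X_j ^+ `|(eta *m P) j l|%N.

(* dt_1 /\ ... /\ dt_n / ((t_1 - 1) ... (t_n - 1)), where t_l = chi^{m_l}. *)
Definition point_form (P : 'M[int]_n) : form :=
  [ffun i : {ffun 'I_n -> 'I_s} =>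
     \det (\matrix_(l < n, k < n)
             (((eta *m P) (i k) l)%:~R * torus_char P l / of_poly 'X_(i k))) /
     \prod_l (torus_char P l - 1)].

(* c is a Cech representative of the image in H^n(X, Omega_X^n) of the local
   cohomology class [dt_1 /\ ... /\ dt_n / (t_1 - 1), ..., (t_n - 1)] at the
   identity p of the torus T, where t_1, ..., t_n are the coordinates of T given
   by a basis of the lattice M: one open set of the cover is T, the others cover
   X \ p and include the sets t_l <> 1; the cocycle c vanishes on the tuples
   of open sets of X \ p, and it is the above form on the tuple
   (T, {t_1 <> 1}, ..., {t_n <> 1}), which determines its class in
   H^n_p(X, Omega_X^n). *)
Definition point_class m (f : 'I_m -> S) (c : cochain m n.+1) : Prop :=
  exists (P : 'M[int]_n) (i0 : 'I_m) (v : 'I_n -> 'I_m),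
    [/\ P \in unitmx,
        f i0 = \prod_j 'X_j,
        forall i, i != i0 -> (f i).@[fun=> 1] = 0 &
        forall l, f (v l) = torus_hyp P l] /\
    [/\ is_cocycle f c,
        forall t : {ffun 'I_n.+1 -> 'I_m}, i0 \notin codom t -> c t = 0 &
        c [ffun k => if unlift ord0 k is Some l then v l else i0]
          = point_form P].

(* H^n(X, Omega_X^n) is the direct limit over refinement of the Cech cohomology
   of the covers {f_i <> 0}; a functional on it is a family of functionals on
   cocycles. The trace map of duality theory is the K-linear functional which
   sends the image of a local cohomology class at a smooth point to its local
   residue. Since H^n(X, Omega_X^n) is one-dimensional, it is determined by its
   value at the class of one point. The order T, {t_1 <> 1}, ... fixes the sign
   convention. *)
Definition functional : Type :=
  forall m, ('I_m -> S) -> cochain m n.+1 -> K.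

Record is_trace (Tr : functional) : Prop := IsTrace {
  trace_linear : forall m (f : 'I_m -> S) (a : K) c c',
    is_cover f -> is_cocycle f c -> is_cocycle f c' ->
    Tr m f (of_poly a%:MP *: c + c') = a * Tr m f c + Tr m f c';
  (* For n = 0, cochain m n is the augmentation term, not part of the Cech
     complex. *)
  trace_coboundary : forall m (f : 'I_m -> S) (b : cochain m n),
    (0 < n)%N -> is_cover f -> is_cochain f b -> Tr m f (cech_d b) = 0;
  trace_refine : forall m m' (f : 'I_m -> S) (f' : 'I_m' -> S)
      (r : 'I_m' -> 'I_m) c,
    is_cover f -> is_cover f' ->
    (forall i, exists (k : nat) (h : S), f' i ^+ k = f (r i) * h) ->
    is_cocycle f c -> Tr m' f' (cech_pull r c) = Tr m f c;
  trace_point : forall m (f : 'I_m -> S) c,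
    is_cover f -> point_class f c -> Tr m f c = 1
}.

(* The cocycle g Omega / (F_0 ... F_n): the determinant is the sign of t if t is
   a permutation of the n+1 indices, and 0 otherwise. *)
Definition omega (F : 'I_n.+1 -> S) (g : S) : cochain n.+1 n.+1 :=
  [ffun t : {ffun 'I_n.+1 -> 'I_n.+1} =>
     (\det (\matrix_(i, j) ((t i == j)%:R : ratfun)) *
      (of_poly g / \prod_j of_poly (F j))) *: Omega].

Definition residue (Tr : functional) (F : 'I_n.+1 -> S) (g : S) : K :=
  Tr n.+1 F (omega F g).

End Cohomology.

Notation gen_ring N := {mpoly rat[N]}.
Notation gen_field N := {fraction {mpoly rat[N]}}.

Section Generic.

Variables (n s N : nat) (eta : 'M[int]_(s, n)) (alpha : 'I_n.+1 -> 'cV[int]_s).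

(* The bijection ix indexes the generic coefficients u_{ia} by the N variables
   of gen_ring N. *)
Definition enumerates (ix : 'I_N -> 'I_n.+1 * 'X_{1..s}) : Prop :=
  injective ix /\
  forall i a, (exists k, ix k = (i, a)) <-> lin_eq eta (mdiv a) (alpha i).

Definition generic_poly (ix : 'I_N -> 'I_n.+1 * 'X_{1..s}) (i : 'I_n.+1)
    : {mpoly (gen_ring N)[s]} :=
  \sum_(k < N | (ix k).1 == i) ('X_k : gen_ring N) *: 'X_[(ix k).2].

Definition base_change (g : {mpoly (gen_ring N)[s]})
    : {mpoly (gen_field N)[s]} :=
  map_mpoly (@tofrac (gen_ring N)) g.

End Generic.

(* Main.v *)
(* Fix an ample divisor D and, for each maximal cone J, let e_J be the exponent
   of the monomial of degree D at the vertex J; let e be the one for sigma_n.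
   The binomials w_J = x^(e_J) - x^e together with T = prod_j x_j define an open
   cover g of X. Like the F_j, they are polynomial combinations of the z_i: a
   row of coefficients of w_J is supported on z_{n+1} and on the first z_l none
   of whose rays lies in J. On the joint cover by the F_j and g, the cochain
   det(a_t) / prod f_t is a cocycle, the formal coboundary of its minors divided
   by z_{n+1}. It restricts to the residue cocycle of Delta on the F_j, so the
   residue may be computed on g.
   On T the w_J are chi^(m_J) - 1 up to a monomial. Summing chi over the lattice
   points of a parallelepiped shifted by an infinitesimal vector v, and dividing by
   prod (chi^(m_i) - 1), gives a formal cochain whose coboundary is regular and
   represents the class of the identity of T, as is seen by enlarging the cover
   with the hypersurfaces chi_l = 1; the key point is that a line in general
   position enters and leaves a cube exactly once. If v is infinitesimal of
   decreasing orders along a basis of M adapted to the flag, then the minors and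
   the lattice point sums agree up to a regular cochain: the only nonregular
   monomial, at the far corner of the parallelepiped, occurs exactly when the n
   cones have distinct types l, and is then cancelled by the minor. Hence the
   residue is that of a point, up to sign. *)
Require Import Defs.
From mathcomp Require Import all_boot all_order all_algebra all_fingroup.
From mathcomp Require Import fraction mpoly.
From mathcomp Require Import zify ring lra.

Set Implicit Arguments.
Unset Strict Implicit.
Unset Printing Implicit Defensive.

Import Order.TTheory GRing.Theory Num.Theory.
Local Open Scope ring_scope.

(** * Graded pieces and their localizations *)

(** Expanding [prod (1 - chi^(m_i))^-1] turns the quotient by lattice point sums into the series of
    lattice points of the simplicial cone spanned by the [m_i] with apex [v]. The coboundary
    relation thus says that the signed cones spanned by n of n+1 vectors add up to cones containing
    lines, whose rational functions vanish. It is proved without series: after clearing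
    denominators, the coefficient of [chi^mu] counts the facets of the cube in R^(n+1) crossed by
    the fibre over [mu - v] of the projection given by the n+1 vectors. The shift has three tasks:
    it removes lattice points from the walls, it is positive on the rays of sigma_n, so that
    exponents there stay at least 1 and survive the division by [prod x_j] that the canonical degree
    forces, and its signs in the basis [m_i] decide whether the far corner is counted. The minors
    over [z_{n+1}] and the cone quotients are in general not regular cochains. Hence the trace
    axioms are applied only to their coboundaries and to the coboundary of their difference, and all
    denominators are handled in the fraction field. *)

Section LinearEquivalence.

Variables (n s : nat) (eta : 'M[int]_(s, n)).
Implicit Types D E : 'cV[int]_s.

Lemma lin_eq_refl D : lin_eq eta D D.
Proof. by exists 0; rewrite subrr mulmx0. Qed.

Lemma lin_eq_sym D E : lin_eq eta D E -> lin_eq eta E D.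
Proof. by case=> m h; exists (- m); rewrite mulmxN -h opprB. Qed.

Lemma lin_eq_trans E D D' : lin_eq eta D E -> lin_eq eta E D' -> lin_eq eta D D'.
Proof. by case=> m h [m' h']; exists (m + m'); rewrite mulmxDr -h -h' addrA subrK. Qed.

Lemma lin_eqD D E D' E' :
  lin_eq eta D E -> lin_eq eta D' E' -> lin_eq eta (D + D') (E + E').
Proof. by case=> m h [m' h']; exists (m + m'); rewrite mulmxDr -h -h' opprD addrACA. Qed.

Lemma lin_eqMn D E k : lin_eq eta D E -> lin_eq eta (D *+ k) (E *+ k).
Proof. by case=> m h; exists (m *+ k); rewrite -mulrnBl h; elim: k => [|k IH]; rewrite ?mulr0n ?mulmx0 // !mulrSr mulmxDr IH. Qed.

Lemma mdivD (a b : 'X_{1..s}) : mdiv (a + b) = mdiv a + mdiv b.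
Proof. by apply/colP=> j; rewrite !mxE mnmDE. Qed.

Lemma mdiv0 : mdiv (0%MM : 'X_{1..s}) = 0.
Proof. by apply/colP=> j; rewrite !mxE mnm0E. Qed.

Lemma mdiv1 j : mdiv (U_(j)%MM : 'X_{1..s}) = delta_mx j 0.
Proof. by apply/colP=> i; rewrite !mxE mnm1E eqxx andbT eq_sym; case: eqP. Qed.

Section Homogeneous.

Variable R : comNzRingType.
Implicit Types f g : {mpoly R[s]}.

Lemma is_homog_lin D E f : lin_eq eta D E -> is_homog eta f D -> is_homog eta f E.
Proof. by move=> h hf a /hf ha; apply: lin_eq_trans h. Qed.

Lemma is_homog0 D : is_homog eta (0 : {mpoly R[s]}) D.
Proof. by move=> a; rewrite msupp0. Qed.

Lemma is_homogX (a : 'X_{1..s}) : is_homog eta ('X_[a] : {mpoly R[s]}) (mdiv a).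
Proof. by move=> b; rewrite msuppX inE => /eqP ->; apply: lin_eq_refl. Qed.

Lemma is_homogD f g D : is_homog eta f D -> is_homog eta g D -> is_homog eta (f + g) D.
Proof. by move=> hf hg a /msuppD_le; rewrite mem_cat => /orP[/hf|/hg]. Qed.

Lemma is_homogN f D : is_homog eta f D -> is_homog eta (- f) D.
Proof. by move=> hf a; rewrite (perm_mem (msuppN _)) => /hf. Qed.

Lemma is_homogM f g D E :
  is_homog eta f D -> is_homog eta g E -> is_homog eta (f * g) (D + E).
Proof.
move=> hf hg a /msuppM_le /allpairsP[[b c] /= [/hf hb /hg hc ->]].
by rewrite mdivD; apply: lin_eqD.
Qed.

Lemma is_homogC (c : R) : is_homog eta (c%:MP : {mpoly R[s]}) 0.
Proof.
move=> a; rewrite msuppC; case: eqP => // _; rewrite inE => /eqP->.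
by rewrite mdiv0; apply: lin_eq_refl.
Qed.

Lemma is_homog1 : is_homog eta (1 : {mpoly R[s]}) 0.
Proof. exact: is_homogC. Qed.

Lemma is_homogZ (c : R) f D : is_homog eta f D -> is_homog eta (c *: f) D.
Proof. by move=> hf; move: (is_homogM (is_homogC (c := c)) hf); rewrite add0r mul_mpolyC. Qed.

Lemma is_homog_sum I (r : seq I) (P : pred I) (F : I -> {mpoly R[s]}) D :
  (forall i, P i -> is_homog eta (F i) D) -> is_homog eta (\sum_(i <- r | P i) F i) D.
Proof. by move=> h; apply: (big_ind (fun f : {mpoly R[s]} => is_homog eta f D)) => //; [apply: is_homog0 | move=> *; apply: is_homogD]. Qed.

Lemma is_homog_prod I (r : seq I) (P : pred I) (F : I -> {mpoly R[s]}) (D : I -> 'cV_s) :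
  (forall i, P i -> is_homog eta (F i) (D i)) ->
  is_homog eta (\prod_(i <- r | P i) F i) (\sum_(i <- r | P i) D i).
Proof.
by move=> h; apply: (big_ind2 (fun (f : {mpoly R[s]}) E => is_homog eta f E)) => //;
  [apply: is_homog1 | move=> *; apply: is_homogM].
Qed.

Lemma is_homog_exp f D k : is_homog eta f D -> is_homog eta (f ^+ k) (D *+ k).
Proof.
move=> h; elim: k => [|k IH]; first by rewrite expr0 mulr0n; apply: is_homog1.
by rewrite exprS mulrS; apply: is_homogM.
Qed.

Lemma is_homog_det q (M : 'M[{mpoly R[s]}]_q) (D E : 'I_q -> 'cV_s) :
  (forall i j, is_homog eta (M i j) (D i - E j)) ->
  is_homog eta (\det M) (\sum_i D i - \sum_j E j).
Proof.
move=> h; apply: is_homog_sum => sg _; rewrite -[_ - _]add0r.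
apply: is_homogM.
  have := is_homog_exp (k := perm.odd_perm sg) (is_homogN is_homog1).
  by rewrite mul0rn.
have -> : \sum_i D i - \sum_j E j = \sum_i (D i - E (perm.fun_of_perm sg i)).
  by rewrite [RHS]big_split sumrN /= [\sum_j E j](reindex_inj (@perm.perm_inj _ sg)).
exact: is_homog_prod.
Qed.

End Homogeneous.
End LinearEquivalence.

Section Localization.

Variables (K : fieldType) (n s : nat) (eta : 'M[int]_(s, n)).
Local Notation S := {mpoly K[s]}.
Local Notation ratfun := (rational_fun K s).
Implicit Types (f g h : S) (D E : 'cV[int]_s) (phi psi : ratfun).

Lemma in_loc_lin f D E phi : lin_eq eta D E -> in_loc eta f D phi -> in_loc eta f E phi.
Proof.
move=> h [k [E' [g [hf hg ->]]]]; exists k, E', g; split=> //.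
by apply: is_homog_lin hg; apply: lin_eqD => //; apply: lin_eq_refl.
Qed.

Lemma in_loc_poly f E g D : is_homog eta f E -> is_homog eta g D ->
  in_loc eta f D (of_poly g).
Proof. by move=> hf hg; exists 0, E, g; rewrite mulr0n addr0 expr0 divr1. Qed.

Lemma is_homog_deg_unique f D E : f != 0 -> is_homog eta f D -> is_homog eta f E ->
  lin_eq eta D E.
Proof.
rewrite -msupp_eq0; case e : (msupp f) => [|a r] // _ hD hE.
have af : a \in msupp f by rewrite e inE eqxx.
exact: lin_eq_trans (lin_eq_sym (hD _ af)) (hE _ af).
Qed.

(** The two fractions may record different degrees for [f]; since [f != 0], these are linearly
    equivalent. *)
Lemma in_locM f D E phi psi : f != 0 -> in_loc eta f D phi -> in_loc eta f E psi ->
  in_loc eta f (D + E) (phi * psi).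
Proof.
move=> f0 [k [D' [g [hf hg ->]]]] [l [E' [h [hf' hh ->]]]].
exists (k + l)%N, D', (g * h); split=> //.
  apply: is_homog_lin (is_homogM hg hh); rewrite mulrnDr addrACA.
  apply: lin_eqD; first exact: lin_eq_refl.
  apply: lin_eqD; first exact: lin_eq_refl.
  exact: lin_eqMn (is_homog_deg_unique f0 hf' hf).
by rewrite /of_poly rmorphM exprD invfM mulrACA.
Qed.

Lemma in_loc_inv f h D h' D' : f != 0 -> is_homog eta h D -> is_homog eta h' D' ->
  f = h * h' -> in_loc eta f (- D) (of_poly h)^-1.
Proof.
move=> f0 hh hh' fE; have := f0; rewrite fE mulf_eq0 negb_or => /andP[h0 h'0].
exists 1%N, (D + D'), h'; split; first exact: is_homogM.
  by rewrite mulr1n addKr.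
by rewrite expr1 /of_poly rmorphM invfM mulrCA divff ?mulr1 // tofrac_eq0.
Qed.

Lemma in_locD f D phi psi : f != 0 -> in_loc eta f D phi -> in_loc eta f D psi ->
  in_loc eta f D (phi + psi).
Proof.
move=> f0 [k [D' [g [hf hg ->]]]] [l [E' [h [hf' hh ->]]]].
have hh2 : is_homog eta h (D + D' *+ l).
  apply: is_homog_lin hh; apply: lin_eqD; first exact: lin_eq_refl.
  exact: lin_eqMn (is_homog_deg_unique f0 hf' hf).
exists (k + l)%N, D', (g * f ^+ l + h * f ^+ k); split=> //.
  apply: is_homogD.
    by rewrite mulrnDr addrA; apply: is_homogM => //; apply: is_homog_exp.
  by rewrite addnC mulrnDr addrA; apply: is_homogM => //; apply: is_homog_exp.
have f0' : tofrac f != 0 by rewrite tofrac_eq0.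
by rewrite /of_poly rmorphD !rmorphM !rmorphXn exprD addf_div ?expf_neq0.
Qed.

Lemma in_loc0 f E D : is_homog eta f E -> in_loc eta f D 0.
Proof. by move=> hf; have := in_loc_poly hf (@is_homog0 _ _ eta _ D); rewrite /of_poly rmorph0. Qed.

Lemma in_loc1 f E : is_homog eta f E -> in_loc eta f 0 1.
Proof. by move=> hf; have := in_loc_poly hf (@is_homog1 _ _ eta _); rewrite /of_poly rmorph1. Qed.

Lemma in_loc_sum f E D I (r : seq I) (P : pred I) (F : I -> ratfun) :
  f != 0 -> is_homog eta f E ->
  (forall i, P i -> in_loc eta f D (F i)) -> in_loc eta f D (\sum_(i <- r | P i) F i).
Proof.
by move=> f0 hf h; apply: (big_ind (fun phi => in_loc eta f D phi)) => //; [apply: in_loc0 hf | move=> *; apply: in_locD].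
Qed.

Lemma in_locZ f E D phi (c : ratfun) z : is_homog eta f E -> f != 0 -> c = z%:~R ->
  in_loc eta f D phi -> in_loc eta f D (c * phi).
Proof.
move=> hf f0 -> h; rewrite -[D]add0r; apply: in_locM => //.
have := in_loc_poly hf (@is_homogC _ _ eta _ (z%:~R : K)).
by rewrite /of_poly [_%:MP]rmorph_int rmorph_int.
Qed.

Lemma in_loc_prod f E I (r : seq I) (P : pred I) (F : I -> ratfun) (D : I -> 'cV_s) :
  f != 0 -> is_homog eta f E ->
  (forall i, P i -> in_loc eta f (D i) (F i)) ->
  in_loc eta f (\sum_(i <- r | P i) D i) (\prod_(i <- r | P i) F i).
Proof.
move=> f0 hf h; apply: (big_ind2 (fun phi E => in_loc eta f E phi)) => //.
  exact: in_loc1 hf.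
by move=> *; apply: in_locM.
Qed.

Definition xm (a : 'cV[int]_s) : ratfun := \prod_j of_poly 'X_j ^ a j 0.

Lemma of_polyX_neq0 j : of_poly ('X_j : S) != 0.
Proof. by rewrite /of_poly tofrac_eq0 -msupp_eq0 msuppX. Qed.

Lemma xmD a b : xm (a + b) = xm a * xm b.
Proof. by rewrite -big_split; apply: eq_bigr => j _; rewrite mxE expfzDr ?of_polyX_neq0. Qed.

Lemma xm0 : xm 0 = 1.
Proof. by rewrite /xm big1 // => j _; rewrite mxE expr0z. Qed.

Lemma xm_neq0 a : xm a != 0.
Proof. by apply/prodf_neq0 => j _; apply: expfz_neq0; apply: of_polyX_neq0. Qed.

Lemma xmN a : xm (- a) = (xm a)^-1.
Proof. by apply: (mulfI (xm_neq0 a)); rewrite -xmD subrr xm0 divff ?xm_neq0. Qed.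

Lemma xm_sum I (r : seq I) (P : pred I) (F : I -> 'cV_s) :
  xm (\sum_(i <- r | P i) F i) = \prod_(i <- r | P i) xm (F i).
Proof. exact: (big_morph xm xmD xm0). Qed.

Lemma xmMn a k : xm (a *+ k) = xm a ^+ k.
Proof. by elim: k => [|k IH]; rewrite ?mulr0n ?xm0 // mulrS xmD IH exprS. Qed.

Lemma xmZ (z : int) a : xm (z *: a) = xm a ^ z.
Proof.
have h k : xm (Posz k *: a) = xm a ^+ k by rewrite -[Posz k]natz scaler_nat xmMn.
by case: z => k; rewrite ?NegzE ?scaleNr ?xmN h ?exprnN.
Qed.

Lemma xm_mulmx p (A : 'M[int]_(s, p)) (m : 'cV[int]_p) :
  xm (A *m m) = \prod_l xm (col l A) ^ m l 0.
Proof.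
under eq_bigr do rewrite -xmZ.
rewrite -xm_sum; congr xm; apply/colP=> j; rewrite mxE summxE.
by apply: eq_bigr => l _; rewrite !mxE mulrC.
Qed.

Lemma xm_mdiv (a : 'X_{1..s}) : xm (mdiv a) = of_poly 'X_[a].
Proof.
rewrite mpolyXE_id /of_poly rmorph_prod; apply: eq_bigr => j _ /=.
by rewrite mxE rmorphXn.
Qed.

Definition mnm_of (a : 'cV[int]_s) : 'X_{1..s} := [multinom `|a j 0%R|%N | j < s].

Lemma mnm_ofK (a : 'cV[int]_s) : (forall j, 0 <= a j 0) -> mdiv (mnm_of a) = a.
Proof. by move=> h; apply/colP=> j; rewrite !mxE mnmE gez0_abs. Qed.

Lemma xm_poly (a : 'cV[int]_s) : (forall j, 0 <= a j 0) -> xm a = of_poly 'X_[mnm_of a].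
Proof. by move=> h; rewrite -xm_mdiv mnm_ofK. Qed.

Lemma is_homog_mnm_of (a : 'cV[int]_s) : (forall j, 0 <= a j 0) -> is_homog eta ('X_[mnm_of a] : S) a.
Proof. by move=> h; rewrite -[in X in is_homog _ _ X](mnm_ofK h); apply: is_homogX. Qed.

Lemma in_loc_xm f E (a : 'cV[int]_s) : is_homog eta f E -> (forall j, 0 <= a j 0) ->
  in_loc eta f a (xm a).
Proof. by move=> hf h; rewrite xm_poly //; apply: in_loc_poly hf (is_homog_mnm_of h). Qed.

Lemma xm_inj : injective xm.
Proof.
(* Multiplication by [x^c] makes both exponents nonnegative, so that supports of polynomials can be
   compared. *)
move=> a b ab; pose c : 'cV[int]_s := \col_j (`|a j 0| + `|b j 0|).
have ha j : 0 <= (c + a) j 0 by rewrite !mxE; move: (a j 0) (b j 0) => x y; lia.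
have hb j : 0 <= (c + b) j 0 by rewrite !mxE; move: (a j 0) (b j 0) => x y; lia.
have : xm (c + a) = xm (c + b) by rewrite !xmD ab.
rewrite !xm_poly // /of_poly => /eqP; rewrite tofrac_eq => /eqP e.
have : mnm_of (c + a) \in msupp ('X_[mnm_of (c + b)] : S) by rewrite -e msuppX inE.
rewrite msuppX inE => /eqP e2; apply: (addrI c).
by rewrite -(mnm_ofK ha) -(mnm_ofK hb) e2.
Qed.

End Localization.

(** * Cech cochains *)

Section ScalarCochains.

Variables (L : fieldType) (m : nat).

Definition omit q (t : {ffun 'I_q.+1 -> 'I_m}) (i : 'I_q.+1) : {ffun 'I_q -> 'I_m} :=
  [ffun k => t (lift i k)].

Definition sd q (c : {ffun 'I_q -> 'I_m} -> L) (t : {ffun 'I_q.+1 -> 'I_m}) : L :=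
  \sum_(i < q.+1) (-1) ^+ i * c (omit t i).

Lemma omit_omit q (t : {ffun 'I_q.+2 -> 'I_m}) (i i' : 'I_q.+2) (j j' : 'I_q.+1) :
  (j < i)%N -> i' = j :> nat -> j'.+1 = i :> nat -> omit (omit t i) j = omit (omit t i') j'.
Proof.
move=> ji ei ej; apply/ffunP=> k; rewrite !ffunE; congr (t _); apply: val_inj.
by rewrite /= /bump; lia.
Qed.

Lemma sd_sd q (c : {ffun 'I_q -> 'I_m} -> L) t : sd (sd c) t = 0.
Proof.
rewrite /sd; under eq_bigr do rewrite mulr_sumr.
rewrite pair_bigA /= (bigID (fun p : 'I_q.+2 * 'I_q.+1 => (p.2 < p.1)%N)) /=.
(* Omitting [i] and then [j < i] removes the same two entries as omitting [j] and then [i - 1]; [h]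
   pairs these terms, whose signs are opposite. *)
pose h (p : 'I_q.+2 * 'I_q.+1) : 'I_q.+2 * 'I_q.+1 :=
  (widen_ord (leqnSn _) p.2, inord p.1.-1).
pose h' (p : 'I_q.+2 * 'I_q.+1) : 'I_q.+2 * 'I_q.+1 := (lift ord0 p.2, inord p.1).
rewrite addrC (reindex_onto h h') /=; last first.
  case=> i j /=; rewrite -leqNgt => ij; congr pair; apply: val_inj => /=.
    by rewrite inordK //; move: (ltn_ord j); lia.
  by rewrite inordK /bump /= //; move: (ltn_ord j); lia.
rewrite (eq_bigl (fun p : 'I_q.+2 * 'I_q.+1 => (p.2 < p.1)%N)); last first.
  case=> i j; have hi := ltn_ord i; have hj := ltn_ord j.
  have e : (inord i.-1 : 'I_q.+1) = i.-1 :> nat by rewrite inordK //; lia.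
  rewrite /h /h' /= e -leqNgt; apply/idP/idP.
    by case/andP=> hij /eqP[/(congr1 val) /=]; rewrite /bump e; lia.
  move=> ji; apply/andP; split; first lia.
  by apply/eqP; congr pair; apply: val_inj => /=; rewrite ?e ?inordK /bump /=; lia.
rewrite -big_split big1 //= => -[i j] /= ji.
have hi := ltn_ord i; have hj := ltn_ord j.
have e : (inord i.-1 : 'I_q.+1) = i.-1 :> nat by rewrite inordK //; lia.
rewrite (@omit_omit _ t i (widen_ord (leqnSn _) j) j (inord i.-1)) ?e //; try lia.
rewrite /=; set x := c _; have -> : (-1 : L) ^+ i = - (-1) ^+ i.-1.
  by rewrite -[in LHS](prednK (_ : 0 < i)%N) ?exprS ?mulN1r //; lia.
by ring.
Qed.

Lemma prod_omit q (f : 'I_m -> L) (t : {ffun 'I_q.+1 -> 'I_m}) (i : 'I_q.+1) :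
  \prod_k f (t k) = f (t i) * \prod_k f (omit t i k).
Proof. by rewrite (bigD1_ord i) //=; congr (_ * _); apply: eq_bigr => k _; rewrite ffunE. Qed.

Variables (n : nat) (a : 'I_m -> 'I_n.+1 -> L) (z : 'I_n.+1 -> L) (f : 'I_m -> L).

Definition detc (t : {ffun 'I_n.+1 -> 'I_m}) : L :=
  \det (\matrix_(i, j) a (t i) j) / \prod_k f (t k).

(** The sign is the part of the cofactor sign [(-1)^(i + n)] along the last column that does not
    depend on the row; the rest is the sign of the coboundary. *)
Definition minorc (u : {ffun 'I_n -> 'I_m}) : L :=
  (-1) ^+ n * \det (\matrix_(i < n, j < n) a (u i) (lift ord_max j)) /
    (z ord_max * \prod_k f (u k)).

(** Cramer's rule for the last unknown: the last row of [adj A * A * z] expresses [det A * z_{n+1}]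
    through the [f (t i)] and the cofactors of the last column, and [f (t i)] cancels against the
    denominator. *)
Lemma detc_sd t : (forall k, f k = \sum_i a k i * z i) -> (forall k, f k != 0) ->
  z ord_max != 0 -> detc t = sd minorc t.
Proof.
move=> fE f0 z0; rewrite /detc; set A := \matrix_(i, j) _.
have : \adj A *m (A *m \col_i z i) = \adj A *m \col_i f (t i).
  by congr (_ *m _); apply/colP=> i; rewrite !mxE fE; apply: eq_bigr => j _; rewrite !mxE.
rewrite mulmxA mul_adj_mx => /(congr1 (fun B : 'cV_n.+1 => B ord_max 0)).
rewrite mul_scalar_mx !mxE => e.
apply: (mulfI z0); rewrite mulrA [z _ * _]mulrC e mulr_suml /sd mulr_sumr.
apply: eq_bigr => i _; rewrite !mxE /cofactor /minorc (prod_omit _ _ i) exprD.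
have -> : row' i (col' ord_max A) = \matrix_(k, j) a (omit t i k) (lift ord_max j).
  by apply/matrixP=> k j; rewrite !mxE ffunE.
set d := \det _; set p := \prod_k _.
have p0 : p != 0 by apply/prodf_neq0.
by field; rewrite z0 p0 f0.
Qed.

End ScalarCochains.

Section FormCochains.

Variables (K : fieldType) (n s : nat) (eta : 'M[int]_(s, n)).
Local Notation S := {mpoly K[s]}.
Local Notation ratfun := (rational_fun K s).

Definition scoch m q (c : {ffun 'I_q -> 'I_m} -> ratfun) : cech_cochain K n s m q :=
  [ffun t => c t *: Omega K eta].

Lemma cech_d_scoch m q (c : {ffun 'I_q -> 'I_m} -> ratfun) :
  cech_d (scoch c) = scoch (sd c).
Proof.
apply/ffunP=> t; rewrite !ffunE /sd scaler_suml; apply: eq_bigr => i _.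
by rewrite ffunE scalerA.
Qed.

Lemma eq_scoch m q (c c' : {ffun 'I_q -> 'I_m} -> ratfun) :
  c =1 c' -> scoch c = scoch c'.
Proof. by move=> h; apply/ffunP=> t; rewrite !ffunE h. Qed.

(** Only [c] has to be regular. The primitive [b] is formal, with arbitrary denominators, so the
    class need not be trivial. *)
Lemma scoch_cocycle m q (f : 'I_m -> S) (c : {ffun 'I_q.+1 -> 'I_m} -> ratfun) b :
  (forall t : {ffun 'I_q.+1 -> 'I_m},
     in_loc eta (\prod_k f (t k)) (- beta0 s) (c t)) -> c =1 sd b ->
  is_cocycle eta f (scoch c).
Proof.
move=> h e; split; first by move=> t; exists (c t); [apply: h | rewrite ffunE].
rewrite cech_d_scoch; apply/ffunP=> t; rewrite !ffunE.
suff -> : sd c t = 0 by rewrite scale0r.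
by rewrite -(sd_sd b t); apply: eq_bigr => i _; rewrite e.
Qed.

Lemma cech_pull_cocycle m m' q (r : 'I_m' -> 'I_m) (f : 'I_m -> S) (c : cech_cochain K n s m q) :
  is_cocycle eta f c -> is_cocycle eta (f \o r) (cech_pull r c).
Proof.
case=> h1 h2; split.
  move=> t; rewrite ffunE; have := h1 [ffun k => r (t k)].
  by under eq_bigr do rewrite ffunE.
apply/ffunP=> t; rewrite !ffunE.
have /ffunP/(_ [ffun k => r (t k)]) := h2; rewrite !ffunE => e; rewrite -[RHS]e.
apply: eq_bigr => i _; rewrite ffunE; congr (_ *: c _).
by apply/ffunP=> k; rewrite !ffunE.
Qed.

Lemma cech_pull_scoch m m' q (r : 'I_m' -> 'I_m) (c : {ffun 'I_q -> 'I_m} -> ratfun) :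
  cech_pull r (scoch c) = scoch (fun t => c [ffun k => r (t k)]).
Proof. by apply/ffunP=> t; rewrite !ffunE. Qed.

End FormCochains.

(** * Lattice points of parallelepipeds *)

Section LineCube.

Variables (F : realFieldType) (I : finType) (a : I -> F).
Implicit Types (r : I -> F).

(** The line is [x |-> a + x * r], and all times are values of the parameter [x]. *)
Definition cube_time r (c : F) i := (c - a i) / r i.
Definition enter_time r i := if 0 < r i then cube_time r 0 i else cube_time r 1 i.
Definition leave_time r i := if 0 < r i then cube_time r 1 i else cube_time r 0 i.
Definition on_face r (x : F) i := [forall k, (k != i) ==> (0 < a k + x * r k < 1)].
(** A criterion in terms of times, rather than a point of intersection, is visibly invariant under
    reversal of the line, which exchanges entries and exits. *)
Definition meets_cube r :=
  [forall k, (r k == 0) ==> (0 < a k < 1)] &&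
  [forall i, forall k, (r i != 0) && (r k != 0) ==> (enter_time r i < leave_time r k)].

Lemma in_cubeE r k x : r k != 0 -> (0 < a k + x * r k < 1) = (enter_time r k < x < leave_time r k).
Proof.
move=> r0; rewrite /enter_time /leave_time /cube_time; case: (ltrgt0P (r k)) r0 => // rk _.
  by rewrite ltr_pdivrMr // ltr_pdivlMr //; congr andb; apply/idP/idP; lra.
by rewrite ltr_ndivrMr // ltr_ndivlMr // andbC; congr andb; apply/idP/idP; lra.
Qed.

Lemma enter_leave r i : r i != 0 -> enter_time r i < leave_time r i.
Proof.
move=> r0; rewrite /enter_time /leave_time /cube_time; case: (ltrgt0P (r i)) r0 => // rk _.
  by rewrite ltr_pM2r ?invr_gt0 //; lra.
by rewrite ltr_nM2r ?invr_lt0 //; lra.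
Qed.

(** The line can enter the cube only through the facet with the latest entry time, and general
    position makes this maximum strict. It does enter there exactly when no exit has occurred
    before. *)
Lemma enter_sum r : (exists i, r i != 0) ->
  (forall i k (c c' : F), i != k -> r i != 0 -> c \in [:: 0; 1] -> c' \in [:: 0; 1] ->
     a k + cube_time r c i * r k != c') ->
  \sum_(i | r i != 0%R) (on_face r (enter_time r i) i)%:R = (meets_cube r)%:R%R :> int%type.
Proof.
move=> [i1 ri1] gen; case: (boolP (meets_cube r)) => [/andP[/forallP Q1 /forallP Q2]|nQ].
  have [i0 ri0 max0] := @Order.TotalTheory.arg_maxP _ _ _ i1 (fun i => r i != 0) (enter_time r) ri1.
  have max1 k : r k != 0 -> enter_time r k <= enter_time r i0 by apply: max0.
  have Q2' i k : r i != 0 -> r k != 0 -> enter_time r i < leave_time r k.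
    by move=> ri rk; move: (Q2 i) => /forallP/(_ k); rewrite ri rk.
  rewrite (bigD1 i0) //= big1 => [|i /andP[ri ii0]].
    rewrite addr0; suff -> : on_face r (enter_time r i0) i0 by [].
    apply/forallP=> k; apply/implyP=> ki0; have [rk|rk] := eqVneq (r k) 0.
      by rewrite rk mulr0 addr0; move: (Q1 k); rewrite rk eqxx.
    rewrite in_cubeE // Q2' // andbT lt_neqAle max1 // andbT.
    (* Equal entry times would place one point of the line on two facet hyperplanes, against
       [gen]. *)
    apply/eqP=> e; have := @enter_leave r k rk; rewrite e.
    move: (gen i0 k (if 0 < r i0 then 0 else 1) (if 0 < r k then 0 else 1)).
    rewrite eq_sym ki0 ri0 => /(_ isT isT).
    have -> : cube_time r (if 0 < r i0 then 0 else 1) i0 = enter_time r i0.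
      by rewrite /enter_time; case: ifP.
    rewrite -e => /(_ _ _)/eqP[]; try by case: ifP; rewrite !inE eqxx ?orbT.
    rewrite /enter_time /cube_time; case: ifP => _; rewrite divfK //; ring.
  case: (boolP (on_face _ _ _)) => // /forallP/(_ i0).
  by rewrite eq_sym ii0 in_cubeE //= => /andP[h _]; move: (max1 i ri); rewrite leNgt h.
rewrite big1 // => i ri; case: (boolP (on_face _ _ _)) => // /forallP h.
have h' k : r k != 0 -> enter_time r k <= enter_time r i < leave_time r k.
  have [->|ki] := eqVneq k i; first by rewrite lexx; apply: enter_leave.
  by move=> rk; move: (h k); rewrite ki in_cubeE //= => /andP[/ltW -> ->].
case/negP: nQ; apply/andP; split; apply/forallP=> k.
  apply/implyP=> /eqP rk; move: (h k); rewrite rk mulr0 addr0.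
  by have [ki|] := eqVneq k i; first by rewrite -ki rk eqxx in ri.
apply/forallP=> l; apply/implyP=> /andP[rk rl].
have /andP[h1 _] := h' k rk; have /andP[_ h2] := h' l rl.
exact: le_lt_trans h1 h2.
Qed.

(* A line in general position enters the cube through one face and leaves it
   through another one. *)
Lemma line_cube r : (exists i, r i != 0) ->
  (forall i k (c c' : F), i != k -> r i != 0 -> c \in [:: 0; 1] -> c' \in [:: 0; 1] ->
     a k + cube_time r c i * r k != c') ->
  \sum_(i | r i != 0) sgz (r i) *
     ((on_face r (cube_time r 1 i) i)%:R - (on_face r (cube_time r 0 i) i)%:R) = 0.
Proof.
move=> ri gen; pose r' i := - r i.
have tE c i : cube_time r' c i = - cube_time r c i by rewrite /cube_time /r' invrN mulrN.
have faceE x i : on_face r' (- x) i = on_face r x i.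
  by apply: eq_forallb => k; rewrite /r' mulrNN.
have enterE i : r i != 0 -> enter_time r' i = - leave_time r i.
  move=> r0; rewrite /enter_time /leave_time !tE /r' oppr_gt0.
  by case: (ltrgt0P (r i)) r0.
have leaveE i : r i != 0 -> leave_time r' i = - enter_time r i.
  move=> r0; rewrite /enter_time /leave_time !tE /r' oppr_gt0.
  by case: (ltrgt0P (r i)) r0.
have r'0 i : (r' i != 0) = (r i != 0) by rewrite /r' oppr_eq0.
have e1 := enter_sum ri gen.
have : \sum_(i | r' i != 0%R) (on_face r' (enter_time r' i) i)%:R = (meets_cube r')%:R%R :> int%type.
  apply: enter_sum; first by case: ri => i; exists i; rewrite r'0.
  by move=> i k c c' ik; rewrite r'0 tE /r' mulrNN; apply: gen.
have -> : meets_cube r' = meets_cube r.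
  congr andb; first by apply: eq_forallb => k; rewrite /r' oppr_eq0.
  apply/forallP/forallP => h i; apply/forallP=> k; apply/implyP=> /andP[h1 h2].
    by move: (h k) => /forallP/(_ i); rewrite !r'0 h1 h2 enterE ?leaveE // ltrN2.
  by rewrite !r'0 in h1 h2; move: (h k) => /forallP/(_ i); rewrite h1 h2 enterE ?leaveE // ltrN2.
rewrite -e1 (eq_bigl _ _ r'0) => /eqP; rewrite -subr_eq0 -sumrB => /eqP e; rewrite -[RHS]e.
apply: eq_bigr => i r0; rewrite enterE // faceE /enter_time /leave_time.
case: (ltrgt0P (r i)) r0 => // h _; first by rewrite gtr0_sgz // mul1r.
by rewrite ltr0_sgz // mulN1r opprB.
Qed.

End LineCube.
Section SignedMinors.

Variables (R : comPzRingType) (n : nat) (T : 'M[R]_(n.+1, n)).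

Definition minors : 'rV[R]_n.+1 := \row_i ((-1) ^+ i * \det (row' i T)).

(** Entry [j] is the expansion, along its first column, of the determinant of [T] with column [j]
    repeated in front. *)
Lemma minors_mul : minors *m T = 0.
Proof.
apply/rowP=> j; rewrite mxE [RHS]mxE.
pose B : 'M_n.+1 := \matrix_(i, k) if unlift ord0 k is Some k' then T i k' else T i j.
have : \det B^T = 0.
  apply: (@determinant_alternate _ _ _ ord0 (lift ord0 j)); first by rewrite neq_lift.
  by move=> i; rewrite !mxE unlift_none liftK.
rewrite det_tr (expand_det_col _ ord0) => e; rewrite -[RHS]e; apply: eq_bigr => i _.
rewrite !mxE unlift_none /cofactor addn0 mulrC; congr (_ * (_ * \det _)).
by apply/matrixP=> k l; rewrite !mxE liftK.
Qed.

End SignedMinors.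

Section LatticePoints.

Variable n : nat.
Implicit Types (M : 'M[int]_n) (mu : 'rV[int]_n) (v y : 'rV[rat]_n).

Definition ratm p q (M : 'M[int]_(p, q)) : 'M[rat]_(p, q) := map_mx intr M.

(* Meaningful only if [\det M != 0]: [invmx A] is [A] for singular [A]. *)
Definition coords M y : 'rV[rat]_n := y *m invmx (ratm M).

Definition in_pip v M mu := [forall i, 0 < coords M (ratm mu - v) 0 i < 1].

Definition generic v M := forall i, 0 < `|coords M v 0 i * (\det M)%:~R| < 1.

Lemma ratm_unit M : (ratm M \in unitmx) = (\det M != 0).
Proof. by rewrite unitmxE /ratm det_map_mx unitfE intr_eq0. Qed.

Lemma coordsK M y : \det M != 0 -> coords M y *m ratm M = y.
Proof. by rewrite -ratm_unit => h; rewrite /coords mulmxKV. Qed.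

Lemma mul_coords M y : \det M != 0 -> coords M (y *m ratm M) = y.
Proof. by rewrite -ratm_unit => h; rewrite /coords mulmxK. Qed.

Lemma coordsB M y y' : coords M (y - y') = coords M y - coords M y'.
Proof. by rewrite /coords mulmxBl. Qed.

Lemma coords_adj M y : \det M != 0 -> (\det M)%:~R *: coords M y = y *m ratm (\adj M).
Proof.
move=> h; rewrite /coords /invmx ratm_unit h -scalemxAr scalerA det_map_mx divff ?intr_eq0 //.
by rewrite scale1r /ratm map_mx_adj.
Qed.

(** By the adjugate, [det M] times a coordinate of a lattice point is an integer, while for [v] it
    lies strictly between 0 and 1 in absolute value. So no lattice point lies on a wall of a shifted
    parallelepiped. *)
Lemma coords_nonint v M mu i (c : int) : \det M != 0 -> generic v M ->
  coords M (ratm mu - v) 0 i != c%:~R.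
Proof.
move=> h /(_ i) g; apply/eqP => e.
have e2 : coords M v 0 i * (\det M)%:~R = (((mu *m \adj M) 0 i - c * \det M))%:~R.
  have e1 : coords M v 0 i = coords M (ratm mu) 0 i - c%:~R.
    by rewrite -e coordsB !mxE opprB addrC subrK.
  rewrite e1 mulrBl rmorphB rmorphM; congr (_ - _).
  have := congr1 (fun B : 'rV_n => B 0 i) (coords_adj (ratm mu) h).
  by rewrite /= mxE mulrC => ->; rewrite /ratm -map_mxM mxE.
move: g; rewrite e2 -intr_norm; set x := (_ - _).
by rewrite (ltr0z) (ltrz1); lia.
Qed.

(** A finite window on the lattice. Every sum below has finite support, and [B] only has to be large
    enough to contain the parallelepipeds in play and their translates. *)
Definition box (B : nat) : seq 'rV[int]_n :=
  [seq \row_j ((f j : nat)%:Z - B%:Z) | f : {ffun 'I_n -> 'I_(B + B).+1} <- enum {: {ffun 'I_n -> 'I_(B + B).+1}}].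

Lemma box_uniq B : uniq (box B).
Proof.
rewrite map_inj_uniq ?enum_uniq // => f g /rowP h; apply/ffunP=> j; apply: val_inj.
by have := h j; rewrite !mxE /=; lia.
Qed.

Lemma mem_box B mu : (mu \in box B) = [forall j, (`|mu 0%R j| <= B)%N].
Proof.
apply/mapP/forallP => [[f _ ->] j|h].
  by rewrite !mxE; move: (ltn_ord (f j)); move: (nat_of_ord (f j)) => x; lia.
exists [ffun j => inord `|(mu 0%R j + B%:Z)%R|%N]; first by rewrite mem_enum.
apply/rowP=> j; have := h j; rewrite !mxE ffunE; move: (mu 0 j) => x hx.
by rewrite inordK ?gez0_abs ?addrK //; lia.
Qed.

Variables (L : comNzRingType) (chi : 'rV[int]_n -> L).
Hypothesis chiD : forall mu nu, chi (mu + nu) = chi mu * chi nu.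

Definition pip_sum v B M : L := \sum_(mu <- box B | in_pip v M mu) chi mu.

Lemma pip_sum_shift v B M (m : 'rV[int]_n) :
  (forall mu, in_pip v M mu -> forall j, (`|mu 0%R j| + `|m 0%R j| <= B)%N) ->
  pip_sum v B M * chi m = \sum_(mu <- box B | in_pip v M (mu - m)) chi mu.
Proof.
move=> h; rewrite /pip_sum mulr_suml -big_filter -[RHS]big_filter.
have -> : \sum_(mu <- [seq mu <- box B | in_pip v M mu]) chi mu * chi m =
  \sum_(mu <- [seq mu + m | mu <- [seq mu <- box B | in_pip v M mu]]) chi mu.
  by rewrite big_map; apply: eq_bigr => mu _; rewrite chiD.
apply: perm_big; apply: uniq_perm; first by rewrite map_inj_uniq ?filter_uniq ?box_uniq //; apply: addIr.
  by rewrite filter_uniq ?box_uniq.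
move=> mu; rewrite mem_filter; apply/mapP/andP.
  case=> nu; rewrite mem_filter => /andP[pn _] ->; rewrite addrK; split=> //.
  by rewrite mem_box; apply/forallP=> j; have := h _ pn j; rewrite !mxE; move: (nu 0 j) (m 0 j) => x y; lia.
case=> pm hmu; exists (mu - m); last by rewrite subrK.
rewrite mem_filter pm mem_box; apply/forallP=> j.
by have := h _ pm j; rewrite !mxE; move: (mu 0 j) (m 0 j) => x y; lia.
Qed.

Section Cocycle.

Variables (v : 'rV[rat]_n) (T : 'M[int]_(n.+1, n)).
Hypothesis gen : forall i, \det (row' i T) != 0 -> generic v (row' i T).

Let r (i : 'I_n.+1) : rat := (minors T 0 i)%:~R.

(* [T] projects R^{n+1} to R^n; its fibre over [mu - v] is a line directed by the
   minors of [T], to which [line_cube] applies. *)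
Lemma pip_boundary mu :
  \sum_i sgz (minors T 0 i) *
    ((in_pip v (row' i T) (mu - row i T))%:R - (in_pip v (row' i T) mu)%:R) = 0.
Proof.
pose y := ratm mu - v.
have rE i : (r i != 0) = (\det (row' i T) != 0).
  by rewrite /r intr_eq0 mxE mulf_eq0 signr_eq0.
have [/existsP[i0 ri0]|/existsPn nr] := boolP [exists i, r i != 0]; last first.
  rewrite big1 // => i _; have := nr i; rewrite negbK /r intr_eq0 => /eqP ->.
  by rewrite sgz0 mul0r.
have rT : \row_i r i *m ratm T = 0.
  have -> : \row_i r i = ratm (minors T) by apply/rowP=> i; rewrite [LHS]mxE [RHS]mxE.
  by rewrite /ratm -map_mxM minors_mul map_mx0.
have splitT (x : 'rV[rat]_n.+1) i : x *m ratm T = x 0 i *: ratm (row i T) + col' i x *m ratm (row' i T).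
  apply/rowP=> j; rewrite !mxE (bigD1_ord i) //=; congr (_ + _); first by rewrite !mxE.
  by apply: eq_bigr => k _; rewrite !mxE.
have uniq_coords (x : 'rV[rat]_n.+1) i : r i != 0 -> x *m ratm T = y ->
    forall k, x 0 (lift i k) = coords (row' i T) (y - x 0 i *: ratm (row i T)) 0 k.
  move=> ri xT k; rewrite -xT (splitT _ i) addrC addKr mul_coords -?rE //.
  by rewrite mxE.
have [a aT] : exists a : 'rV[rat]_n.+1, a *m ratm T = y.
  exists (\row_i (if unlift i0 i is Some k then coords (row' i0 T) y 0 k else 0)).
  rewrite (splitT _ i0) mxE unlift_none scale0r add0r -[RHS](@coordsK (row' i0 T)) -?rE //.
  by congr (_ *m _); apply/rowP=> k; rewrite [LHS]mxE mxE liftK.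
have aTr (c : rat) i : r i != 0 -> let x := a + (cube_time (a 0) r c i) *: \row_i r i in
    x *m ratm T = y /\ x 0 i = c.
  move=> ri /=; split; first by rewrite mulmxDl aT -scalemxAl rT scaler0 addr0.
  by rewrite !mxE /cube_time divfK //; ring.
have ptE c i k : (a + (cube_time (a 0) r c i) *: \row_i r i) 0 k = a 0 k + cube_time (a 0) r c i * r k.
  by rewrite !mxE.
(* At the point of the fibre whose coordinate [i] is [c], the other coordinates are those of
   [mu - c *: row i T - v] in the basis [row' i T]. Crossing a facet is therefore membership in a
   parallelepiped. *)
have faceE (c : int) i : r i != 0 ->
    on_face (a 0) r (cube_time (a 0) r c%:~R i) i = in_pip v (row' i T) (mu - c *: row i T).
  move=> ri; have [h1 h2] := aTr c%:~R i ri; have := uniq_coords _ i ri h1; rewrite h2 => h3.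
  have e : ratm (mu - c *: row i T) - v = y - c%:~R *: ratm (row i T).
    by rewrite /ratm map_mxB map_mxZ /y addrAC.
  apply/forallP/forallP => [h k|h k].
    by rewrite e -h3 ptE; move: (h (lift i k)); rewrite eq_sym neq_lift.
  apply/implyP=> ki; case: (unliftP i k) ki => [k' ->|->] ki; last by rewrite eqxx in ki.
  by have := h k'; rewrite e -h3 ptE.
rewrite (bigID (fun i => r i != 0)) /= [X in _ + X]big1 ?addr0 => [|i]; last first.
  by rewrite negbK /r intr_eq0 => /eqP ->; rewrite sgz0 mul0r.
rewrite -[RHS](@line_cube _ _ (a 0) r).
- apply: eq_bigr => i ri; rewrite (faceE 1) // (faceE 0) //.
  by rewrite scale1r scale0r subr0 /r sgz_int.
- by exists i0.
(* General position of the fibre: a second coordinate equal to 0 or 1 would be an integral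
   coordinate of a shifted lattice point. *)
move=> i k c c' ik ri hc hc'; apply/eqP => e.
have [c1 ec] : exists c1 : int, c = c1%:~R.
  by move: hc; rewrite !inE => /orP[]/eqP->; [exists 0|exists 1].
have [c2 ec'] : exists c1 : int, c' = c1%:~R.
  by move: hc'; rewrite !inE => /orP[]/eqP->; [exists 0|exists 1].
case: (unliftP i k) ik e => [k' ->|->]; last by rewrite eqxx.
move=> _ e; have [h1 h2] := aTr c i ri; have := uniq_coords _ i ri h1 k'.
rewrite h2 ptE e ec' => /esym/eqP; apply/negP.
have -> : y - c *: ratm (row i T) = ratm (mu - c1 *: row i T) - v.
  by rewrite /ratm map_mxB map_mxZ /y ec addrAC.
by rewrite rE in ri; apply: coords_nonint => //; apply: gen.
Qed.

(** This is the vanishing of the coboundary of [sgz (det M) * pip_sum M / prod (chi (row k M) - 1)],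
    with denominators cleared. Multiplication by [chi (row i T) - 1] compares a parallelepiped with
    its translate, and the coefficient of each [chi mu] is [pip_boundary]. *)
Lemma pip_cocycle B :
  (forall i mu, \det (row' i T) != 0 -> in_pip v (row' i T) mu ->
     forall j, (`|mu 0%R j| + `|T i j| <= B)%N) ->
  \sum_(i < n.+1) (-1) ^+ i * (sgz (\det (row' i T)))%:~R *
     pip_sum v B (row' i T) * (chi (row i T) - 1) = 0.
Proof.
move=> hB.
transitivity (\sum_i \sum_(mu <- box B) (sgz (minors T 0 i) *
    ((in_pip v (row' i T) (mu - row i T))%:R - (in_pip v (row' i T) mu)%:R))%:~R * chi mu).
  apply: eq_bigr => i _.
  have -> : (-1) ^+ i * (sgz (\det (row' i T)))%:~R = (sgz (minors T 0 i))%:~R :> L.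
    rewrite mxE sgzM rmorphM; congr (_ * _); rewrite -signr_odd -[in RHS]signr_odd.
    by case: (odd i); rewrite ?expr0 ?expr1 ?sgz1 // sgzN sgz1.
  have [d0|d0] := eqVneq (\det (row' i T)) 0.
    rewrite mxE d0 mulr0 sgz0 !mul0r big1 // => mu _; by rewrite !mul0r.
  rewrite -mulrA mulrBr mulr1 pip_sum_shift => [|mu pm j]; last first.
    by have := hB i mu d0 pm j; rewrite !mxE.
  rewrite /pip_sum big_mkcond [X in _ - X]big_mkcond -sumrB mulr_sumr /=; apply: eq_bigr => mu _.
  rewrite rmorphM -mulrA; congr (_ * _); rewrite rmorphB mulrBl.
  by do 2!case: (in_pip _ _ _); rewrite ?mul1r ?mul0r.
rewrite exchange_big big1 //= => mu _; rewrite -mulr_suml -[\sum_i _](rmorph_sum intr).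
by rewrite pip_boundary mul0r.
Qed.

End Cocycle.

Lemma in_pip_bound v C M mu : \det M != 0 -> (forall j, `|v 0 j| <= 1) ->
  (forall i j, (`|M i j| <= C)%N) -> in_pip v M mu -> forall j, (`|mu 0%R j| <= n * C + 1)%N.
Proof.
move=> dM hv hM /forallP h j.
have : ratm mu - v = coords M (ratm mu - v) *m ratm M by rewrite coordsK.
move=> /rowP/(_ j); rewrite !mxE => e.
have : `|(mu 0 j)%:~R : rat| <= (n * C + 1)%:R.
  rewrite -[_%:~R](subrK (v 0 j)) e natrD; apply: le_trans (ler_normD _ _) _.
  apply: lerD; last exact: hv.
  apply: le_trans (ler_norm_sum _ _ _) _.
  rewrite natrM -[in X in X%:R * _](card_ord n) mulr_natl -sumr_const; apply: ler_sum => i _.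
  have /andP[h0 h1] := h i; rewrite normrM [ratm M i j]mxE -[C%:R]mul1r; apply: ler_pM => //.
    by rewrite gtr0_norm // ltW.
  by rewrite -intr_norm pmulrn ler_int; have := hM i j; lia.
by rewrite -intr_norm pmulrn ler_int; move: (mu 0 j) => x; lia.
Qed.

End LatticePoints.

(** * Infinitesimal shifts *)

Section Infinitesimal.

Variable n : nat.
Implicit Types (M : 'M[int]_n) (mu : 'rV[int]_n) (v : 'rV[rat]_n) (w : 'cV[rat]_n).

(** The lowest power of eps in the pairing of [w] with [(eps^n, ..., eps)] comes from the last
    nonzero entry, which therefore decides the sign. *)
Definition last_pos w := exists2 k, 0 < w k 0 & forall k' : 'I_n, (k < k')%N -> w k' 0 = 0.

(* [v] behaves like (eps^n, ..., eps^2, eps) with eps infinitesimal, on integral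
   functionals with entries bounded by [L]. *)
Definition infinitesimal (L : nat) v :=
  (forall j, `|v 0 j| <= 1) /\
  forall c : 'cV[int]_n, (forall k, (`|c k 0%R| <= L)%N) ->
    `|(v *m ratm c) 0 0| < 1 /\ (last_pos (ratm c) -> 0 < (v *m ratm c) 0 0).

Lemma infinitesimal_exists L : exists v, infinitesimal L v.
Proof.
(* With [n * L * e < 1], at most n terms of higher order with coefficients bounded by [L] stay below
   the leading power of [e]. *)
pose e : rat := (n * L + 2)%:R^-1.
have e0 : 0 < e by rewrite invr_gt0 ltr0n addn2.
have eL : (n * L)%:R * e < 1 by rewrite ltr_pdivrMr ?ltr0n ?addn2 // mul1r ltr_nat; lia.
have e1 : e <= 1 by rewrite invf_le1 ?ltr0n ?ler1n addn2.
exists (\row_j e ^+ (n - j)); split=> [j|c hc].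
  by rewrite mxE ger0_norm ?exprn_ge0 ?exprn_ile1 // ltW.
have cE k : `|(c k 0)%:~R| <= L%:R :> rat.
  by rewrite -intr_norm pmulrn ler_int; have := hc k; lia.
have vE : ((\row_j e ^+ (n - j)) *m ratm c) 0 0 = \sum_(j < n) e ^+ (n - j) * (c j 0)%:~R.
  by rewrite mxE; apply: eq_bigr => j _; rewrite !mxE.
split; rewrite vE.
  apply: le_lt_trans eL; apply: le_trans (ler_norm_sum _ _ _) _.
  rewrite natrM -mulrA -[X in X%:R * _](card_ord n) mulr_natl -sumr_const.
  apply: ler_sum => j _; rewrite normrM mulrC; apply: ler_pM; rewrite ?cE //.
  rewrite ger0_norm ?exprn_ge0 ?(ltW e0) //.
  have -> : (n - j)%N = (n - j).-1.+1 by have := ltn_ord j; lia.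
  by rewrite exprS ler_piMr ?exprn_ile1 ?(ltW e0).
case=> k; rewrite mxE => ck hk.
have ck1 : 1 <= (c k 0)%:~R :> rat by rewrite ltr0z in ck; rewrite (ler_int _ 1).
rewrite (bigD1 k) //=.
have : e ^+ (n - k) <= e ^+ (n - k) * (c k 0)%:~R by rewrite ler_peMr // exprn_ge0 // ltW.
suff : `|\sum_(i < n | i != k) e ^+ (n - i) * (c i 0)%:~R| < e ^+ (n - k).
  by rewrite ltr_norml => /andP[h1 h2] h3; lra.
apply: le_lt_trans (ler_norm_sum _ _ _) _.
apply: (@le_lt_trans _ _ (\sum_(i < n) e ^+ (n - k).+1 * L%:R)).
  rewrite [X in _ <= X](bigD1 k) //= -[X in X <= _]add0r.
  apply: lerD; first by rewrite mulr_ge0 // exprn_ge0 // ltW.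
  apply: ler_sum => i ik; rewrite normrM ger0_norm ?exprn_ge0 ?(ltW e0) //.
  have [ki|ik'] := ltnP k i.
    have := hk _ ki; rewrite mxE => ->.
    by rewrite normr0 mulr0 mulr_ge0 // exprn_ge0 // ltW.
  apply: ler_pM; rewrite ?cE ?exprn_ge0 ?(ltW e0) //.
  rewrite ler_wiXn2l // ?(ltW e0) //.
  have : (i < k)%N by rewrite ltn_neqAle ik' andbT; apply: contra ik => /eqP h; apply/eqP/val_inj.
  by have := ltn_ord k; lia.
rewrite sumr_const card_ord -mulrnAr -mulr_natr -natrM exprSr -mulrA.
rewrite -[X in _ < X]mulr1 ltr_pM2l ?exprn_gt0 //.
by rewrite mulrC mulnC.
Qed.

Lemma last_posP w : w != 0 -> last_pos w \/ last_pos (- w).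
Proof.
case/cV0Pn=> i0 hi0.
have [k wk max_k] := @arg_maxnP _ i0 (fun i => w i 0 != 0) val hi0.
have hk (k' : 'I_n) : (k < k')%N -> w k' 0 = 0.
  by move=> kk'; apply/eqP; apply: contraTT kk' => /max_k /=; rewrite -leqNgt.
case: (ltrgt0P (w k 0)) wk => // h _; [left|right]; exists k => //; rewrite ?mxE ?oppr_gt0 //.
by move=> k' /hk; rewrite !mxE => ->; rewrite oppr0.
Qed.

Lemma last_posZ a w : 0 < a -> last_pos w -> last_pos (a *: w).
Proof.
move=> a0 [k wk hk]; exists k; first by rewrite mxE mulr_gt0.
by move=> k' /hk e; rewrite mxE e mulr0.
Qed.

Section Coordinates.

Variables (L : nat) (v : 'rV[rat]_n) (M : 'M[int]_n).
Hypothesis vL : infinitesimal L v.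
Hypothesis dM : \det M != 0.
Hypothesis adjL : forall i j, (`|(\adj M) i j| <= L)%N.

Let W := invmx (ratm M).

Lemma ratm_inj p q : injective (@ratm p q).
Proof.
move=> A B e; apply/matrixP=> i j; apply: (@intr_inj rat).
by have := congr1 (fun C : 'M_(p, q) => C i j) e; rewrite !mxE.
Qed.

Lemma ratm_sum_rows p q (A : 'M[int]_(p, q)) :
  ratm (\sum_i row i A) = const_mx 1 *m ratm A.
Proof.
apply/rowP=> j; rewrite !mxE summxE rmorph_sum; apply: eq_bigr => i _.
by rewrite !mxE mul1r.
Qed.

Lemma ratmN p q (N : 'M[int]_(p, q)) : ratm (- N) = - ratm N.
Proof. exact: map_mxN. Qed.

Lemma dot_adj i : (v *m ratm (col i (\adj M))) 0 0 = (\det M)%:~R * coords M v 0 i.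
Proof.
have := congr1 (fun B : 'rV_n => B 0 i) (coords_adj v dM).
by rewrite /= mxE => ->; rewrite !mxE; apply: eq_bigr => j _; rewrite !mxE.
Qed.

Lemma col_adj i : ratm (col i (\adj M)) = (\det M)%:~R *: col i W.
Proof.
rewrite /W /invmx ratm_unit dM /ratm det_map_mx -map_mx_adj.
by apply/colP=> k; rewrite !mxE mulrA divff ?mul1r // intr_eq0.
Qed.

Lemma adj_colL i k : (`|(col i (\adj M)) k 0%R| <= L)%N.
Proof. by rewrite mxE. Qed.

Lemma adj_colNL i k : (`|(- col i (\adj M)) k 0%R| <= L)%N.
Proof. by rewrite mxE abszN mxE. Qed.

(** Coordinate [i] of [v] is its pairing with column [i] of [W]. Scaled by [det M] this is a column
    of the adjugate, an integral functional within the bound [L]; a negative determinant is absorbed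
    by changing the sign of that column. *)
Lemma coords_gt0_last i : last_pos (col i W) -> 0 < coords M v 0 i.
Proof.
move=> lp; case: (ltrgt0P (\det M)) dM => // d0 _.
  have [_ /(_ _)] := vL.2 _ (adj_colL i); rewrite dot_adj pmulr_rgt0 ?ltr0z //.
  by apply; rewrite col_adj; apply: last_posZ; rewrite ?ltr0z.
have [_ /(_ _)] := vL.2 _ (adj_colNL i).
rewrite ratmN mulmxN mxE dot_adj -mulNr pmulr_rgt0 ?oppr_gt0 ?ltrz0 //.
apply; rewrite col_adj -scaleNr; apply: last_posZ => //.
by rewrite oppr_gt0 ltrz0.
Qed.

Lemma coords_lt0_last i : last_pos (- col i W) -> coords M v 0 i < 0.
Proof.
move=> lp; case: (ltrgt0P (\det M)) dM => // d0 _.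
  have [_ /(_ _)] := vL.2 _ (adj_colNL i).
  rewrite ratmN mulmxN mxE dot_adj -mulrN pmulr_rgt0 ?ltr0z // oppr_gt0; apply.
  by rewrite col_adj -scalerN; apply: last_posZ; rewrite ?ltr0z.
have [_ /(_ _)] := vL.2 _ (adj_colL i).
rewrite dot_adj nmulr_rgt0 ?ltrz0 //; apply.
by rewrite col_adj -[_ *: _]opprK -scaleNr -scalerN; apply: last_posZ; rewrite ?oppr_gt0 ?ltrz0.
Qed.

Lemma col_inv_neq0 i : col i W != 0.
Proof.
apply/eqP=> h; have := mulmxV (_ : ratm M \in unitmx); rewrite ratm_unit => /(_ dM).
move=> /(congr1 (col i)); rewrite colE -mulmxA -colE -/W h mulmx0 => /colP/(_ i).
by rewrite !mxE eqxx => /esym/eqP; rewrite oner_eq0.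
Qed.

Lemma coords_neq0 i : coords M v 0 i != 0.
Proof.
case: (last_posP (col_inv_neq0 i)) => [/coords_gt0_last/gt_eqF->|/coords_lt0_last/lt_eqF->] //.
Qed.

Lemma coords_gt0P i : 0 < coords M v 0 i -> last_pos (col i W).
Proof.
by case: (last_posP (col_inv_neq0 i)) => // /coords_lt0_last h1 h2; have := lt_trans h1 h2; rewrite ltxx.
Qed.

Lemma infinitesimal_generic : generic v M.
Proof.
move=> i; rewrite normr_gt0 mulf_neq0 ?coords_neq0 ?intr_eq0 //=.
by rewrite mulrC -dot_adj; apply: (vL.2 _ _).1; apply: adj_colL.
Qed.

(* Coordinates of lattice points are multiples of 1 / det M, those of [v] are smaller. *)
Lemma pip_coords_le mu i : in_pip v M mu -> 0 <= coords M (ratm mu) 0 i <= 1.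
Proof.
move=> /forallP/(_ i); rewrite coordsB mxE [(- _ : 'rV__) _ _]mxE => /andP[h0 h1].
have /andP[_] := infinitesimal_generic i; rewrite normrM => g.
pose d : rat := `|(\det M)%:~R|; have d0 : 0 < d by rewrite normr_gt0 intr_eq0.
have [x xE] : exists x : int, coords M (ratm mu) 0 i * d = x%:~R.
  have e : (\det M)%:~R * coords M (ratm mu) 0 i = ((mu *m \adj M) 0 i)%:~R.
    have := congr1 (fun B : 'rV_n => B 0 i) (coords_adj (ratm mu) dM).
    by rewrite /= mxE => ->; rewrite /ratm -map_mxM mxE.
  exists (Num.sg (\det M) * (mu *m \adj M) 0 i).
  rewrite rmorphM /= -e mulrA [LHS]mulrC; congr (_ * _).
  by rewrite /d -intr_norm [`|\det M|]normrEsg rmorphM.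
have hx : -1 < x%:~R :> rat /\ x%:~R < d + 1.
  have : -1 < coords M v 0 i * d < 1 by rewrite -ltr_norml normrM (ger0_norm (ltW d0)).
  have aux (l c : rat) : 0 < l - c -> l - c < 1 -> -1 < c * d < 1 -> -1 < l * d /\ l * d < d + 1.
    by move=> l0 l1 /andP[g1 g2]; split; nra.
  by rewrite -xE; apply: aux.
have [x0 xd] : 0 <= x /\ x <= `|\det M|.
  case: hx; have -> : d + 1 = (`|\det M| + 1)%:~R by rewrite /d -intr_norm rmorphD.
  rewrite (ltr_int _ (-1)) ltr_int.
  by move: (\det M) => D ? ?; split; lia.
apply/andP; split; first by rewrite -(pmulr_lge0 _ d0) xE ler0z.
by rewrite -(ler_pM2r d0) mul1r xE /d -intr_norm ler_int.
Qed.

(** [mu w] is a sum of products of nonnegative numbers. Were all of them zero, each [i] with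
    [(M w)_i > 0] would have coordinate 0 at [mu], hence a negative coordinate at [v], and [v w]
    could not be positive. *)
Lemma pip_dot_gt0 mu (w : 'cV[int]_n) : (forall i, 0 <= (M *m w) i 0) ->
  0 < (v *m ratm w) 0 0 -> in_pip v M mu -> 0 < (mu *m w) 0 0.
Proof.
move=> hw vw pm.
have dotE y : (y *m ratm w) 0 0 = \sum_i coords M y 0 i * ((M *m w) i 0)%:~R.
  rewrite -[in LHS](coordsK y dM) -mulmxA /ratm -map_mxM mxE.
  by apply: eq_bigr => i _; rewrite [map_mx _ _ _ _]mxE.
have muE : ((mu *m w) 0 0)%:~R = \sum_i coords M (ratm mu) 0 i * ((M *m w) i 0)%:~R :> rat.
  by rewrite -dotE /ratm -map_mxM [RHS]mxE.
have h i : 0 <= coords M (ratm mu) 0 i * ((M *m w) i 0)%:~R.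
  by rewrite mulr_ge0 ?ler0z //; case/andP: (pip_coords_le i pm).
rewrite -(ltr0z rat) muE lt_neqAle sumr_ge0 // andbT eq_sym.
apply: contraL vw; rewrite psumr_eq0 // => /allP h0; rewrite -leNgt dotE.
apply: sumr_le0 => i _; have := h0 i; rewrite mem_index_enum => /(_ isT) /=.
rewrite mulf_eq0 => /orP[/eqP e|/eqP ->]; last by rewrite mulr0.
rewrite mulr_le0_ge0 ?ler0z //; have /forallP/(_ i) := pm.
by rewrite coordsB mxE e [(- _ : 'rV__) _ _]mxE add0r oppr_gt0 => /andP[/ltW].
Qed.

(** With coordinates [l_i] in [0, 1], each [e + l_i * (M w)_i] is nonnegative, and it can vanish
    only for [l_i = 1]. Away from the far corner some term is positive. *)
Lemma pip_dot_gtN mu (w : 'cV[int]_n) (e : int) : 0 < e ->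
  (forall i, - e <= (M *m w) i 0) -> in_pip v M mu -> mu != \sum_i row i M ->
  0 < e *+ n + (mu *m w) 0 0.
Proof.
move=> e0 hw pm ne.
have muE : ((mu *m w) 0 0)%:~R = \sum_i coords M (ratm mu) 0 i * ((M *m w) i 0)%:~R :> rat.
  have := coordsK (ratm mu) dM => /(congr1 (fun A => A *m ratm w)).
  rewrite -mulmxA /ratm -!map_mxM -/(ratm _) => /(congr1 (fun A : 'rV_1 => A 0 0)).
  by rewrite !mxE => <-; apply: eq_bigr => i _; rewrite [map_mx _ _ _ _]mxE.
have h i : 0 <= e%:~R + coords M (ratm mu) 0 i * ((M *m w) i 0)%:~R.
  case/andP: (pip_coords_le i pm) => l0 l1; move: (hw i); rewrite -(ler_int rat) rmorphN.
  have : 0 < e%:~R :> rat by rewrite ltr0z.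
  nra.
have eE : (e *+ n)%:~R = \sum_(i < n) e%:~R :> rat by rewrite sumr_const card_ord rmorphMn.
rewrite -(ltr0z rat) rmorphD /= eE muE -big_split lt_neqAle /= sumr_ge0 /= => [|i _]; last exact: h.
rewrite andbT eq_sym.
apply: contra ne; rewrite psumr_eq0 // => /allP h0; apply/eqP.
have c1 i : coords M (ratm mu) 0 i = 1.
  have := h0 i; rewrite mem_index_enum => /(_ isT) /= /eqP.
  case/andP: (pip_coords_le i pm) => l0 l1; move: (hw i); rewrite -(ler_int rat) rmorphN.
  have : 0 < e%:~R :> rat by rewrite ltr0z.
  nra.
suff : ratm mu = ratm (\sum_i row i M) by apply: ratm_inj.
rewrite -(coordsK (ratm mu) dM) ratm_sum_rows; congr (_ *m _).
by apply/rowP=> i; rewrite c1 mxE.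
Qed.

(** The corner has all coordinates 1, so everything depends on the sign of the coordinates of [v],
    which are smaller than 1 in absolute value. *)
Lemma corner_in_pip : in_pip v M (\sum_i row i M) = [forall i, 0 < coords M v 0 i].
Proof.
have v1 i : `|coords M v 0 i| < 1.
  have /andP[_] := infinitesimal_generic i; rewrite normrM; apply: le_lt_trans.
  rewrite ler_peMr // -intr_norm (ler_int _ 1).
  by have := dM; rewrite -normr_gt0.
apply: eq_forallb => i; rewrite coordsB ratm_sum_rows mul_coords // mxE [(- _ : 'rV__) _ _]mxE [const_mx _ _ _]mxE.
have := v1 i; rewrite ltr_norml => /andP[h1 h2].
by rewrite subr_gt0 h2 /= gtrBl.
Qed.

End Coordinates.
End Infinitesimal.

(** * Types of vertices and the far corner of a parallelepiped *)

Section Types.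

Variables (n : nat) (ty : 'I_n -> 'I_n).

(** The sign of [ty] if it is a permutation, and 0 otherwise. *)
Definition type_sign : int := \det (\matrix_(i, j) (j == ty i)%:R).

Lemma type_sign_ninj : ~~ injectiveb ty -> type_sign = 0.
Proof.
case/injectivePn=> i [j ij e]; apply: (determinant_alternate ij) => k.
by rewrite !mxE e.
Qed.

Lemma det_types (R : comNzRingType) (c : 'I_n -> R) :
  \det (\matrix_(i, j) (if j == ty i then c i else 0)) = type_sign%:~R * \prod_i c i.
Proof.
have -> : \matrix_(i, j) (if j == ty i then c i else 0) =
    diag_mx (\row_i c i) *m map_mx intr (\matrix_(i, j) (j == ty i)%:R).
  apply/matrixP=> i j; rewrite mul_diag_mx !mxE.
  by case: eqP => _; rewrite ?mulr1 ?mulr0.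
rewrite det_mulmx det_diag mulrC det_map_mx; congr (_ * _).
by apply: eq_bigr => i _; rewrite mxE.
Qed.

Variable M : 'M[int]_n.
Hypothesis M0 : forall i (k : 'I_n), (k < ty i)%N -> M i k = 0.
Hypothesis M_gt0 : forall i, 0 < M i (ty i).

(** Placing row [i] at position [ty i] makes [M] upper triangular with positive diagonal. *)
Lemma types_inj_det : injective ty -> sgz (\det M) = type_sign.
Proof.
move=> ty_inj; pose p := perm ty_inj.
have tsE : type_sign = (-1) ^+ p.
  rewrite /type_sign -det_perm; congr (\det _); apply/matrixP=> i j.
  by rewrite !mxE permE eq_sym.
pose N := row_perm p^-1%g M.
have NE i j : N (ty i) j = M i j by rewrite mxE -[ty i](permE ty_inj) permK.
have ME : M = perm_mx p *m N.
  by rewrite /N row_permE mulmxA -perm_mxM mulgV perm_mx1 mul1mx.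
have N_gt0 : 0 < \det N.
  rewrite -det_tr det_trig.
    apply: prodr_gt0 => k _; rewrite mxE -[k](permKV p) permE NE; exact: M_gt0.
  apply/is_trig_mxP=> i j ij; rewrite mxE -[j](permKV p) permE NE; apply: M0.
  by rewrite -permE permKV.
rewrite ME det_mulmx det_perm sgzM (gtr0_sgz N_gt0) mulr1 tsE.
by case: (odd_perm p).
Qed.

Lemma types_inj_det_neq0 : injective ty -> \det M != 0.
Proof.
move=> ti; rewrite -sgz_eq0 (types_inj_det ti).
have -> : type_sign = (-1) ^+ perm ti.
  rewrite /type_sign -det_perm; congr (\det _); apply/matrixP=> i j.
  by rewrite !mxE permE eq_sym.
by rewrite signr_eq0.
Qed.

(** Up to the permutation [ty], [M] is upper triangular with positive diagonal, hence so is its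
    inverse: column [i] ends at [ty i] with a positive entry. *)
Lemma types_inj_last_pos i : injective ty -> last_pos (col i (invmx (ratm M))).
Proof.
move=> ti; have dM := types_inj_det_neq0 ti; set W := invmx _.
have MW : ratm M *m W = 1%:M by rewrite mulmxV // ratm_unit.
have [tau tyK tauK] := injF_bij ti.
have W0 m (k : 'I_n) : (n - k <= m)%N -> (ty i < k)%N -> W k i = 0.
  elim: m k => [|m IH] k hk ik; first by have := ltn_ord k; lia.
  have := congr1 (fun A : 'M_n => A (tau k) i) MW; rewrite !mxE (bigD1 k) //= big1.
    rewrite addr0; have -> : (tau k == i) = false.
      by apply: contraTF ik => /eqP <-; rewrite tauK ltnn.
    move/eqP; rewrite mulf_eq0 mxE intr_eq0 => /orP[/eqP e|/eqP //].
    by have := M_gt0 (tau k); rewrite tauK e ltxx.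
  move=> j jk; have [kj|jk'] := ltnP k j.
    by rewrite IH ?mulr0 //; lia.
  rewrite mxE M0 ?mul0r // tauK ltn_neqAle jk' andbT.
  by apply: contra jk => /eqP e; apply/eqP/val_inj.
exists (ty i); last by move=> k ik; rewrite mxE; apply: (@W0 n) => //; apply: leq_subr.
have := congr1 (fun A : 'M_n => A i i) MW; rewrite !mxE eqxx (bigD1 (ty i)) //= big1.
  rewrite addr0 mxE => e; rewrite -(pmulr_rgt0 _ (_ : 0 < (M i (ty i))%:~R)) ?e ?ltr01 //.
  by rewrite ltr0z.
move=> j jk; have [kj|jk'] := ltnP (ty i) j.
  by rewrite (@W0 n) ?mulr0 // leq_subr.
rewrite mxE M0 ?mul0r // ltn_neqAle jk' andbT.
by apply: contra jk => /eqP e; apply/eqP/val_inj.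
Qed.

(** The converse of [types_inj_last_pos]: together they say that the infinitesimal shift counts the
    far corner exactly when the types are distinct. *)
Lemma types_inj_of_last_pos : \det M != 0 ->
  (forall i, last_pos (col i (invmx (ratm M)))) -> injective ty.
Proof.
move=> dM lp; set W := invmx _ in lp.
have WM : W *m ratm M = 1%:M by rewrite mulVmx // ratm_unit.
have kap_ex i : exists k, 0 < W k i /\ forall k' : 'I_n, (k < k')%N -> W k' i = 0.
  have [k h1 h2] := lp i; exists k.
  by split=> [|k' /h2]; [move: h1|]; rewrite mxE.
have [kap kapP] := fin_all_exists kap_ex.
have M_ge0 i (k : 'I_n) : (k <= ty i)%N -> 0 <= M i k.
  rewrite leq_eqVlt => /orP[/eqP e|/M0 -> //].
  by rewrite ltW // (_ : k = ty i) //; apply: val_inj.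
(* Descending induction on [k], where [kap i] is the position of the last nonzero entry of column
   [i] of [W]. In entry [(k, l)] of [W M], [l <= k], columns with [kap i < k] vanish at [k], and
   those with [kap i > k] meet a zero of [M] by induction. Only [kap i = k] remains, with positive
   weights. *)
have main m (k : 'I_n) : (n - k <= m)%N ->
    (forall i, kap i = k -> (k <= ty i)%N) /\ (exists i, ty i = k).
  elim: m k => [|m IH] k hk; first by have := ltn_ord k; lia.
  have sumE (l : 'I_n) : (l <= k)%N ->
      \sum_(i | kap i == k) W k i * (M i l)%:~R = (k == l)%:R.
    move=> lk; have := congr1 (fun A : 'M_n => A k l) WM; rewrite !mxE => <-.
    rewrite [RHS](bigID (fun i => kap i == k)) /= [X in _ = _ + X]big1 ?addr0.
      by apply: eq_bigr => i _; rewrite mxE.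
    move=> i ik; have [kk|kk] := ltnP (kap i) k; first by rewrite (kapP i).2 ?mul0r.
    have kk' : (k < kap i)%N.
      by rewrite ltn_neqAle kk andbT; apply: contra ik => /eqP e; apply/eqP/val_inj.
    have hm : (n - kap i <= m)%N by lia.
    have [h _] := IH (kap i) hm.
    rewrite mxE M0 ?mulr0 //; exact: leq_ltn_trans lk (leq_trans kk' (h i erefl)).
  have ge_k i : kap i = k -> (k <= ty i)%N.
    move=> ik; rewrite leqNgt; apply/negP => lt_i.
    (* In the column of the smallest type, no term is negative and that of [i0] is positive, yet the
       off-diagonal entry of [W M] is 0. *)
    have [i0 /eqP ki0 min0] := @arg_minnP _ i (fun i => kap i == k) (fun i => val (ty i)) (introT eqP ik).
    have lt0 : (ty i0 < k)%N by apply: leq_ltn_trans (min0 _ (introT eqP ik)) lt_i.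
    have := sumE (ty i0) (ltnW lt0); rewrite (bigD1 i0) ?ki0 //=.
    have -> : (k == ty i0) = false by apply/eqP => e; move: lt0; rewrite -e ltnn.
    move/eqP; apply/negP; rewrite gt_eqF //; apply: ltr_pwDl.
      by rewrite mulr_gt0 ?ltr0z //; rewrite -ki0; apply: (kapP i0).1.
    apply: sumr_ge0 => j /andP[/eqP kj _]; rewrite mulr_ge0 ?ler0z ?M_ge0 //.
      by rewrite -kj ltW //; apply: (kapP j).1.
    by apply: min0; apply/eqP.
  split=> //; apply/exists_eqP; apply: contraT => /existsPn ne.
  have := sumE k (leqnn k); rewrite eqxx big1 ?(eq_sym 0) => [/eqP|i /eqP ki]; rewrite ?oner_eq0 //.
  rewrite M0 ?mulr0 // ltn_neqAle ge_k // andbT eq_sym.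
  by apply: contra (ne i) => /eqP e; apply/eqP/val_inj.
have surj k : exists i, ty i = k by have [] := main n k (leq_subr _ _).
have [g gK] := fin_all_exists surj.
have g_inj : injective g := can_inj gK.
have [h hK Kh] := injF_bij g_inj.
by move=> x y; rewrite -[x]Kh -[y]Kh !gK => ->.
Qed.

End Types.

(** * Cones and flags *)

Section Cones.

Variables (R : realFieldType) (n s : nat) (eta : 'M[int]_(s, n)).
Implicit Types (J B : {set 'I_s}) (u v : 'rV[R]_n).
Local Notation E := (etaR R eta).

Definition gens B : 'M[R]_(#|B|, n) := \matrix_(i < #|B|) row (enum_val i) E.

Definition spread B (c : 'rV[R]_#|B|) (j : 'I_s) : R := \sum_(i | enum_val i == j) c 0 i.

Lemma spread_val B (c : 'rV[R]_#|B|) i : spread c (enum_val i) = c 0 i.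
Proof.
by rewrite /spread (big_pred1 i) // => k; rewrite (inj_eq enum_val_inj).
Qed.

Lemma mul_gens B (c : 'rV[R]_#|B|) : c *m gens B = \sum_(j in B) spread c j *: row j E.
Proof.
rewrite mulmx_sum_row [RHS]big_enum_val; apply: eq_bigr => i _.
by rewrite rowK spread_val.
Qed.

Lemma in_coneS J B v : B \subset J -> in_cone eta B v -> in_cone eta J v.
Proof.
move=> BJ [c [c0 ->]]; exists (fun j => if j \in B then c j else 0).
split=> [j|]; first by case: ifP.
rewrite [RHS](bigID (mem B)) /= [X in _ = _ + X]big1 ?addr0 => [|j /andP[_ /negPf->]]; last by rewrite scale0r.
apply: eq_big => j; first by case: (boolP (j \in B)) => [/(subsetP BJ)->|]; rewrite ?andbF.
by move=> ->.
Qed.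

(* Caratheodory's theorem. *)
Lemma in_cone_free J v : in_cone eta J v ->
  exists B, [/\ B \subset J, row_free (gens B) & in_cone eta B v].
Proof.
have [k] := ubnP #|J|; elim: k J => // k IH J; rewrite ltnS => hJ hv.
have [fr|nfr] := boolP (row_free (gens J)); first by exists J.
have [c [c0 vE]] := hv.
have [d [j0 dj0 dE]] : exists d : 'I_s -> R, exists2 j0, (j0 \in J) && (0 < d j0) &
    \sum_(j in J) d j *: row j E = 0.
  have : kermx (gens J) != 0 by rewrite kermx_eq0.
  case/rowV0Pn=> d /sub_kermxP dE /rV0Pn[i di].
  case: (ltrgt0P (d 0 i)) di => // h _.
    by exists (spread d); exists (enum_val i); rewrite -?mul_gens // enum_valP spread_val.
  exists (spread (- d)); exists (enum_val i).
    by rewrite enum_valP spread_val mxE oppr_gt0.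
  by rewrite -mul_gens mulNmx dE oppr0.
have [j /andP[jJ dj] min_j] := @Order.TotalTheory.arg_minP _ _ _ j0
  (fun j => (j \in J) && (0 < d j)) (fun j => c j / d j) dj0.
pose t := c j / d j.
have t0 : 0 <= t by rewrite divr_ge0 // ltW.
have c'0 l : l \in J -> 0 <= c l - t * d l.
  move=> lJ; rewrite subr_ge0; have [dl|dl] := ltP 0 (d l).
    by rewrite -ler_pdivlMr //; apply: min_j; rewrite lJ.
  by apply: le_trans (c0 l); apply: mulr_ge0_le0.
have hv' : in_cone eta (J :\ j) v.
  exists (fun l => if l \in J then c l - t * d l else 0); split=> [l|].
    by case: ifP => // /c'0.
  have -> : v = \sum_(l in J) (c l - t * d l) *: row l E.
    transitivity (\sum_(j in J) c j *: row j E - t *: (\sum_(j in J) d j *: row j E)).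
      by rewrite dE scaler0 subr0.
    rewrite scaler_sumr -sumrB.
    by apply: eq_bigr => l _; rewrite scalerA scalerBl.
  rewrite (bigD1 j) //= /t divfK ?gt_eqF // subrr scale0r add0r.
  apply: eq_big => [l|l /andP[-> _] //].
  by rewrite !inE andbC.
have [B [BJ fr hB]] : exists B, [/\ B \subset J :\ j, row_free (gens B) & in_cone eta B v].
  by apply: IH hv'; apply: leq_trans hJ; rewrite (cardsD1 j J) jJ.
by exists B; split=> //; apply: subset_trans BJ (subsetDl _ _).
Qed.

Lemma small_pos (I : finType) (P : I -> R -> Prop) :
  (forall i, exists2 d, 0 < d & forall e, 0 < e < d -> P i e) ->
  exists2 d, 0 < d & forall e, 0 < e < d -> forall i, P i e.
Proof.
move=> /fin_all_exists2[d d0 dP].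
have [e e0 ed] : exists2 e, 0 < e & forall i, i \in enum I -> e <= d i.
  elim: (enum I) => [|i r [e e0 IH]]; first by exists 1.
  exists (Num.min e (d i)); first by rewrite lt_min e0 d0.
  move=> k; rewrite inE ge_min => /orP[/eqP->|/IH ->] //.
  by rewrite lexx orbT.
exists e => // x /andP[x0 xe] i; apply: dP; rewrite x0.
by apply: lt_le_trans xe (ed _ _); rewrite mem_enum.
Qed.

Lemma affine_small (a b : R) : 0 < a -> exists2 d, 0 < d & forall e, 0 < e < d -> 0 < a + e * b.
Proof.
move=> a0; have b1 : 0 < `|b| + 1 by have := normr_ge0 b; lra.
exists (a / (`|b| + 1)); first by rewrite divr_gt0.
move=> e /andP[e0]; rewrite ltr_pdivlMr // => he.
have : - (e * `|b|) <= e * b by rewrite -mulrN ler_pM2l // lerNl -normrN ler_norm.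
by nra.
Qed.

Lemma in_coneE B w : in_cone eta B w ->
  exists2 c : 'rV[R]_#|B|, (forall i, 0 <= c 0 i) & w = c *m gens B.
Proof.
case=> c [c0 ->]; exists (\row_i c (enum_val i)) => [i|]; first by rewrite mxE.
rewrite mulmx_sum_row big_enum_val; apply: eq_bigr => i _.
by rewrite mxE rowK.
Qed.

Lemma in_cone_gens B (c : 'rV[R]_#|B|) : (forall i, 0 <= c 0 i) -> in_cone eta B (c *m gens B).
Proof.
move=> c0; exists (spread c); split; last by rewrite mul_gens.
by move=> j; apply: sumr_ge0.
Qed.

(** Closedness of the cone along one ray. By Caratheodory only free families [B] matter; there
    membership of [v + e u] is a system of equations and inequalities affine in [e], one of which
    fails at [e = 0] and keeps failing for small [e]. *)
Lemma in_cone_closed v u J : ~ in_cone eta J v ->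
  exists2 d, 0 < d & forall e, 0 < e < d -> ~ in_cone eta J (v + e *: u).
Proof.
move=> nv.
suff [d d0 dP] : exists2 d, 0 < d & forall e, 0 < e < d -> forall B : {set 'I_s},
    B \subset J -> row_free (gens B) -> ~ in_cone eta B (v + e *: u).
  exists d => // e he /in_cone_free[B [BJ fr]]; exact: dP.
apply: small_pos => B.
have [BJ|] := boolP (B \subset J); last by exists 1.
have [/row_freeP[G GE]|] := boolP (row_free (gens B)); last by exists 1.
pose a := v *m G; pose b := u *m G; pose p := v - a *m gens B; pose q := u - b *m gens B.
have inB e : in_cone eta B (v + e *: u) -> (forall i, 0 <= (a + e *: b) 0 i) /\ p + e *: q = 0.
  case/in_coneE=> c c0 cE.
  have cE' : c = a + e *: b.
    by rewrite /a /b scalemxAl -mulmxDl cE -mulmxA GE mulmx1.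
  split; first by rewrite -cE'.
  rewrite /p /q scalerBr scalemxAl addrACA -opprD -mulmxDl -cE' cE; exact: subrr.
have [p0|] := eqVneq p 0; last first.
  case/rV0Pn=> l; case: (ltrgt0P (p 0 l)) => // pl _.
    have [d d0 dP] := affine_small (q 0 l) pl; exists d => // e /dP h _ _ /inB[_].
    by move=> /rowP/(_ l); rewrite mxE [(e *: q) 0 l]mxE [RHS]mxE => h'; move: h; rewrite h' ltxx.
  have pl' : 0 < - p 0 l by rewrite oppr_gt0.
  have [d d0 dP] := affine_small (- q 0 l) pl'; exists d => // e /dP h _ _ /inB[_].
  by move=> /rowP/(_ l); rewrite mxE [(e *: q) 0 l]mxE [RHS]mxE => h'; move: h; rewrite mulrN -opprD h' oppr0 ltxx.
have [/existsP[i ai]|/existsPn na] := boolP [exists i, a 0 i < 0].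
  have ai' : 0 < - a 0 i by rewrite oppr_gt0.
  have [d d0 dP] := affine_small (- b 0 i) ai'; exists d => // e /dP h _ _ /inB[/(_ i)].
  rewrite mxE [(e *: b) 0 i]mxE => h' _; move: h h'.
  by rewrite mulrN -opprD oppr_gt0 ltNge => /negP.
case: nv; apply: in_coneS BJ _; rewrite (_ : v = a *m gens B); last by apply/eqP; rewrite -subr_eq0 -/p p0.
by apply: in_cone_gens => i; rewrite leNgt na.
Qed.

Variable Sigma : {set {set 'I_s}}.
Hypothesis fan : complete_fan R eta Sigma.

Definition cone_mx J : 'M[R]_(s, n) := \matrix_(j, l) (if j \in J then E j l else 0).

Lemma row_cone_mx J j : row j (cone_mx J) = if j \in J then row j E else 0.
Proof. by apply/rowP=> l; rewrite !mxE; case: ifP; rewrite !mxE. Qed.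

Lemma cone_mx_mul0 J (m : 'cV[R]_n) :
  (forall j, j \in J -> (E *m m) j 0 = 0) -> cone_mx J *m m = 0.
Proof.
move=> h; apply/row_matrixP=> j; rewrite row_mul row_cone_mx row0.
case: ifP => [/h e|_]; last by rewrite mul0mx.
apply/rowP=> k; rewrite ord1 [RHS]mxE -[RHS]e -row_mul !mxE.
by apply: eq_bigr => l _; rewrite !mxE.
Qed.

Lemma row_sub_cone_mx J j : j \in J -> (row j E <= cone_mx J)%MS.
Proof. by move=> jJ; have := row_sub j (cone_mx J); rewrite row_cone_mx jJ. Qed.

Lemma cone_mx_subP J k (U : 'M[R]_(k, n)) :
  (forall j, j \in J -> (row j E <= U)%MS) -> (cone_mx J <= U)%MS.
Proof.
move=> h; apply/row_subP=> j; rewrite row_cone_mx; case: ifP => [/h //|_].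
exact: sub0mx.
Qed.

Lemma in_cone_sub J v : in_cone eta J v -> (v <= cone_mx J)%MS.
Proof.
case=> c [_ ->]; apply: summx_sub => j jJ.
by apply: scalemx_sub; apply: row_sub_cone_mx.
Qed.

(** Let [v] be the sum of the rays of [J] and [u] a vector outside its span. Some cone contains
    [v + e u]; for small [e] it must contain [J], and it differs from [J] because of [u]. Iteration
    ends by cardinality. *)
Lemma cone_in_maximal J : J \in Sigma ->
  exists J', [/\ J' \in Sigma, cone_dim R eta J' = n & J \subset J'].
Proof.
have [k] := ubnP (s - #|J|); elim: k J => // k IH J; rewrite ltnS => hk JS.
have [dJ|dJ] := eqVneq (cone_dim R eta J) n; first by exists J.
have : ~~ (1%:M <= cone_mx J)%MS by rewrite sub1mx /row_full.
case/row_subPn=> l; set u := row l _ => hu.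
pose v := \sum_(j in J) row j E.
have hv : in_cone eta J v.
  by exists (fun _ => 1); split=> [_|]; [apply: ler01|apply: eq_bigr => j _; rewrite scale1r].
(* A functional cutting out the face [J :&: J'] is nonnegative on [J] and vanishes at [v] if [v]
   lies in [J'], hence at every ray of [J]. *)
have nv J' : J' \in Sigma -> ~~ (J \subset J') -> ~ in_cone eta J' v.
  move=> J'S nJ hv'; have [[m [m0 mI]] cap] := fan_cap fan JS J'S.
  have [c [c0 vE]] := cap v hv hv'.
  have m1 : (v *m m) 0 0 = 0.
    rewrite vE mulmx_suml summxE big1 // => j; rewrite mI inE => /andP[_ /eqP e].
    by rewrite -scalemxAl mxE -row_mul mxE e mulr0.
  have m2 : (v *m m) 0 0 = \sum_(j in J) (E *m m) j 0.
    by rewrite mulmx_suml summxE; apply: eq_bigr => j _; rewrite -row_mul mxE.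
  case/negP: nJ; apply/subsetP=> j jJ.
  have : j \in J :&: J'; last by rewrite inE => /andP[].
  rewrite mI inE jJ /=; apply/eqP.
  exact: (psumr_eq0P m0 (etrans (esym m2) m1)).
have [d d0 dP] : exists2 d, 0 < d & forall e, 0 < e < d -> forall J' : {set 'I_s},
    J' \in Sigma -> ~~ (J \subset J') -> ~ in_cone eta J' (v + e *: u).
  apply: small_pos => J'.
  have [J'S|] := boolP (J' \in Sigma); last by exists 1.
  have [|nJ] := boolP (J \subset J'); first by exists 1.
  by have [d d0 dP] := in_cone_closed u (nv _ J'S nJ); exists d => // e /dP.
have d2 : 0 < d / 2 < d by apply/andP; split; lra.
have [J' J'S hJ'] := fan_cover fan (v + (d / 2) *: u).
have JJ' : J \subset J' by apply: contraT => nJ; case: (dP _ d2 _ J'S nJ).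
have [|J'' [h1 h2 h3]] := IH J' _ J'S; last by exists J''; split=> //; apply: subset_trans h3.
have : J \proper J'.
  rewrite properEneq JJ' andbT; apply: contraNneq hu => e.
  rewrite -e in hJ'; have : (v + (d / 2) *: u - v <= cone_mx J)%MS.
    by apply: addmx_sub; rewrite ?eqmx_opp; apply: in_cone_sub.
  by rewrite addrAC subrr add0r; rewrite eqmx_scale // gt_eqF //; case/andP: d2.
move/proper_card; have := max_card J'; rewrite card_ord; lia.
Qed.

Lemma ray_neq0 j : row j E != 0.
Proof.
apply/eqP=> h; have [] : (2 : int) = 1 \/ (2 : int) = -1 by
  apply: (fan_primitive fan (j := j)) => l; move/rowP/(_ l): h; rewrite !mxE => /eqP; rewrite intr_eq0 => /eqP->; apply: dvdz0.
all: by [].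
Qed.

Section Flag.

Variable sg : n.+1.-tuple {set 'I_s}.
Hypothesis flag : complete_flag R eta Sigma sg.
Local Notation sgk := (nth setT sg).

Lemma flag_mem k : (k <= n)%N -> sgk k \in Sigma.
Proof. by move=> kn; have [/(_ (inord k))[]] := flag; rewrite (tnth_nth setT) inordK. Qed.

Lemma flag_dim k : (k <= n)%N -> \rank (cone_mx (sgk k)) = k.
Proof. by move=> kn; have [/(_ (inord k))[_]] := flag; rewrite (tnth_nth setT) inordK. Qed.

Lemma flag_sub k : (k < n)%N -> sgk k \subset sgk k.+1.
Proof. by have [_] := flag; apply. Qed.

Lemma flag0 : sgk 0 = set0.
Proof.
have := flag_dim (leq0n n) => /eqP; rewrite mxrank_eq0 => /eqP h.
apply/setP=> j; rewrite inE; apply/negP => jJ; have := ray_neq0 j.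
by have := row_cone_mx (sgk 0) j; rewrite jJ h row0 => <-; rewrite eqxx.
Qed.

Lemma flag_facet k : (k < n)%N -> exists m : 'cV[R]_n,
  (forall j, j \in sgk k -> (E *m m) j 0 = 0) /\
  (forall j, j \in sgk k.+1 -> j \notin sgk k -> 0 < (E *m m) j 0).
Proof.
move=> kn; have [[m [m0 mI]] _] := fan_cap fan (flag_mem kn) (flag_mem (ltnW kn)).
have cap : sgk k.+1 :&: sgk k = sgk k by apply/setIidPr/flag_sub.
rewrite cap in mI; exists m; split=> j jk.
  by move: jk; rewrite mI inE => /andP[_ /eqP].
rewrite mI inE jk /= => jk'; rewrite lt_neqAle eq_sym jk' /=; exact: m0.
Qed.

Lemma flag_span k j (m : 'cV[R]_n) : (k < n)%N -> j \in sgk k.+1 -> j \notin sgk k ->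
  (forall i, i \in sgk k -> (E *m m) i 0 = 0) -> (E *m m) j 0 = 0 ->
  forall i, i \in sgk k.+1 -> (E *m m) i 0 = 0.
Proof.
move=> kn jk1 jk mk mj.
have [m' [m'0 m'_gt0]] := flag_facet kn.
pose U := (cone_mx (sgk k) + row j E)%MS.
have rowE (p : 'cV[R]_n) i : (E *m p) i 0 = (row i E *m p) 0 0 by rewrite -row_mul [RHS]mxE.
have nsub : ~~ (row j E <= cone_mx (sgk k))%MS.
  apply/negP => /submxP[D DE]; have := m'_gt0 j jk1 jk.
  by rewrite rowE DE -mulmxA cone_mx_mul0 // mulmx0 mxE ltxx.
have UE : (U <= cone_mx (sgk k.+1))%MS.
  rewrite addsmx_sub row_sub_cone_mx // andbT; apply: cone_mx_subP => i ik.
  by apply: row_sub_cone_mx; apply: (subsetP (flag_sub kn)).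
have ltU : (k < \rank U)%N.
  rewrite -[X in (X < _)%N](flag_dim (ltnW kn)) ltn_neqAle mxrankS ?addsmxSl // andbT.
  have [_ ->] := mxrank_leqif_sup (addsmxSl (cone_mx (sgk k)) (row j E)).
  by rewrite addsmx_sub negb_and nsub orbT.
have Usub : (cone_mx (sgk k.+1) <= U)%MS.
  have [_ <-] := mxrank_leqif_sup UE.
  by rewrite eqn_leq mxrankS //= flag_dim.
have Um : (U <= kermx m)%MS.
  rewrite addsmx_sub; apply/andP; split; first by apply/sub_kermxP; apply: cone_mx_mul0.
  by apply/sub_kermxP/rowP=> i; rewrite ord1 -rowE mj mxE.
move=> i ik; have /sub_kermxP h := submx_trans (row_sub_cone_mx ik) (submx_trans Usub Um).
by rewrite rowE h mxE.
Qed.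

(** The functional cutting out the face [sigma_{k+1} :&: J] vanishes on sigma_k and on one new ray,
    so by [flag_span] the face is all of sigma_{k+1}. *)
Lemma flag_inter J k j : J \in Sigma -> (k < n)%N -> sgk k \subset J ->
  j \in sgk k.+1 -> j \notin sgk k -> j \in J -> sgk k.+1 \subset J.
Proof.
move=> JS kn kJ jk1 jk jJ.
have [[m [m0 mI]] _] := fan_cap fan (flag_mem kn) JS.
have z i : i \in sgk k.+1 -> i \in J -> (E *m m) i 0 = 0.
  move=> ik iJ; have : i \in sgk k.+1 :&: J by rewrite inE ik.
  by rewrite mI inE => /andP[_ /eqP].
have h := @flag_span k j m kn jk1 jk.
apply/subsetP=> i ik; have : i \in sgk k.+1 :&: J; last by rewrite inE => /andP[].
rewrite mI inE ik; apply/eqP; apply: h => //; last exact: z.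
by move=> l lk; apply: z; [apply: (subsetP (flag_sub kn))|apply: (subsetP kJ)].
Qed.

Lemma flag_top J : J \in Sigma -> sgk n \subset J -> J = sgk n.
Proof.
move=> JS nJ; have [[m [m0 mI]] _] := fan_cap fan JS (flag_mem (leqnn n)).
have cap : J :&: sgk n = sgk n by apply/setIidPr.
have : m = 0.
  have : row_full (cone_mx (sgk n)) by rewrite /row_full flag_dim.
  case/row_fullP=> G GE; rewrite -[m]mul1mx -GE -mulmxA cone_mx_mul0 ?mulmx0 //.
  by move=> j; rewrite -{1}cap mI inE => /andP[_ /eqP].
move=> m_0; rewrite -cap mI; apply/setP=> j.
by rewrite inE m_0 mulmx0 mxE eqxx andbT.
Qed.

(** This [k] is the type of [J]. It precedes the first member of the flag not contained in [J]; by
    [flag_inter], a step not wholly inside [J] has no ray in [J]. *)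
Lemma flag_exit J : J \in Sigma -> J != sgk n ->
  exists k : 'I_n, sgk k \subset J /\ (forall j, j \in sgk k.+1 -> j \notin sgk k -> j \notin J).
Proof.
move=> JS Jn; pose P k := (k <= n)%N && ~~ (sgk k \subset J).
have exP : exists k, P k.
  exists n; rewrite /P leqnn /=; apply: contra Jn => h; apply/eqP; exact: flag_top.
case: (ex_minnP exP) => -[|k] /andP[kn nk] min_k; first by rewrite flag0 sub0set in nk.
have kJ : sgk k \subset J.
  apply: contraT => h; have := min_k k; rewrite /P (ltnW kn) h ltnn; exact.
exists (Ordinal kn); split=> // j jk1 jk; apply: contra nk => jJ; exact: (flag_inter JS kn kJ jk1 jk jJ).
Qed.

Lemma flag_step_exists (k : 'I_n) : exists j, (j \in sgk k.+1) && (j \notin sgk k).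
Proof.
have [/existsP//|/existsPn h] := boolP [exists j, (j \in sgk k.+1) && (j \notin sgk k)].
have : sgk k.+1 \subset sgk k.
  by apply/subsetP=> j jk; have := h j; rewrite jk /= negbK.
have := flag_sub (ltn_ord k) => h1 h2; have e : sgk k.+1 = sgk k by apply/eqP; rewrite eqEsubset h1 h2.
have := flag_dim (ltn_ord k); rewrite e flag_dim; last exact: ltnW.
by move/n_Sn.
Qed.

End Flag.
End Cones.

(** A column Hermite form: the Smith normal form of the first row supplies a unimodular matrix
    clearing it beyond the diagonal, and induction treats the lower right block. *)
Lemma unimodular_trig n (A : 'M[int]_n) : exists2 P, P \in unitmx & is_trig_mx (A *m P).
Proof.
elim: n A => [|n IH] A.
  by exists 1%:M; rewrite ?unitmx1 //; apply/is_trig_mxP=> -[].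
have [L uL [Rm uR [d _ rE]]] := int_Smith_normal_form (usubmx (A : 'M_(1 + n, 1 + n))).
pose B : 'M_(1 + n) := (A : 'M_(1 + n)) *m invmx Rm.
have B0 : ursubmx B = 0.
  have -> : ursubmx B = rsubmx (usubmx (A : 'M_(1 + n)) *m invmx Rm).
    by rewrite /ursubmx /B -[in LHS](vsubmxK (A : 'M_(1 + n))) mul_col_mx col_mxKu.
  rewrite rE -!mulmxA mulmxV // mulmx1; apply/matrixP=> i j.
  rewrite !mxE big1 // => k _; rewrite !mxE !ord1.
  by rewrite /= mulr0n mulr0.
have [P uP tP] := IH (drsubmx B).
pose U : 'M[int]_(1 + n) := block_mx 1%:M 0 0 P.
have uU : U \in unitmx by rewrite unitmxE /U det_ublock det1 mul1r -unitmxE.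
exists (invmx Rm *m U); first by rewrite unitmx_mul unitmx_inv uR.
have -> : A *m (invmx Rm *m U) = B *m U by rewrite mulmxA.
have -> : B *m U = block_mx (ulsubmx B) 0 (dlsubmx B) (drsubmx B *m P).
  rewrite -[in LHS](submxK B) B0 /U mulmx_block !mulmx0 !mul0mx !mulmx1 !addr0.
  by rewrite add0r.
have -> := @is_trig_block_mx _ 1 n 1 n (ulsubmx B) 0 (dlsubmx B) (drsubmx B *m P) erefl.
by rewrite eqxx tP mx11_is_trig.
Qed.

Lemma unimodular_pos_trig n (A : 'M[int]_n) : \det A != 0 ->
  exists P, [/\ P \in unitmx, is_trig_mx (A *m P) & forall i, 0 < (A *m P) i i].
Proof.
move=> dA; have [P uP tP] := unimodular_trig A.
have d0 i : (A *m P) i i != 0.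
  have : \det (A *m P) != 0.
    rewrite det_mulmx mulf_neq0 //; move: uP; rewrite unitmxE.
    by apply: contraTneq => ->; rewrite unitr0.
  by rewrite det_trig // => /prodf_neq0; apply.
pose D := diag_mx (\row_i Num.sg ((A *m P) i i)).
exists (P *m D); split.
- rewrite unitmx_mul uP unitmxE det_diag; apply: rpred_prod => i _; rewrite mxE.
  by case: sgrP (d0 i).
- apply/is_trig_mxP=> i j ij; rewrite mulmxA mul_mx_diag mxE.
  by move/is_trig_mxP: tP => -> //; rewrite mul0r.
by move=> i; rewrite mulmxA mul_mx_diag mxE [(\row_j _) _ _]mxE mulrC -normrEsg normr_gt0.
Qed.

Section FlagBasis.

Variables (R : realFieldType) (n s : nat) (eta : 'M[int]_(s, n)).
Variables (Sigma : {set {set 'I_s}}) (sg : n.+1.-tuple {set 'I_s}).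
Hypothesis fan : complete_fan R eta Sigma.
Hypothesis flag : complete_flag R eta Sigma sg.
Local Notation sgk := (nth setT sg).
Local Notation E := (etaR R eta).

(** The columns of [P] form a lattice basis in which the rays of the flag are block triangular. It
    comes from triangularizing the pairing with one chosen new ray per step. *)
Lemma flag_basis : exists2 P : 'M[int]_n, P \in unitmx &
  (forall (k : 'I_n) l j, (l <= k)%N -> j \in sgk l -> (eta *m P) j k = 0) /\
  (forall (k : 'I_n) j, j \in sgk k.+1 -> j \notin sgk k -> 0 < (eta *m P) j k).
Proof.
have [b bP] := fin_all_exists (flag_step_exists flag).
pose B : 'M[int]_n := \matrix_(k, l) eta (b k) l.
have van (m : 'cV[R]_n) (l : nat) : (l <= n)%N ->
    (forall k : 'I_n, (k < l)%N -> (E *m m) (b k) 0 = 0) -> forall j, j \in sgk l -> (E *m m) j 0 = 0.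
  elim: l => [|l IH] ln h; first by rewrite (flag0 fan flag) => j; rewrite inE.
  have /andP[b1 b2] := bP (Ordinal ln).
  apply: (flag_span fan flag ln b1 b2); first by apply: IH (ltnW ln) _ => k kl; apply: h; apply: ltnW.
  exact: h.
have van0 (m : 'cV[R]_n) : (forall j, j \in sgk n -> (E *m m) j 0 = 0) -> m = 0.
  move=> h; have : row_full (cone_mx R eta (sgk n)) by rewrite /row_full (flag_dim flag).
  by case/row_fullP=> G GE; rewrite -[m]mul1mx -GE -mulmxA cone_mx_mul0 ?mulmx0.
have dB : \det B != 0.
  apply/negP => /eqP d0.
  have : \det (map_mx (intr : int -> R) B)^T == 0 by rewrite det_tr det_map_mx d0 rmorph0.
  move/det0P=> [v v0 vB]; case/eqP: v0; apply: trmx_inj; rewrite trmx0.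
  apply: van0; apply: van => // k _.
  have := congr1 (fun A : 'rV_n => A 0 k) vB; rewrite !mxE => h; rewrite -[RHS]h.
  by apply: eq_bigr => l _; rewrite !mxE mulrC.
have [P [uP tP dP]] := unimodular_pos_trig dB.
exists P => //.
have gE j k : ((eta *m P) j k)%:~R = (E *m col k (map_mx intr P)) j 0 :> R.
  rewrite !mxE rmorph_sum; apply: eq_bigr => l _; by rewrite !mxE rmorphM.
have BE k l : (B *m P) k l = (eta *m P) (b k) l.
  by rewrite !mxE; apply: eq_bigr => i _; rewrite mxE.
have g0 (k : 'I_n) l j : (l <= k)%N -> j \in sgk l -> (eta *m P) j k = 0.
  move=> lk jl; apply: (@intr_inj R); rewrite gE; apply: van jl; first by apply: leq_trans lk (ltnW (ltn_ord k)).
  move=> i il; rewrite -gE -BE; move/is_trig_mxP: tP => -> //.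
  exact: leq_trans il lk.
split=> // k j jk1 jk.
rewrite -(ltr0z R).
(* Positivity is known so far only at the chosen ray [b k]. The multiple [c *: m] of the facet
   functional takes the same value there, so the difference vanishes on all of sigma_{k+1} and
   positivity passes to every new ray. *)
have [m [m0 m_gt0]] := flag_facet fan flag (ltn_ord k).
have /andP[b1 b2] := bP k; have mb := m_gt0 _ b1 b2.
pose c := ((eta *m P) (b k) k)%:~R / (E *m m) (b k) 0.
have c0 : 0 < c by rewrite divr_gt0 // ltr0z -BE.
have subE i : (E *m (col k (map_mx intr P) - c *: m)) i 0 =
    ((eta *m P) i k)%:~R - c * (E *m m) i 0.
  by rewrite mulmxBr -scalemxAr mxE -gE [(- _ : 'cV__) i 0]mxE [(c *: _ : 'cV__) i 0]mxE.
have h : (E *m (col k (map_mx intr P) - c *: m)) j 0 = 0.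
  apply: (flag_span fan flag (ltn_ord k) b1 b2) jk1.
    by move=> i ik; rewrite subE m0 // mulr0 subr0 (g0 k k).
  by rewrite subE /c divfK ?subrr // gt_eqF.
move: h; rewrite subE => /eqP; rewrite subr_eq0 => /eqP ->.
by rewrite mulr_gt0 // m_gt0.
Qed.

End FlagBasis.

Section Vertices.

Variables (R : realFieldType) (n s : nat) (eta : 'M[int]_(s, n)).
Variables (Sigma : {set {set 'I_s}}).

(* [e J] is the exponent of the vertex of the polytope of [D] given by [J]. *)
Lemma ample_vertex D : ample R eta Sigma D -> exists e : {set 'I_s} -> 'cV[int]_s,
  forall J, J \in Sigma -> cone_dim R eta J = n ->
    [/\ lin_eq eta (e J) D, forall j, 0 <= e J j 0 & forall j, (e J j 0 == 0) = (j \in J)].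
Proof.
case=> m mP; exists (fun J => D + eta *m m J) => J JS dJ; have h := mP J JS dJ.
have e0 j : if j \in J then (D + eta *m m J) j 0 = 0 else 0 < (D + eta *m m J) j 0.
  have := h j; rewrite [(D + _) j 0]mxE; case: ifP => _; first by move=> ->; rewrite subrr.
  by rewrite -subr_gt0 opprK addrC.
split; first by exists (m J); rewrite addrC addKr.
  by move=> j; have := e0 j; case: ifP => _ => [->//|/ltW].
by move=> j; have := e0 j; case: ifP => _ => [->|/gt_eqF->]; rewrite ?eqxx.
Qed.

End Vertices.

(** * The generic polynomials have no common zero *)

Section AlgebraicDependence.

Variables (k L : fieldType) (iota : {rmorphism k -> L}) (T : finType) (tau : T -> L).
Hypothesis tau0 : forall r, tau r != 0.

Definition laurent (e : T -> int) : L := \prod_r tau r ^ e r.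

Definition shift D (g : {ffun T -> 'I_(D + D).+1}) (r : T) : int := (g r : nat)%:Z - D%:Z.

Definition laurent_span (D : nat) (x : L) := exists c : {ffun T -> 'I_(D + D).+1} -> k,
  x = \sum_g iota (c g) * laurent (shift g).

Lemma span_laurent D e : (forall r, `|e r| <= D)%N -> laurent_span D (laurent e).
Proof.
move=> he; pose g0 : {ffun T -> 'I_(D + D).+1} := [ffun r => inord `|(e r + D%:Z)%R|%N].
exists (fun g => (g == g0)%:R); rewrite (bigD1 g0) //= big1 ?addr0 => [|g /negPf->]; last by rewrite rmorph0 mul0r.
rewrite eqxx rmorph1 mul1r; apply: eq_bigr => r _; congr (_ ^ _).
rewrite /shift ffunE; move: (he r); move: (e r) => x hx.
by rewrite inordK ?gez0_abs ?addrK //; lia.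
Qed.

Lemma span0 D : laurent_span D 0.
Proof. by exists (fun _ => 0); rewrite big1 // => g _; rewrite rmorph0 mul0r. Qed.

Lemma spanD D x y : laurent_span D x -> laurent_span D y -> laurent_span D (x + y).
Proof.
move=> [c ->] [c' ->]; exists (fun g => c g + c' g); rewrite -big_split.
by apply: eq_bigr => g _; rewrite rmorphD mulrDl.
Qed.

Lemma spanZ D a x : laurent_span D x -> laurent_span D (iota a * x).
Proof.
move=> [c ->]; exists (fun g => a * c g); rewrite mulr_sumr.
by apply: eq_bigr => g _; rewrite rmorphM mulrA.
Qed.

Lemma spanN D x : laurent_span D x -> laurent_span D (- x).
Proof. by move=> /(spanZ (-1)); rewrite rmorphN1 mulN1r. Qed.

Lemma span_sum D I (r : seq I) (P : pred I) (F : I -> L) :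
  (forall i, P i -> laurent_span D (F i)) -> laurent_span D (\sum_(i <- r | P i) F i).
Proof. by move=> h; apply: (big_ind (laurent_span D)) => //; [apply: span0|apply: spanD]. Qed.

Lemma laurentD e e' : laurent (fun r => e r + e' r) = laurent e * laurent e'.
Proof. by rewrite -big_split; apply: eq_bigr => r _; rewrite expfzDr. Qed.

Lemma spanM D D' x y : laurent_span D x -> laurent_span D' y -> laurent_span (D + D') (x * y).
Proof.
move=> [c ->] [c' ->]; rewrite mulr_suml; apply: span_sum => g _.
rewrite mulr_sumr; apply: span_sum => g' _.
rewrite mulrACA -rmorphM -laurentD; apply: spanZ; apply: span_laurent => r.
have := ltn_ord (g r); have := ltn_ord (g' r); rewrite /shift.
by move: (nat_of_ord _) (nat_of_ord _) => a b; lia.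
Qed.

Lemma spanW D D' x : (D <= D')%N -> laurent_span D x -> laurent_span D' x.
Proof.
move=> DD' [c ->]; apply: span_sum => g _; apply: spanZ; apply: span_laurent => r.
have := ltn_ord (g r); rewrite /shift; move: (nat_of_ord _) => a; lia.
Qed.

Lemma span1 : laurent_span 0 1.
Proof.
suff -> : 1 = laurent (fun _ => 0) by apply: span_laurent.
by rewrite /laurent big1 // => r _; rewrite expr0z.
Qed.

Lemma span_exp D x m : laurent_span D x -> laurent_span (D * m) (x ^+ m).
Proof.
move=> h; elim: m => [|m IH]; first by rewrite muln0 expr0; apply: span1.
by rewrite mulnS exprS; apply: spanM.
Qed.

Variables (N C : nat) (y : 'I_N -> L).
Hypothesis T_lt : (#|T| < N)%N.
Hypothesis y_span : forall i, laurent_span C (y i).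

(* There are d^N monomials of degree < d in each [y i], all of them linear
   combinations of O(d^|T|) Laurent monomials in the [tau r]. *)
Lemma algebraic_dependence : exists2 P : {mpoly k[N]}, P != 0 & mmap iota y P = 0.
Proof.
(* Exponents are at most [D = N * C * d], so there are at most [(a * d)^|T|] Laurent monomials;
   [d > a^|T|] makes this less than [d^(|T|+1) <= d^N]. *)
pose a := (2 * (N * C)).+1; pose d := (a ^ #|T|).+1.
pose X := {ffun 'I_N -> 'I_d}; pose D := (N * (C * d))%N; pose G := {ffun T -> 'I_(D + D).+1}.
have cardXG : (#|{: G}| < #|{: X}|)%N.
  rewrite !card_ffun !card_ord.
  apply: (@leq_ltn_trans ((a * d) ^ #|T|)).
    have le1 : ((D + D).+1 <= a * d)%N by rewrite /D /a; have : (0 < d)%N by []; nia.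
    by case: #|T| => [|t]; rewrite ?expn0 // leq_exp2r.
  rewrite expnMn; apply: (@leq_trans (d ^ #|T|.+1)); last by rewrite leq_pexp2l.
  by rewrite expnS ltn_pmul2r // expn_gt0.
have monE (x : X) : exists c : {ffun T -> 'I_(D + D).+1} -> k,
    \prod_i y i ^+ x i = \sum_g iota (c g) * laurent (shift g).
  suff [E ED] : exists2 E, (E <= D)%N & laurent_span E (\prod_i y i ^+ x i) by apply: spanW.
  suff [E ED] : exists2 E, (E <= \sum_(i < N) C * d)%N & laurent_span E (\prod_i y i ^+ x i).
    by exists E => //; apply: leq_trans ED _; rewrite sum_nat_const card_ord.
  apply: (big_ind2 (fun (E : nat) z => exists2 E', (E' <= E)%N & laurent_span E' z)).
  - by exists 0%N => //; apply: span1.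
  - move=> E1 z1 E2 z2 [E1' h1 s1] [E2' h2 s2].
    by exists (E1' + E2')%N; [apply: leq_add|apply: spanM].
  by move=> i _; exists (C * x i)%N; [rewrite leq_mul2l ltnW ?orbT|apply: span_exp].
have [c cP] := fin_all_exists monE.
pose M : 'M[k]_(#|{: X}|, #|{: G}|) := \matrix_(i, j) c (enum_val i) (enum_val j).
have : kermx M != 0.
  rewrite kermx_eq0 /row_free; apply: contraTneq cardXG => <-.
  by rewrite -leqNgt rank_leq_col.
case/rowV0Pn=> v /sub_kermxP vM v0.
pose mon (x : X) : 'X_{1..N} := [multinom (x i : nat) | i < N].
have mon_inj : injective mon.
  move=> x x' /mnmP h; apply/ffunP=> i; apply: val_inj.
  by have := h i; rewrite !mnmE.
exists (\sum_i v 0 i *: 'X_[mon (enum_val i)]).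
  case/rV0Pn: v0 => i vi; apply: contraNneq vi => /(congr1 (mcoeff (mon (enum_val i)))).
  rewrite mcoeff0 raddf_sum (bigD1 i) //= big1 => [|j ji].
    by rewrite mcoeffZ mcoeffX eqxx mulr1 addr0 => ->.
  rewrite mcoeffZ mcoeffX (inj_eq mon_inj) (inj_eq enum_val_inj) (negPf ji).
  by rewrite mulr0.
rewrite raddf_sum /=.
transitivity (\sum_i iota (v 0 i) * \sum_j iota (M i j) * laurent (shift (enum_val j))).
  apply: eq_bigr => i _; rewrite mmapZ mmapX; congr (_ * _).
  rewrite /mmap1; have -> : \prod_(i0 < N) y i0 ^+ mon (enum_val i) i0 = \prod_j y j ^+ (enum_val i) j.
    by apply: eq_bigr => j _; rewrite mnmE.
  rewrite cP [LHS](reindex_onto enum_val enum_rank) /=; last by move=> g _; rewrite enum_rankK.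
  by apply: eq_big => j; rewrite ?enum_valK ?eqxx // => _; rewrite mxE.
under eq_bigr do rewrite mulr_sumr.
rewrite exchange_big big1 //= => j _.
under eq_bigr do rewrite mulrA -rmorphM.
rewrite -mulr_suml -rmorph_sum; have := congr1 (fun A : 'rV_#|{: G}| => A 0 j) vM.
by rewrite !mxE => ->; rewrite rmorph0 mul0r.
Qed.

End AlgebraicDependence.

Section IdealUpToPowers.

Variables (K : fieldType) (s m : nat) (Y : {mpoly K[s]}) (F : 'I_m -> {mpoly K[s]}).
Local Notation ratfun := (rational_fun K s).
Implicit Types (x y : ratfun).

(** Membership in the ideal generated by the [F i] in the localization of the polynomial ring at
    [Y], viewed inside the fraction field; [is_loc] is that localization. *)
Definition in_ideal x := exists k (c : 'I_m -> {mpoly K[s]}),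
  of_poly Y ^+ k * x = of_poly (\sum_i c i * F i).

Definition is_loc x := exists k g, of_poly Y ^+ k * x = of_poly g.

Lemma in_ideal0 : in_ideal 0.
Proof.
exists 0%N, (fun _ => 0); rewrite mulr0 big1 ?/of_poly ?rmorph0 // => i _.
by rewrite mul0r.
Qed.

Lemma in_idealD x y : in_ideal x -> in_ideal y -> in_ideal (x + y).
Proof.
move=> [k [c hc]] [l [d hd]].
exists (k + l)%N, (fun i => Y ^+ l * c i + Y ^+ k * d i).
rewrite mulrDr exprD [X in X + _]mulrAC hc -mulrA hd /of_poly -!rmorphXn -!rmorphM -rmorphD.
congr tofrac; rewrite mulrC !mulr_sumr -big_split; apply: eq_bigr => i _.
by rewrite mulrDl !mulrA.
Qed.

Lemma in_idealM x y : is_loc x -> in_ideal y -> in_ideal (x * y).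
Proof.
move=> [k [g hg]] [l [d hd]]; exists (k + l)%N, (fun i => g * d i).
rewrite exprD mulrACA hg hd /of_poly -rmorphM mulr_sumr; congr tofrac.
by apply: eq_bigr => i _; rewrite mulrA.
Qed.

Lemma is_locM x y : is_loc x -> is_loc y -> is_loc (x * y).
Proof.
move=> [k [g hg]] [l [d hd]]; exists (k + l)%N, (g * d).
by rewrite exprD mulrACA hg hd /of_poly rmorphM.
Qed.

Lemma is_loc_poly g : is_loc (of_poly g).
Proof. by exists 0%N, g; rewrite expr0 mul1r. Qed.

Lemma is_locB x y : is_loc x -> in_ideal y -> is_loc (x - y).
Proof.
move=> [k [g hg]] [l [d hd]].
exists (k + l)%N, (Y ^+ l * g - Y ^+ k * (\sum_i d i * F i)).
rewrite mulrBr exprD [X in X - _]mulrAC hg -mulrA hd.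
by rewrite /of_poly -!rmorphXn -!rmorphM -rmorphB mulrC.
Qed.

Definition congr_ideal x y := [/\ is_loc x, is_loc y & in_ideal (x - y)].

Lemma congr_ideal_refl x : is_loc x -> congr_ideal x x.
Proof. by move=> h; split=> //; rewrite subrr; apply: in_ideal0. Qed.

Lemma congr_idealM x x' y y' :
  congr_ideal x x' -> congr_ideal y y' -> congr_ideal (x * y) (x' * y').
Proof.
move=> [h1 h2 h3] [h4 h5 h6]; split; try exact: is_locM.
have -> : x * y - x' * y' = x * (y - y') + y' * (x - x').
  by rewrite !mulrBr [y' * x]mulrC [y' * x']mulrC addrA subrK.
by apply: in_idealD; apply: in_idealM.
Qed.

Lemma congr_ideal_exp x y k : congr_ideal x y -> congr_ideal (x ^+ k) (y ^+ k).
Proof.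
move=> h; elim: k => [|k IH]; last by rewrite !exprS; apply: congr_idealM.
by rewrite !expr0; apply: congr_ideal_refl; exists 0%N, 1; rewrite expr0 mul1r /of_poly rmorph1.
Qed.

Lemma in_ideal_mmap (k : fieldType) (iota : {rmorphism k -> ratfun}) N (z y : 'I_N -> ratfun)
  (P : {mpoly k[N]}) :
  (forall a, is_loc (iota a)) -> (forall i, congr_ideal (z i) (y i)) ->
  in_ideal (mmap iota z P - mmap iota y P).
Proof.
move=> hi hzy; rewrite /mmap -sumrB.
apply: (big_ind in_ideal) => //; [exact: in_ideal0|exact: in_idealD|] => a _.
rewrite -mulrBr; apply: in_idealM => //.
suff [] : congr_ideal (mmap1 z a) (mmap1 y a) by [].
apply: (big_ind2 congr_ideal) => [||i _]; last exact: congr_ideal_exp.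
  by apply: congr_ideal_refl; exists 0%N, 1; rewrite expr0 mul1r /of_poly rmorph1.
by move=> *; apply: congr_idealM.
Qed.

End IdealUpToPowers.

Section GenericCover.

Variables (R : realFieldType) (n s N : nat) (eta : 'M[int]_(s, n)) (Sigma : {set {set 'I_s}}).
Variables (alpha : 'I_n.+1 -> 'cV[int]_s) (ix : 'I_N -> 'I_n.+1 * 'X_{1..s}).
Hypothesis ample_alpha : forall i, ample R eta Sigma (alpha i).
Hypothesis ix_enum : enumerates eta alpha ix.
Local Notation K := (gen_field N).
Local Notation F j := (base_change (generic_poly ix j)).
Local Notation uK k := (tofrac ('X_k : gen_ring N) : K).

Lemma base_generic i : F i = \sum_(k < N | (ix k).1 == i) uK k *: 'X_[(ix k).2].
Proof.
rewrite /base_change /generic_poly rmorph_sum; apply: eq_bigr => k _ /=.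
by rewrite map_mpolyZ map_mpolyX.
Qed.

Lemma generic_homog i : is_homog eta (F i) (alpha i).
Proof.
rewrite base_generic; apply: is_homog_sum => k /eqP ki; apply: is_homogZ.
apply: is_homog_lin (@is_homogX _ _ eta _ (ix k).2).
by apply/ix_enum.2; exists k; rewrite -ki -surjective_pairing.
Qed.

Lemma vertex_index J i : J \in Sigma -> cone_dim R eta J = n ->
  exists k, (ix k).1 = i /\ forall j, ((ix k).2 j == 0)%N = (j \in J).
Proof.
move=> JS dJ; have [e eP] := ample_vertex (ample_alpha i); have [h1 h2 h3] := eP J JS dJ.
have [k kE] : exists k, ix k = (i, mnm_of (e J)).
  by apply/ix_enum.2; rewrite mnm_ofK.
exists k; rewrite kE; split=> // j /=.
by rewrite mnmE -h3 absz_eq0.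
Qed.

Lemma generic_neq0 J i : J \in Sigma -> cone_dim R eta J = n -> F i != 0.
Proof.
move=> JS dJ; have [k [ki _]] := vertex_index i JS dJ.
rewrite base_generic; apply/eqP => /(congr1 (mcoeff (ix k).2)).
rewrite mcoeff0 raddf_sum (bigD1 k) ?ki //= big1 => [|l /andP[/eqP li lk]].
  rewrite mcoeffZ mcoeffX eqxx mulr1 addr0 => /eqP.
  by rewrite tofrac_eq0 -msupp_eq0 msuppX.
rewrite mcoeffZ mcoeffX; case: eqP => [e|_]; last by rewrite mulr0.
case/eqP: lk; apply: ix_enum.1; rewrite (surjective_pairing (ix l)) (surjective_pairing (ix k)).
by rewrite e li ki.
Qed.

(* On the chart of [J], the equation F_i = 0 expresses the vertex coefficient of F_i
   as a Laurent polynomial in the N - (n + 1) other coefficients and n characters.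
   By counting, the coefficients then satisfy an algebraic relation modulo the F_i,
   whose value is a nonzero scalar. *)
Lemma generic_vertex_cover J : J \in Sigma -> cone_dim R eta J = n ->
  exists (k : nat) (c : 'I_n.+1 -> {mpoly K[s]}),
    (\prod_(j | j \notin J) 'X_j) ^+ k = \sum_i c i * F i.
Proof.
move=> JS dJ.
have [kv kvP] := fin_all_exists (fun i => vertex_index i JS dJ).
have kv_inj : injective kv.
  by move=> i i' /(congr1 (fun k => (ix k).1)); rewrite (kvP i).1 (kvP i').1.
pose Y : {mpoly K[s]} := \prod_(j | j \notin J) 'X_j.
pose av i := (ix (kv i)).2.
(* The vertex coefficients, one for each polynomial; these are the ones eliminated. *)
pose special k := kv (ix k).1 == k.
have /fin_all_exists[mu muE] k : exists m : 'cV[int]_n, mdiv (ix k).2 - mdiv (av (ix k).1) = eta *m m.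
  have h1 : lin_eq eta (mdiv (ix k).2) (alpha (ix k).1).
    by apply/ix_enum.2; exists k; rewrite -surjective_pairing.
  have h2 : lin_eq eta (mdiv (av (ix k).1)) (alpha (ix k).1).
    by apply/ix_enum.2; exists (kv (ix k).1); rewrite [LHS]surjective_pairing (kvP _).1.
  exact: lin_eq_trans h1 (lin_eq_sym h2).
pose z k : rational_fun K s := of_poly (uK k)%:MP.
pose y k := if special k then
    - (\sum_(l | ((ix l).1 == (ix k).1) && (l != k)) z l * xm K (mdiv (ix l).2 - mdiv (av (ix l).1)))
  else z k.
pose iota : {rmorphism rat -> rational_fun K s} :=
  (@tofrac {mpoly K[s]} \o @mpolyC s K \o @tofrac (gen_ring N) \o @mpolyC N rat)%FUN.
(* Replacing the n+1 special coefficients by n characters leaves fewer than [N] independent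
   quantities. *)
pose T : finType := ({k : 'I_N | ~~ special k} + 'I_n)%type.
pose tau (r : T) : rational_fun K s :=
  match r with inl k => z (val k) | inr l => xm K (col l eta) end.
have z0 k : z k != 0 by rewrite /z /of_poly tofrac_eq0 mpolyC_eq0 tofrac_eq0 -msupp_eq0 msuppX.
have tau0 r : tau r != 0 by case: r => [k|l]; [apply: z0|apply: xm_neq0].
pose C := (\sum_(k < N) \sum_(j < n) `|mu k j 0%R|%N).+1.
have muC k j : (`|mu k j 0%R| <= C)%N.
  by apply: leqW; rewrite (bigD1 k) //= (bigD1 j) //= -addnA leq_addr.
have laurentE (l : {k : 'I_N | ~~ special k}) (f : 'I_n -> int) :
    z (val l) * \prod_j xm K (col j eta) ^ f j =
    laurent tau (fun r => match r with inl k => (k == l)%:R | inr j => f j end).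
  rewrite /laurent big_sumType /=; congr (_ * _).
  rewrite (bigD1 l) //= eqxx expr1z big1 ?mulr1 // => k /negPf ->.
  by rewrite expr0z.
have span_zx l : ~~ special l -> laurent_span iota tau C
    (z l * xm K (mdiv (ix l).2 - mdiv (av (ix l).1))).
  move=> nl; rewrite muE xm_mulmx (laurentE (exist _ l nl)); apply: span_laurent => -[k|j] //.
  by case: (_ == _).
have y_span k : laurent_span iota tau C (y k).
  rewrite /y; case: (boolP (special k)) => [/eqP sk|nk].
    apply: spanN; apply: span_sum => l /andP[/eqP lk nlk]; apply: span_zx.
    by rewrite /special lk sk eq_sym.
  have -> : z k = z k * \prod_j xm K (col j eta) ^ (0 : int).
    by rewrite big1 ?mulr1 // => j _; rewrite expr0z.
  rewrite (laurentE (exist _ k nk) (fun=> 0)); apply: span_laurent => -[l|j] //.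
  by case: (_ == _).
have T_lt : (#|{: T}| < N)%N.
  rewrite card_sum card_ord card_sig.
  have := cardC (mem (codom kv)); rewrite card_codom // !card_ord => h.
  rewrite -[X in (_ < X)%N]h addnC addSn ltnS leq_add2l subset_leq_card //.
  apply/subsetP=> k; rewrite !inE /special => h'; apply: contra h' => /codomP[i ->].
  by rewrite (kvP i).1.
have [P P0 Py] := algebraic_dependence tau0 T_lt y_span.
(* The [z k] are the indeterminates themselves, so evaluating [P] at them returns [P], a nonzero
   element of the field of coefficients. *)
have zP : mmap iota z P = of_poly (tofrac P)%:MP.
  rewrite [in RHS](mpolyE P) /of_poly /mmap !raddf_sum /=; apply: eq_bigr => a _.
  rewrite -mul_mpolyC !rmorphM /=; congr (_ * _).
  rewrite mpolyXE_id !rmorph_prod; apply: eq_bigr => i _.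
  by rewrite !rmorphXn.
(* The vertex monomial involves only variables outside [J], so it becomes invertible once [Y] is;
   this allows the division solving [F_i = 0]. *)
have vertexE i : exists E b, Y ^+ E = 'X_[av i] * 'X_[b] :> {mpoly K[s]}.
  pose E := mdeg (av i); exists E.
  exists [multinom (if j \in J then 0 else E - av i j)%N | j < s].
  rewrite -mpolyXD -prodrXl mpolyXE_id big_mkcond; apply: eq_bigr => j _.
  rewrite mnmDE mnmE; case: (boolP (j \in J)) => jJ /=.
    by have := (kvP i).2 j; rewrite jJ => /eqP ->; rewrite expr0.
  by rewrite subnKC // /E mdegE (bigD1 j) //= leq_addr.
have zy k : congr_ideal Y (fun i => F i) (z k) (y k).
  have zl : is_loc Y (z k) by apply: is_loc_poly.
  suff hzy : in_ideal Y (fun i => F i) (z k - y k).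
    by split=> //; have := is_locB zl hzy; rewrite opprB addrC subrK.
  rewrite /y; case: (boolP (special k)) => [/eqP sk|nk]; last by rewrite subrr; apply: in_ideal0.
  pose i := (ix k).1; have [E [b YE]] := vertexE i.
  have FE : of_poly (F i) = xm K (mdiv (av i)) *
      (z k + \sum_(l | ((ix l).1 == i) && (l != k)) z l * xm K (mdiv (ix l).2 - mdiv (av (ix l).1))).
    rewrite base_generic /of_poly rmorph_sum (bigD1 k) ?eqxx //= mulrDr mulr_sumr; congr (_ + _).
      rewrite xm_mdiv mulrC /z /of_poly -mul_mpolyC rmorphM /av /i sk; exact.
    apply: eq_bigr => l /andP[/eqP li _].
    rewrite mulrCA li -xmD addrC subrK xm_mdiv /z /of_poly -mul_mpolyC rmorphM; exact.
  exists E, (fun i' => if i' == i then 'X_[b] else 0).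
  have -> : \sum_i' (if i' == i then 'X_[b] else 0) * F i' = 'X_[b] * F i.
    rewrite (bigD1 i) //= eqxx big1 ?addr0 // => i' ne; by rewrite ifN ?mul0r.
  rewrite opprK /of_poly -rmorphXn YE !rmorphM /= -!/(of_poly _) FE.
  by rewrite -xm_mdiv -mulrA mulrCA.
have iota_loc a : is_loc Y (iota a) by apply: is_loc_poly.
have [k [c]] := in_ideal_mmap P iota_loc zy.
rewrite Py subr0 zP /of_poly -rmorphXn -rmorphM => /eqP; rewrite tofrac_eq => /eqP e.
exists k, (fun i => (tofrac P)^-1 *: c i).
transitivity ((tofrac P)^-1 *: \sum_i c i * F i); last first.
  by rewrite scaler_sumr; apply: eq_bigr => i _; rewrite scalerAl.
rewrite -e mulrC mul_mpolyC scalerA mulVf ?scale1r //.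
by rewrite tofrac_eq0.
Qed.

(** Maximal cones suffice, since the monomial of a cone is a multiple of that of any larger cone. *)
Lemma generic_is_cover : complete_fan R eta Sigma ->
  (exists2 J, J \in Sigma & cone_dim R eta J = n) ->
  is_cover eta Sigma (fun i => F i).
Proof.
move=> fan [J0 J0S dJ0]; split=> [i|J JS].
  split; first exact: generic_neq0 J0S dJ0.
  by exists (alpha i); apply: generic_homog.
have [J' [J'S dJ' JJ']] := cone_in_maximal fan JS.
have [k [c e]] := generic_vertex_cover J'S dJ'.
exists k, (fun i => (\prod_(j | (j \notin J) && (j \in J')) 'X_j) ^+ k * c i).
rewrite (bigID (fun j => j \in J')) /= exprMn.
have -> : \prod_(j | (j \notin J) && (j \notin J')) 'X_j = \prod_(j | j \notin J') 'X_j :> {mpoly K[s]}.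
  apply: eq_bigl => j; case: (boolP (j \in J')) => [_|nj]; rewrite ?andbF ?andbT //.
  by apply: contra nj; apply: (subsetP JJ').
rewrite e mulr_sumr; apply: eq_bigr => i _; exact: mulrA.
Qed.

End GenericCover.

(** * The class of a point *)

Section PointCocycle.

Variables (K : fieldType) (n s : nat) (eta : 'M[int]_(s, n)) (P : 'M[int]_n).
Local Notation S := {mpoly K[s]}.
Local Notation ratfun := (rational_fun K s).
Local Notation gamma := (eta *m P).
Local Notation X := (\prod_j 'X_j : S).

Definition chi (mu : 'rV[int]_n) : ratfun := xm K (gamma *m mu^T).

Lemma chiD mu nu : chi (mu + nu) = chi mu * chi nu.
Proof. by rewrite /chi linearD mulmxDr xmD. Qed.

Lemma xm_beta0 : xm K (beta0 s) = of_poly X.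
Proof. by rewrite /xm /of_poly rmorph_prod; apply: eq_bigr => j _; rewrite mxE expr1z. Qed.

Lemma is_homog_coords : is_homog eta X (beta0 s).
Proof.
have -> : beta0 s = \sum_j delta_mx j 0.
  apply/colP=> j; rewrite summxE (bigD1 j) //= !mxE !eqxx big1 ?addr0 // => i /negPf ij.
  by rewrite mxE eq_sym ij.
apply: is_homog_prod => j _; rewrite -mdiv1; exact: is_homogX.
Qed.

Lemma coords_prod_neq0 : X != 0.
Proof. by apply/prodf_neq0 => j _; rewrite -msupp_eq0 msuppX. Qed.

(** An open set on which [prod x_j] is invertible lies in the torus, where all Laurent monomials are
    regular. *)
Lemma in_loc_torus f h E b : f != 0 -> f = X * h -> is_homog eta h E -> in_loc eta f b (xm K b).
Proof.
move=> f0 fE hh; pose N := (\sum_j `|b j 0%R|)%N.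
have hf : is_homog eta f (beta0 s + E) by rewrite fE; apply: is_homogM => //; apply: is_homog_coords.
have -> : xm K b = xm K (b + beta0 s *+ N) * \prod_(i < N) (of_poly X)^-1.
  by rewrite prodr_const card_ord xmD xmMn xm_beta0 exprVn mulfK // expf_neq0 // tofrac_eq0 coords_prod_neq0.
apply: (@in_loc_lin _ _ _ _ _ ((b + beta0 s *+ N) + \sum_(i < N) - beta0 s)).
  by rewrite sumr_const card_ord mulNrn addrK; apply: lin_eq_refl.
apply: in_locM => //; last first.
  apply: in_loc_prod hf _ => // i _.
  exact: in_loc_inv f0 is_homog_coords hh fE.
apply: in_loc_xm hf _ => j; rewrite mxE mulmxnE mxE.
have : (`|b j 0%R| <= N)%N by rewrite /N (bigD1 j) //= leq_addr.
by rewrite -[1 *+ N]/(N%:R) natz; move: (b j 0) => x; lia.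
Qed.

Variables (m : nat) (f : 'I_m -> S) (a0 : 'I_m -> 'cV[int]_s) (mm : 'I_m -> 'rV[int]_n).
Variable (i0 : 'I_m).
Hypothesis f_neq0 : forall k, f k != 0.
Hypothesis f_homog : forall k, is_homog eta (f k) (a0 k).
Hypothesis f_i0 : f i0 = X.
Hypothesis mm_i0 : mm i0 = 0.
Hypothesis fE : forall k, k != i0 -> of_poly (f k) = xm K (a0 k) * (chi (mm k) - 1).

Variables (v : 'rV[rat]_n) (L B : nat).
Definition exps (u : {ffun 'I_n -> 'I_m}) : 'M[int]_n := \matrix_i mm (u i).
Hypothesis vL : infinitesimal L v.
Hypothesis adjL : forall u i j, (`|\adj (exps u) i j| <= L)%N.
Hypothesis boxB : forall u mu k, \det (exps u) != 0 -> in_pip v (exps u) mu ->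
  forall j, (`|mu 0%R j| + `|mm k 0%R j| <= B)%N.

(* On tuples containing [i0] the product in the denominator is 0, and so is the sign. *)
Definition cone_gen (u : {ffun 'I_n -> 'I_m}) : ratfun :=
  (sgz (\det (exps u)))%:~R * pip_sum chi v B (exps u) / \prod_k (chi (mm (u k)) - 1)
    * xm K (- beta0 s).

Lemma cone_gen_i0 (u : {ffun 'I_n -> 'I_m}) : i0 \in codom u -> cone_gen u = 0.
Proof.
case/codomP=> k uk; rewrite /cone_gen (_ : \det _ = 0) ?sgz0 ?mul0r //.
rewrite (expand_det_row _ k) big1 // => j _; rewrite mxE -uk mm_i0.
by rewrite mxE mul0r.
Qed.

Lemma chi_neq1 k : k != i0 -> chi (mm k) - 1 != 0.
Proof.
move=> /fE e; apply: contraTneq (f_neq0 k) => h; apply/negPn.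
by rewrite -[_ == 0]tofrac_eq0 -/(of_poly _) e h mulr0.
Qed.

(** [pip_cocycle] for the n+1 exponents of [t], divided by all the factors [chi - 1] and by
    [prod x_j]. *)
Lemma cone_gen_sd0 (t : {ffun 'I_n.+1 -> 'I_m}) : i0 \notin codom t -> sd cone_gen t = 0.
Proof.
move=> ht; have ti k : t k != i0 by apply: contraNneq ht => <-; apply: codom_f.
pose T : 'M[int]_(n.+1, n) := \matrix_i mm (t i).
have TE i : row' i T = exps (omit t i) by apply/matrixP=> k l; rewrite !mxE ffunE.
have p0 : \prod_k (chi (mm (t k)) - 1) != 0 by apply/prodf_neq0 => k _; apply: chi_neq1.
have gen i : \det (row' i T) != 0 -> generic v (row' i T).
  rewrite TE => d0; apply: infinitesimal_generic vL d0 _; exact: adjL.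
have hB i mu : \det (row' i T) != 0 -> in_pip v (row' i T) mu ->
     forall j, (`|mu 0%R j| + `|T i j| <= B)%N.
  by rewrite TE => d0 pm j; have := boxB (t i) d0 pm j; rewrite mxE.
have := pip_cocycle chiD gen hB.
move=> /(congr1 (fun x => x / \prod_k (chi (mm (t k)) - 1) * xm K (- beta0 s))).
rewrite !mul0r => e; rewrite -[RHS]e !mulr_suml; apply: eq_bigr => i _.
rewrite /cone_gen TE rowK (prod_omit (fun k => chi (mm k) - 1) t i).
have c0 := chi_neq1 (ti i); set sg := (sgz _)%:~R; set ps := pip_sum _ _ _ _.
set q := \prod_k _; set c := chi (mm (t i)) - 1 in c0 *.
rewrite !mulrA; congr (_ * _); rewrite invfM mulrA; congr (_ / _).
by rewrite [RHS]mulfK.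
Qed.

(** With [i0] in the tuple all monomials are regular, and each factor [chi - 1] is an equation of
    the cover up to a monomial. *)
Lemma in_loc_cone_gen (t : {ffun 'I_n.+1 -> 'I_m}) i : i0 \in codom t ->
  in_loc eta (\prod_k f (t k)) (- beta0 s) (cone_gen (omit t i)).
Proof.
set ft := \prod_k _ => it.
have ft0 : ft != 0 by apply/prodf_neq0 => k _.
have fth : is_homog eta ft (\sum_k a0 (t k)) by apply: is_homog_prod => k _.
have [iu|niu] := boolP (i0 \in codom (omit t i)).
  by rewrite cone_gen_i0 //; apply: in_loc0 fth.
have tor b : in_loc eta ft b (xm K b).
  case/codomP: it => k tk.
  apply: (@in_loc_torus _ (\prod_(k' | k' != k) f (t k')) (\sum_(k' | k' != k) a0 (t k'))) => //.
    by rewrite /ft (bigD1 k) //= -tk f_i0.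
  by apply: is_homog_prod => k' _.
rewrite /cone_gen -prodfV; set u := omit t i.
have deg : lin_eq eta (0 + \sum_k (a0 (u k) - a0 (u k)) + - beta0 s) (- beta0 s).
  rewrite big1 ?addr0 ?add0r; last by move=> k _; rewrite subrr.
  exact: lin_eq_refl.
apply: (in_loc_lin deg); apply: (in_locM ft0 _ (tor _)); apply: (in_locM ft0).
  apply: (@in_loc_lin _ _ _ _ _ (0 + 0)); first by rewrite addr0; apply: lin_eq_refl.
  apply: (in_locM ft0).
    have := in_loc_poly fth (@is_homogC _ _ eta _ ((sgz (\det (exps u)))%:~R : K)).
    by rewrite /of_poly [_%:MP]rmorph_int rmorph_int.
  rewrite /pip_sum; apply: (in_loc_sum _ ft0 fth) => mu _; apply: in_loc_lin (tor _).
  by exists (P *m mu^T); rewrite subr0 mulmxA.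
apply: (in_loc_prod _ ft0 fth) => k _.
have ui : u k != i0 by apply: contraNneq niu => <-; apply: codom_f.
have -> : (chi (mm (u k)) - 1)^-1 = xm K (a0 (u k)) * (of_poly (f (u k)))^-1.
  by rewrite fE // invfM mulrA divff ?mul1r // xm_neq0.
apply: (in_locM ft0) => //; rewrite /u ffunE.
apply: (@in_loc_inv _ _ _ eta ft _ _ (\prod_(k' | k' != lift i k) f (t k')) (\sum_(k' | k' != lift i k) a0 (t k'))) => //.
  by apply: is_homog_prod => k' _.
by rewrite /ft (bigD1 (lift i k)).
Qed.

(** On tuples through [i0] each term of the coboundary is regular; on the others the terms need not
    be, but their sum is 0. *)
Lemma cone_gen_cocycle : is_cocycle eta f (scoch eta (sd cone_gen)).
Proof.
apply: (@scoch_cocycle _ _ _ _ _ _ _ _ cone_gen) => // t.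
have ft0 : \prod_k f (t k) != 0 by apply/prodf_neq0 => k _.
have fth : is_homog eta (\prod_k f (t k)) (\sum_k a0 (t k)) by apply: is_homog_prod => k _.
have [it|it] := boolP (i0 \in codom t); last by rewrite cone_gen_sd0 //; apply: in_loc0 fth.
apply: (in_loc_sum _ ft0 fth) => i _.
rewrite -signr_odd; case: (odd i); rewrite ?expr1 ?expr0 ?mul1r; last exact: in_loc_cone_gen.
rewrite -[- beta0 s]add0r; apply: (in_locM ft0); last exact: in_loc_cone_gen.
have := in_loc_poly fth (@is_homogC _ _ eta _ (-1 : K)).
by rewrite /of_poly rmorphN1 rmorphN1.
Qed.

Lemma sd_cone_gen_first (t : {ffun 'I_n.+1 -> 'I_m}) : (forall k, t (lift ord0 k) != i0) -> t ord0 = i0 ->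
  sd cone_gen t = cone_gen (omit t ord0).
Proof.
move=> ht t0; rewrite /sd big_ord_recl expr0 mul1r big1 ?addr0 // => i _.
rewrite cone_gen_i0 ?mulr0 //; apply/codomP; case: i => i hi; have n0 : (0 < n)%N by case: n hi.
exists (Ordinal n0); rewrite ffunE -t0; congr (t _); apply: val_inj.
by rewrite /= /bump.
Qed.

End PointCocycle.

(** Unit vectors are [last_pos], so [v] has coordinates in (0, 1) and the shifted unit cube contains
    only [(1, ..., 1)]. Its character [t_1 ... t_n] turns the forms [dt_l / t_l] into [dt_l]. *)
Lemma in_pip_scalar1 n v L (mu : 'rV[int]_n) : (0 < L)%N -> infinitesimal L v ->
  in_pip v 1%:M mu = (mu == const_mx 1).
Proof.
move=> L0 [v1 vL].
have vj j : 0 < v 0 j < 1.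
  pose c : 'cV[int]_n := delta_mx j 0.
  have cL (k : 'I_n) : (`|c k 0%R| <= L)%N.
    by rewrite mxE; case: (_ && _).
  have dotE : (v *m ratm c) 0 0 = v 0 j.
    rewrite mxE (bigD1 j) //= big1 => [|k /negPf kj]; rewrite !mxE ?eqxx ?kj ?mulr1 ?mulr0 //.
    by rewrite addr0.
  have [h1 h2] := vL _ cL; rewrite dotE in h1 h2; apply/andP; split.
    apply: h2; exists j; first by rewrite !mxE !eqxx.
    by move=> k jk; rewrite !mxE andbT; case: eqP jk => // ->; rewrite ltnn.
  by apply: le_lt_trans (ler_norm _) h1.
have cE y : coords (1%:M : 'M_n) y = y by rewrite /coords /ratm map_mx1 invmx1 mulmx1.
apply/forallP/eqP => [h|-> j].
  apply/rowP=> j; have := h j; have := vj j; rewrite cE mxE [(- v) 0 j]mxE [ratm _ 0 j]mxE mxE.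
  move: (mu 0 j) (v 0 j) => x y /andP[y0 y1] /andP[h1 h2].
  have : (0 < x)%R by rewrite -(ltr0z rat); lra.
  have : x < 2 by rewrite -(ltr_int rat); lra.
  by lia.
by have := vj j; rewrite cE !mxE; lra.
Qed.

Section PointForm.

Variables (K : fieldType) (n s : nat) (eta : 'M[int]_(s, n)) (P : 'M[int]_n).
Local Notation ratfun := (rational_fun K s).

Lemma torus_charE l : torus_char K eta P l = xm K (col l (eta *m P)).
Proof. by apply: eq_bigr => j _; rewrite [(col _ _) _ _]mxE. Qed.

Lemma chi_delta l : chi K eta P (delta_mx 0 l) = torus_char K eta P l.
Proof. by rewrite torus_charE /chi trmx_delta -colE. Qed.

Lemma chi_const1 : chi K eta P (const_mx 1) = \prod_l torus_char K eta P l.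
Proof.
rewrite /chi xm_mulmx; apply: eq_bigr => l _.
by rewrite !mxE expr1z torus_charE.
Qed.

Lemma cone_gen_basis m (mm : 'I_m -> 'rV[int]_n) (u : {ffun 'I_n -> 'I_m}) v L B :
  (0 < L)%N -> (0 < B)%N -> infinitesimal L v -> (forall k, mm (u k) = delta_mx 0 k) ->
  cone_gen K eta P mm v B u =
  \prod_l torus_char K eta P l / \prod_l (torus_char K eta P l - 1) * xm K (- beta0 s).
Proof.
move=> L0 B0 vL mmu.
have e1 : exps mm u = 1%:M.
  by apply/matrixP=> i j; rewrite mxE mmu !mxE eqxx eq_sym.
rewrite /cone_gen e1 det1 sgz1 mul1r -chi_const1; congr (_ / _ * _); last first.
  by apply: eq_bigr => l _; rewrite mmu chi_delta.
rewrite /pip_sum -big_filter.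
suff -> : [seq mu <- box n B | in_pip v 1%:M mu] = [:: const_mx 1] by rewrite big_seq1.
rewrite (eq_filter (fun mu => @in_pip_scalar1 _ v L mu L0 vL)).
apply: perm_small_eq => //; apply: uniq_perm; rewrite ?filter_uniq ?box_uniq // => mu.
rewrite mem_filter inE; case: eqP => //= ->; rewrite mem_box.
by apply/forallP=> j; rewrite mxE.
Qed.

Lemma omit_prod (t : {ffun 'I_n -> 'I_s}) : injective t ->
  \prod_(j | j \notin codom t) of_poly 'X_j = xm K (beta0 s) / \prod_k of_poly 'X_(t k) :> ratfun.
Proof.
move=> t_inj; rewrite xm_beta0 /of_poly rmorph_prod /= [X in X / _](bigID (fun j => j \in codom t)) /=.
have <- : \prod_(j | j \in codom t) tofrac 'X_j = \prod_k tofrac 'X_(t k) :> ratfun.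
  rewrite -big_uniq /=; last by rewrite map_inj_uniq ?enum_uniq.
  by rewrite big_map big_enum.
rewrite [X in _ = X / _]mulrC mulfK //; apply/prodf_neq0 => k _; exact: of_polyX_neq0.
Qed.

(** The logarithmic forms [dt_l / t_l] are integral combinations of the [dx_j / x_j] with matrix
    [eta P]; their wedge product is [det P] times [x^(- beta0) Omega]. *)
Lemma point_formE : point_form K eta P =
  ((\det P)%:~R * (\prod_l torus_char K eta P l / \prod_l (torus_char K eta P l - 1) * xm K (- beta0 s)))
    *: Omega K eta.
Proof.
apply/ffunP=> t; rewrite !ffunE.
set d1 := \det _; set tc := \prod_l torus_char K eta P l; set p := \prod_l (torus_char K eta P l - 1).
rewrite /GRing.scale /=.
pose G : 'M[ratfun]_n := \matrix_(l, k) (eta (t k) l)%:~R.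
have -> : d1 = tc * (\det P)%:~R * \det G * \prod_k (of_poly 'X_(t k))^-1.
  have -> : (\det P)%:~R = \det (map_mx intr P)^T :> ratfun by rewrite det_tr det_map_mx.
  have -> : tc = \det (diag_mx (\row_l torus_char K eta P l)).
    by rewrite det_diag; apply: eq_bigr => l _; rewrite mxE.
  have -> : \prod_k (of_poly 'X_(t k))^-1 = \det (diag_mx (\row_k (of_poly 'X_(t k))^-1 : 'rV[ratfun]_n)).
    by rewrite det_diag; apply: eq_bigr => l _; rewrite mxE.
  rewrite -!det_mulmx; congr (\det _); apply/matrixP=> l k.
  rewrite [LHS]mxE mul_mx_diag [RHS]mxE; congr (_ * _); last by rewrite mxE.
  rewrite -mulmxA mul_diag_mx [RHS]mxE mulrC; congr (_ * _); first by rewrite mxE.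
  rewrite !mxE rmorph_sum; apply: eq_bigr => p' _.
  by rewrite !mxE rmorphM mulrC.
have [t_inj|t_ninj] := boolP (injectiveb t).
  rewrite omit_prod; last exact/injectiveP.
  rewrite xmN prodfV; set q := \prod_k _; set D := (\det P)%:~R; set g := \det G.
  have x0 : xm K (beta0 s) != 0 := xm_neq0 K (beta0 s).
  move: (xm K (beta0 s)) x0 => x x0.
  rewrite [RHS](_ : _ = (tc * D * g / q / p) * (x / x)); first by rewrite divff // mulr1.
  by rewrite !mulrA; ring.
have -> : \det G = 0.
  case/injectivePn: t_ninj => i [j ij tij]; rewrite -det_tr; apply: (determinant_alternate ij) => l.
  by rewrite !mxE tij.
by rewrite !mulr0 !mul0r mulr0.
Qed.

End PointForm.

(** * The cover attached to the vertices *)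

Section FieldIdentities.

Variable L : fieldType.
Implicit Types a b c d e g p x : L.

Lemma mul_divK x c : x != 0 -> c = x * c / x.
Proof. by move=> x0; rewrite mulrAC divff ?mul1r. Qed.

Lemma div_div_regroup a b c d e : a * b / (c / d) * e = a * (b * d * e) / c.
Proof. by rewrite invf_div; ring. Qed.

Lemma sub_div_regroup a b c d e g p :
  a * (b * c) / (d * p) - a * (e * g / p) = a * (b * c / d - e * g) / p.
Proof. by rewrite invfM; ring. Qed.

End FieldIdentities.

Section FlagMonomials.

Variables (K : fieldType) (n s : nat) (sg : n.+1.-tuple {set 'I_s}).
Local Notation sgk := (nth setT sg).
Hypothesis sgk0 : sgk 0 = set0.
Hypothesis sgk_sub : forall k, (k < n)%N -> sgk k \subset sgk k.+1.

Lemma sgk_last : sgk n.+1 = setT.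
Proof. by rewrite nth_default // size_tuple. Qed.

Lemma flag_zE i : of_poly (flag_z K sg i) = xm K (flag_z_deg sg i).
Proof.
rewrite /flag_z /xm /of_poly rmorph_prod big_mkcond; apply: eq_bigr => j _.
by rewrite mxE; case: (j \in _); rewrite ?expr1z ?expr0z.
Qed.

Lemma sum_flag_z_deg : \sum_i flag_z_deg sg i = beta0 s.
Proof.
apply/colP=> j; rewrite summxE mxE.
transitivity (\sum_(0 <= i < n.+1) ((j \in sgk i.+1)%:R - (j \in sgk i)%:R : int)).
  rewrite big_mkord; apply: eq_bigr => i _; rewrite mxE inE.
  have : sgk i \subset sgk i.+1.
    have := ltn_ord i; rewrite ltnS leq_eqVlt => /orP[/eqP->|/sgk_sub//].
    by rewrite sgk_last subsetT.
  move/subsetP/(_ j); case: (j \in sgk i) => [->//|_]; by rewrite subr0.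
by rewrite telescope_sumr // sgk_last sgk0 !inE subr0.
Qed.

Lemma flag_step_lift (k : 'I_n) : flag_step sg (lift ord_max k) = sgk k.+1 :\: sgk k.
Proof. by rewrite /flag_step /= /bump leqNgt ltn_ord. Qed.

Lemma flag_step_max : flag_step sg ord_max = ~: sgk n.
Proof. by rewrite /flag_step /= sgk_last setTD. Qed.

End FlagMonomials.

Section VertexCover.

Variables (K : fieldType) (n s q : nat) (eta : 'M[int]_(s, n)) (P : 'M[int]_n).
Variable (sg : n.+1.-tuple {set 'I_s}).
Local Notation sgk := (nth setT sg).
Local Notation gamma := (eta *m P).
Local Notation S := {mpoly K[s]}.
Hypothesis sgk0 : sgk 0 = set0.
Hypothesis sgk_sub : forall k, (k < n)%N -> sgk k \subset sgk k.+1.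
Hypothesis gamma0 : forall (k : 'I_n) l j, (l <= k)%N -> j \in sgk l -> gamma j k = 0.
Hypothesis gamma_gt0 : forall (k : 'I_n) j, j \in sgk k.+1 -> j \notin sgk k -> 0 < gamma j k.
Hypothesis step_ex : forall k : 'I_n, exists j, (j \in sgk k.+1) && (j \notin sgk k).

Variables (Jc : 'I_q -> {set 'I_s}) (eJ : 'I_q -> 'cV[int]_s) (es : 'cV[int]_s).
Variables (cc : 'I_q -> 'cV[int]_n) (ty : 'I_q -> 'I_n).
Hypothesis eJ_ge0 : forall i j, 0 <= eJ i j 0.
Hypothesis eJ_eq0 : forall i j, (eJ i j 0 == 0) = (j \in Jc i).
Hypothesis es_ge0 : forall j, 0 <= es j 0.
Hypothesis es_eq0 : forall j, (es j 0 == 0) = (j \in sgk n).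
Hypothesis ccE : forall i, gamma *m cc i = eJ i - es.
Hypothesis ty_sub : forall i, sgk (ty i) \subset Jc i.
Hypothesis ty_notin : forall i j, j \in sgk (ty i).+1 -> j \notin sgk (ty i) -> j \notin Jc i.

Lemma sgk_mono k l : (k <= l <= n)%N -> sgk k \subset sgk l.
Proof.
elim: l => [|l IH] /andP[kl ln]; first by move: kl; rewrite leqn0 => /eqP->.
move: kl; rewrite leq_eqVlt => /orP[/eqP->//|]; rewrite ltnS => kl.
by apply: subset_trans (sgk_sub ln); apply: IH; rewrite kl ltnW.
Qed.

Lemma es_sgk j : j \in sgk n -> es j 0 = 0.
Proof. by rewrite -es_eq0 => /eqP. Qed.

(** On a ray of sigma_{k+1} the exponent [es] and all basis characters after [k] vanish, so only
    coordinate [k] contributes. *)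
Lemma cc_at i (k : 'I_n) j : j \in sgk k.+1 -> (forall l : 'I_n, (l < k)%N -> cc i l 0 = 0) ->
  gamma j k * cc i k 0 = eJ i j 0.
Proof.
move=> jk h; have := congr1 (fun A : 'cV_s => A j 0) (ccE i).
rewrite /= mxE [(eJ i - es) j 0]mxE [(- es) j 0]mxE es_sgk ?subr0 => [<-|]; last first.
  by apply: (subsetP (sgk_mono _)) jk; rewrite ltn_ord leqnn.
rewrite (bigD1 k) //= big1 ?addr0 // => l lk; have [lk'|kl] := ltnP l k.
  by rewrite h ?mulr0.
rewrite (@gamma0 l k.+1 j) ?mul0r // ltn_neqAle kl andbT eq_sym.
by apply: contra lk => /eqP e; apply/eqP/val_inj.
Qed.

(** Up to its type, [Jc i] contains the rays of the flag and its vertex exponent vanishes on them.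
    At the type itself that exponent is positive, which gives [cc_gt0]. *)
Lemma cc0 i (k : 'I_n) : (k < ty i)%N -> cc i k 0 = 0.
Proof.
have [m] := ubnP k; elim: m k => // m IH k; rewrite ltnS => km kt.
have [j /andP[j1 j2]] := step_ex k.
have h : forall l : 'I_n, (l < k)%N -> cc i l 0 = 0.
  by move=> l lk; apply: IH; [apply: leq_trans lk km|apply: ltn_trans lk kt].
have := cc_at j1 h; have /eqP -> : eJ i j 0 == 0.
  rewrite eJ_eq0; apply: (subsetP (ty_sub i)); apply: (subsetP (sgk_mono _)) j1.
  by rewrite kt ltnW.
by move/eqP; rewrite mulf_eq0 gt_eqF ?gamma_gt0 // => /eqP.
Qed.

Lemma cc_gt0 i : 0 < cc i (ty i) 0.
Proof.
have [j /andP[j1 j2]] := step_ex (ty i).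
have e := cc_at j1 (@cc0 i); have g := gamma_gt0 j1 j2.
by rewrite -(pmulr_rgt0 _ g) e lt_neqAle eJ_ge0 eq_sym eJ_eq0 ty_notin.
Qed.

Lemma z_ty_le i j : 0 <= (eJ i - flag_z_deg sg (lift ord_max (ty i))) j 0.
Proof.
rewrite !mxE flag_step_lift inE; case: (boolP (_ && _)) => [/andP[h1 h2]|_]; last by rewrite subr0.
have : eJ i j 0 != 0 by rewrite eJ_eq0 ty_notin.
by have := eJ_ge0 i j; rewrite mulr1n; move: (eJ i j 0) => x; lia.
Qed.

Lemma z_last_le j : 0 <= (es - flag_z_deg sg ord_max) j 0.
Proof.
rewrite !mxE flag_step_max inE -es_eq0; have := es_ge0 j.
by case: (eqVneq (es j 0) 0) => [->|]; rewrite /= ?subr0 // mulr1n; move: (es j 0) => x; lia.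
Qed.

Lemma beta0_z_le j : 0 <= (beta0 s - flag_z_deg sg ord_max) j 0.
Proof. by rewrite !mxE; case: (j \in _). Qed.

(* The index set is that of T = prod_j x_j, followed by the maximal cones other
   than sigma_n. *)
Definition vtx (k : 'I_(1 + q)) : S :=
  match split k with
  | inl _ => \prod_j 'X_j
  | inr i => 'X_[mnm_of (eJ i)] - 'X_[mnm_of es]
  end.

Definition vtx_deg (k : 'I_(1 + q)) : 'cV[int]_s := if split k is inr _ then es else beta0 s.

Definition vtx_exp (k : 'I_(1 + q)) : 'rV[int]_n := if split k is inr i then (cc i)^T else 0.

(** The row of [prod x_j] is placed entirely on [z_{n+1}], so that the minors omitting the last
    column vanish on tuples containing the torus, just as [cone_gen] does. *)
Definition vtx_row (k : 'I_(1 + q)) (c : 'I_n.+1) : S :=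
  match split k, unlift ord_max c with
  | inl _, Some _ => 0
  | inl _, None => 'X_[mnm_of (beta0 s - flag_z_deg sg ord_max)]
  | inr i, Some l => if l == ty i then 'X_[mnm_of (eJ i - flag_z_deg sg (lift ord_max l))] else 0
  | inr i, None => - 'X_[mnm_of (es - flag_z_deg sg ord_max)]
  end.

Lemma eJ_lin i : lin_eq eta (eJ i) es.
Proof. by exists (P *m cc i); rewrite -ccE mulmxA. Qed.

Lemma vtx_homog k : is_homog eta (vtx k) (vtx_deg k).
Proof.
rewrite /vtx /vtx_deg; case: split => [_|i]; first exact: is_homog_coords.
apply: is_homogD; last by apply: is_homogN; apply: is_homog_mnm_of.
by apply: is_homog_lin (eJ_lin i) _; apply: is_homog_mnm_of.
Qed.

Lemma vtx_row_homog k c : is_homog eta (vtx_row k c) (vtx_deg k - flag_z_deg sg c).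
Proof.
rewrite /vtx_row /vtx_deg; case: (split k) => [_|i]; case: unliftP => [l|] ->.
- exact: is_homog0.
- by apply: is_homog_mnm_of; apply: beta0_z_le.
- case: eqP => [->|_]; last exact: is_homog0.
  apply: is_homog_lin (is_homog_mnm_of eta (z_ty_le i)).
  by apply: lin_eqD; [apply: eJ_lin|apply: lin_eq_refl].
by apply: is_homogN; apply: is_homog_mnm_of; apply: z_last_le.
Qed.

Lemma of_poly_vtx_row k c : of_poly (vtx_row k c) =
  match split k, unlift ord_max c with
  | inl _, Some _ => 0
  | inl _, None => xm K (beta0 s - flag_z_deg sg ord_max)
  | inr i, Some l => if l == ty i then xm K (eJ i - flag_z_deg sg (lift ord_max l)) else 0
  | inr i, None => - xm K (es - flag_z_deg sg ord_max)
  end.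
Proof.
rewrite /vtx_row; case: (split k) => [_|i]; case: unliftP => [l|] _.
- by rewrite /of_poly rmorph0.
- by rewrite -xm_poly //; apply: beta0_z_le.
- case: eqP => [->|_]; last by rewrite /of_poly rmorph0.
  by rewrite -xm_poly //; apply: z_ty_le.
by rewrite xm_poly ?/of_poly ?rmorphN //; apply: z_last_le.
Qed.

Lemma of_poly_vtx k : of_poly (vtx k) =
  if split k is inr i then xm K (eJ i) - xm K es else xm K (beta0 s).
Proof.
rewrite /vtx; case: (split k) => [_|i]; first by rewrite xm_beta0.
by rewrite !xm_poly // /of_poly rmorphB.
Qed.

Lemma vtx_row_sum k : vtx k = \sum_c vtx_row k c * flag_z K sg c.
Proof.
apply/eqP; rewrite -tofrac_eq rmorph_sum; apply/eqP.
rewrite -/(of_poly _) of_poly_vtx big_ord_recr /=.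
have zE c : tofrac (vtx_row k c * flag_z K sg c) = of_poly (vtx_row k c) * xm K (flag_z_deg sg c).
  by rewrite rmorphM -flag_zE.
rewrite zE of_poly_vtx_row unlift_none.
case e : (split k) => [u|i].
  rewrite big1 ?add0r => [|c _]; first by rewrite -xmD subrK.
  rewrite zE of_poly_vtx_row e (_ : widen_ord _ c = lift ord_max c) ?liftK ?mul0r //.
  by apply: val_inj; rewrite /= /bump leqNgt ltn_ord.
rewrite (bigD1 (ty i)) //= big1 ?addr0 => [|c ct].
  rewrite zE of_poly_vtx_row e (_ : widen_ord _ _ = lift ord_max (ty i)); last first.
    by apply: val_inj; rewrite /= /bump leqNgt ltn_ord.
  by rewrite liftK eqxx -xmD subrK mulNr -xmD subrK.
rewrite zE of_poly_vtx_row e (_ : widen_ord _ c = lift ord_max c) ?liftK ?(negPf ct) ?mul0r //.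
by apply: val_inj; rewrite /= /bump leqNgt ltn_ord.
Qed.

Lemma vtx_chi k : split k != inl ord0 ->
  of_poly (vtx k) = xm K (vtx_deg k) * (chi K eta P (vtx_exp k) - 1).
Proof.
rewrite of_poly_vtx /vtx_deg /vtx_exp; case: (split k) => [u|i _]; first by rewrite ord1 eqxx.
by rewrite /chi trmxK ccE mulrBr mulr1 -xmD [es + _]addrC subrK.
Qed.

Lemma vtx_neq0 k : vtx k != 0.
Proof.
rewrite -tofrac_eq0 -/(of_poly _) of_poly_vtx; case: (split k) => [_|i]; first exact: xm_neq0.
rewrite subr_eq0; apply/eqP => /xm_inj e.
have [j /andP[j1 j2]] := step_ex (ty i).
have := ty_notin j1 j2; rewrite -eJ_eq0 e es_eq0 => /negP[].
by apply: (subsetP (sgk_mono _)) j1; rewrite ltn_ord leqnn.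
Qed.

Variables (v : 'rV[rat]_n) (L B : nat).
Hypothesis vL : infinitesimal L v.
Hypothesis adjL : forall u i j, (`|\adj (exps vtx_exp u) i j| <= L)%N.
Hypothesis gammaL : forall j k, (`|gamma j k| <= L)%N.
Hypothesis boxB : forall u mu, \det (exps vtx_exp u) != 0 -> in_pip v (exps vtx_exp u) mu ->
  forall j, (`|mu 0%R j| <= B)%N.

Definition ray_fun j : 'cV[int]_n := (row j gamma)^T.

Lemma ray_fun_entry j k i : ray_fun j k i = gamma j k.
Proof. by rewrite /ray_fun [LHS]mxE [LHS]mxE. Qed.

Lemma ray_funE (mu : 'rV[int]_n) j : (mu *m ray_fun j) 0 0 = (gamma *m mu^T) j 0.
Proof. by rewrite mxE [RHS]mxE; apply: eq_bigr => k _; rewrite ray_fun_entry [mu^T _ _]mxE mulrC. Qed.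

(** A ray entering the flag at sigma_{k+1} has its last nonzero coordinate at [k], and it is
    positive. This ties the order of the infinitesimals to the flag. *)
Lemma ray_fun_gt0 j : j \in sgk n -> 0 < (v *m ratm (ray_fun j)) 0 0.
Proof.
move=> jn; have exk : exists k, (k <= n)%N && (j \in sgk k) by exists n; rewrite leqnn.
have cL k : (`|ray_fun j k 0%R| <= L)%N by rewrite ray_fun_entry.
apply: (vL.2 _ cL).2.
case: (ex_minnP exk) => -[|k] /andP[kn jk] mink; first by rewrite sgk0 inE in jk.
have jk' : j \notin sgk k by apply/negP => h; have := mink k; rewrite h (ltnW kn) ltnn => /(_ isT).
exists (Ordinal kn); first by rewrite mxE ray_fun_entry ltr0z; apply: gamma_gt0.
by move=> l kl; rewrite mxE ray_fun_entry (@gamma0 l k.+1 j).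
Qed.

Section Correction.

Variables (u : {ffun 'I_n -> 'I_(1 + q)}) (J : 'I_n -> 'I_q).
Hypothesis uE : forall k, u k = rshift 1 (J k).
Let M := exps vtx_exp u.
Let tau k := ty (J k).
Let corner := \sum_k row k M.
(** The exponent of the monomial of [mu] once [cone_gen] is written over the product of the
    binomials: each [chi - 1] is a binomial divided by [x^es]. *)
Let term (mu : 'rV[int]_n) := gamma *m mu^T + es *+ n - beta0 s.

Lemma split_u k : split (u k) = inr (J k).
Proof. by rewrite uE; case: splitP => [i /= e|i /= /addnI/val_inj->//]; have := ltn_ord i; rewrite -e. Qed.

Lemma rowM k : row k M = (cc (J k))^T.
Proof. by rewrite rowK /vtx_exp split_u. Qed.

Lemma M_entry k l : M k l = cc (J k) l 0.
Proof. by have := congr1 (fun A : 'rV_n => A 0 l) (rowM k); rewrite !mxE. Qed.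

Lemma M_ray k j : (M *m ray_fun j) k 0 = eJ (J k) j 0 - es j 0.
Proof.
have -> : (M *m ray_fun j) k 0 = (row k M *m ray_fun j) 0 0 by rewrite -row_mul [RHS]mxE.
by rewrite rowM ray_funE trmxK ccE !mxE.
Qed.

(** Subtracting [beta0] costs 1 at each ray, so strict positivity is needed. On sigma_n it comes
    from the positivity of [v], and elsewhere from [es > 0], with the far corner as only
    exception. *)
Lemma term_ge0 mu : \det M != 0 -> in_pip v M mu -> mu != corner -> forall j, 0 <= term mu j 0.
Proof.
move=> dM pm mc j; rewrite mxE [(- _ : 'cV_s) j 0]mxE [beta0 s j 0]mxE [(gamma *m _ + _) j 0]mxE.
rewrite mulmxnE -ray_funE.
suff : 0 < (mu *m ray_fun j) 0 0 + es j 0 *+ n by move: (_ + _) => x; lia.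
have [jn|jn] := boolP (j \in sgk n).
  rewrite es_sgk // mul0rn addr0; apply: (pip_dot_gt0 vL dM (adjL u)) pm.
    by move=> k; rewrite M_ray es_sgk // subr0.
  exact: ray_fun_gt0.
rewrite addrC; apply: (pip_dot_gtN vL dM (adjL u)) pm mc.
  by rewrite lt_neqAle es_ge0 eq_sym es_eq0 jn.
by move=> k; rewrite M_ray; have := eJ_ge0 (J k) j; move: (eJ _ _ _) => x; lia.
Qed.

Lemma term_lin mu : lin_eq eta (term mu) (es *+ n - beta0 s).
Proof. by exists (P *m mu^T); rewrite /term -[X in X - _]addrA mulmxA addrK. Qed.

Let M0 i (k : 'I_n) : (k < tau i)%N -> M i k = 0.
Proof. by rewrite M_entry; apply: cc0. Qed.

Let M_gt0 i : 0 < M i (tau i).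
Proof. by rewrite M_entry; apply: cc_gt0. Qed.

Lemma corner_type : \det M != 0 -> in_pip v M corner = injectiveb tau.
Proof.
move=> dM; rewrite (corner_in_pip vL dM (adjL u)); apply/forallP/injectiveP => h.
  by apply: (types_inj_of_last_pos M0 M_gt0 dM) => i; apply: (coords_gt0P vL dM (adjL u)).
by move=> i; apply: (coords_gt0_last vL dM (adjL u)); exact: (types_inj_last_pos M0 M_gt0).
Qed.

(** The degrees of the [z_i] add up to [beta0], and distinct types use each of the first n of them
    once: this is the monomial of the minor divided by [z_{n+1}]. *)
Lemma corner_term : injective tau ->
  term corner = \sum_k (eJ (J k) - flag_z_deg sg (lift ord_max (tau k))) - flag_z_deg sg ord_max.
Proof.
move=> ti; rewrite /term -(sum_flag_z_deg sgk0 sgk_sub) big_ord_recr /= sumrB opprD addrA.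
congr (_ - _); congr (_ - _); last first.
  rewrite (reindex_inj ti) /=; apply: eq_bigr => k _; congr flag_z_deg.
  by apply: val_inj; rewrite /= /bump leqNgt ltn_ord.
rewrite /corner linear_sum /= mulmx_sumr -[es *+ n](_ : \sum_(k < n) es = _); last first.
  by rewrite sumr_const card_ord.
by rewrite -big_split /=; apply: eq_bigr => k _; rewrite rowM trmxK ccE subrK.
Qed.

(* The vertex [corner] of the parallelepiped, whose monomial may fail to be
   regular, is cancelled by the contribution of the flag monomials. *)
Lemma corner_cancel :
  (type_sign tau)%:~R * \prod_k xm K (eJ (J k) - flag_z_deg sg (lift ord_max (tau k))) /
    xm K (flag_z_deg sg ord_max) -
  (sgz (\det M))%:~R * (\sum_(mu <- box n B | in_pip v M mu) xm K (term mu)) =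
  - (sgz (\det M))%:~R * \sum_(mu <- box n B | in_pip v M mu && (mu != corner)) xm K (term mu).
Proof.
have [d0|d0] := eqVneq (\det M) 0.
  rewrite d0 sgz0 !mul0r subr0 type_sign_ninj ?mul0r ?mulNr ?mul0r ?oppr0 //.
  apply/negP => /injectiveP ti; have := types_inj_det_neq0 M0 M_gt0 ti.
  by rewrite d0 eqxx.
rewrite (bigID (fun mu => mu == corner)) /= mulrDr opprD addrA mulNr -[RHS]add0r; congr (_ - _).
have [ti|nti] := boolP (injectiveb tau).
  have pc : in_pip v M corner by rewrite corner_type.
  rewrite (types_inj_det M0 M_gt0); last exact/injectiveP.
  rewrite (eq_bigl (pred1 corner)) => [|mu /=]; last by case: eqP => [->|]; rewrite ?pc ?andbF.
  have -> : \sum_(mu <- box n B | pred1 corner mu) xm K (term mu) = xm K (term corner).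
    rewrite -big_filter filter_pred1_uniq ?box_uniq ?big_seq1 //.
    by rewrite mem_box; apply/forallP=> j; apply: boxB d0 pc _.
  rewrite corner_term; last exact/injectiveP.
  by rewrite xmD xm_sum xmN mulrA subrr.
rewrite type_sign_ninj // !mul0r big_pred0 ?mulr0 ?subr0 // => mu.
by case: eqP => [->|]; rewrite ?andbF // corner_type // (negPf nti).
Qed.

End Correction.

(** The difference of the two formal primitives. Its regularity makes their coboundaries
    cohomologous, and [(-1)^n] matches the sign in [minorc]. *)
Definition correction (u : {ffun 'I_n -> 'I_(1 + q)}) : rational_fun K s :=
  minorc (fun k c => of_poly (vtx_row k c)) (fun i => of_poly (flag_z K sg i))
    (fun k => of_poly (vtx k)) u - (-1) ^+ n * cone_gen K eta P vtx_exp v B u.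

Lemma correctionE (u : {ffun 'I_n -> 'I_(1 + q)}) (J : 'I_n -> 'I_q) : (forall k, u k = rshift 1 (J k)) ->
  correction u = (-1) ^+ n * (- (sgz (\det (exps vtx_exp u)))%:~R *
    \sum_(mu <- box n B | in_pip v (exps vtx_exp u) mu && (mu != \sum_k row k (exps vtx_exp u)))
      xm K (gamma *m mu^T + es *+ n - beta0 s)) / \prod_k of_poly (vtx (u k)).
Proof.
move=> uE; rewrite -(corner_cancel uE).
set p := \prod_k of_poly (vtx (u k)).
have p0 : p != 0 by apply/prodf_neq0 => k _; rewrite /of_poly tofrac_eq0; apply: vtx_neq0.
rewrite /correction /minorc.
have -> : \matrix_(i, j) of_poly (vtx_row (u i) (lift ord_max j)) = \matrix_(i, j)
   (if j == ty (J i) then xm K (eJ (J i) - flag_z_deg sg (lift ord_max (ty (J i)))) else 0).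
  apply/matrixP=> i j; rewrite !mxE of_poly_vtx_row (split_u uE) liftK.
  by case: eqP => [->|].
rewrite det_types flag_zE -/p.
have -> : cone_gen K eta P vtx_exp v B u = (sgz (\det (exps vtx_exp u)))%:~R *
    (\sum_(mu <- box n B | in_pip v (exps vtx_exp u) mu) xm K (gamma *m mu^T + es *+ n - beta0 s)) / p.
  rewrite /cone_gen /pip_sum.
  have -> : \prod_k (chi K eta P (vtx_exp (u k)) - 1) = p / xm K (es *+ n).
    rewrite xmMn -[n in X in _ / X](card_ord n) -prodr_const -prodf_div.
    apply: eq_bigr => k _; rewrite vtx_chi ?(split_u uE) // /vtx_deg (split_u uE).
    exact: mul_divK (xm_neq0 _ _).
  have -> : \sum_(mu <- box n B | in_pip v (exps vtx_exp u) mu) xm K (gamma *m mu^T + es *+ n - beta0 s) =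
      (\sum_(mu <- box n B | in_pip v (exps vtx_exp u) mu) chi K eta P mu) * xm K (es *+ n) * xm K (- beta0 s).
    by rewrite !mulr_suml; apply: eq_bigr => mu _; rewrite !xmD.
  exact: div_div_regroup.
exact: sub_div_regroup.
Qed.

Lemma correction_regular (u : {ffun 'I_n -> 'I_(1 + q)}) :
  in_loc eta (\prod_k vtx (u k)) (- beta0 s) (correction u).
Proof.
set f := \prod_k _.
have f0 : f != 0 by apply/prodf_neq0 => k _; apply: vtx_neq0.
have fh : is_homog eta f (\sum_k vtx_deg (u k)) by apply: is_homog_prod => k _; apply: vtx_homog.
(* On a tuple through the torus the minor has a zero row and [cone_gen] is 0. *)
have [/existsP[k uk]|/existsPn nu] := boolP [exists k, u k == lshift q ord0].
  suff -> : correction u = 0 by apply: in_loc0 fh.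
  rewrite /correction (@cone_gen_i0 _ _ _ _ _ _ _ (lshift q ord0)).
  - rewrite mulr0 subr0 /minorc (_ : \det _ = 0) ?mulr0 ?mul0r //.
    rewrite (expand_det_row _ k) big1 // => j _; rewrite mxE (eqP uk) of_poly_vtx_row.
    by rewrite (unsplitK (inl ord0)) liftK mul0r.
  - by rewrite /vtx_exp (unsplitK (inl ord0)).
  by apply/codomP; exists k; rewrite (eqP uk).
have /fin_all_exists[J uE] k : exists i, u k = rshift 1 i.
  case: (split_ordP (u k)) => [i e|i ->]; last by exists i.
  by have := nu k; rewrite e ord1 eqxx.
rewrite (correctionE uE); have [d0|d0] := eqVneq (\det (exps vtx_exp u)) 0.
  by rewrite d0 sgz0 oppr0 mul0r mulr0 mul0r; apply: in_loc0 fh.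
rewrite mulrA -mulrA -prodfV.
set S0 := \sum_(_ <- _ | _) _; set Q := \prod_k _.
apply: (@in_locZ _ _ _ _ f _ _ _ _ ((-1) ^+ n * - sgz (\det (exps vtx_exp u))) fh f0).
  by rewrite !rmorphM rmorphN rmorphXn rmorphN1.
apply: (@in_loc_lin _ _ _ _ _ ((es *+ n - beta0 s) + \sum_k - vtx_deg (u k))).
  rewrite (eq_bigr (fun=> - es)) => [|k _]; last by rewrite /vtx_deg (split_u uE).
  by rewrite sumr_const card_ord mulNrn addrAC subrr add0r; apply: lin_eq_refl.
apply: (in_locM f0).
  apply: (in_loc_sum _ f0 fh) => mu /andP[pm mc].
  apply: (in_loc_lin (term_lin mu)); apply: in_loc_xm fh _; exact: (term_ge0 uE).
apply: (in_loc_prod _ f0 fh) => k _.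
apply: (@in_loc_inv _ _ _ eta f _ _ (\prod_(k' | k' != k) vtx (u k')) (\sum_(k' | k' != k) vtx_deg (u k'))) => //.
- exact: vtx_homog.
- by apply: is_homog_prod => k' _; apply: vtx_homog.
by rewrite /f (bigD1 k).
Qed.

End VertexCover.

(** * Comparison of cocycles *)

Section Glue.

Variables (A : Type) (p q : nat) (a : 'I_p -> A) (b : 'I_q -> A).

Definition glue (k : 'I_(p + q)) : A :=
  match split k with inl i => a i | inr j => b j end.

Lemma glue_l i : glue (lshift q i) = a i.
Proof. by rewrite /glue (unsplitK (inl i)). Qed.

Lemma glue_r j : glue (rshift p j) = b j.
Proof. by rewrite /glue (unsplitK (inr j)). Qed.

Lemma glue_ind (Q : A -> Prop) : (forall i, Q (a i)) -> (forall j, Q (b j)) -> forall k, Q (glue k).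
Proof. by move=> ha hb k; rewrite /glue; case: split. Qed.

End Glue.

Section Covers.

Variables (K : fieldType) (n s : nat) (eta : 'M[int]_(s, n)) (Sigma : {set {set 'I_s}}).
Local Notation S := {mpoly K[s]}.
Local Notation ratfun := (rational_fun K s).

Lemma is_cover_extend m m' (f : 'I_m -> S) (f' : 'I_m' -> S) (r : 'I_m' -> 'I_m) :
  (forall k, f k != 0 /\ exists D, is_homog eta (f k) D) -> (forall k, f' k = f (r k)) ->
  is_cover eta Sigma f' -> is_cover eta Sigma f.
Proof.
move=> hf e [_ h]; split=> // J /h[k [c ec]]; exists k, (fun i => \sum_(l | r l == i) c l); rewrite ec.
rewrite (partition_big r xpredT) //=; apply: eq_bigr => i _.
by rewrite mulr_suml; apply: eq_bigr => l /eqP <-; rewrite e.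
Qed.

Section PolynomialRows.

Variables (sg : n.+1.-tuple {set 'I_s}) (m : nat) (f : 'I_m -> S) (d : 'I_m -> 'cV[int]_s).
Variable (a : 'I_m -> 'I_n.+1 -> S).
Hypothesis z_sum : \sum_i flag_z_deg sg i = beta0 s.
Hypothesis f_neq0 : forall k, f k != 0.
Hypothesis f_homog : forall k, is_homog eta (f k) (d k).
Hypothesis a_homog : forall k c, is_homog eta (a k c) (d k - flag_z_deg sg c).
Hypothesis a_sum : forall k, f k = \sum_c a k c * flag_z K sg c.

Definition row_cochain := detc (fun k c => of_poly (a k c)) (fun k => of_poly (f k)) : _ -> ratfun.

Lemma flag_z_neq0 i : of_poly (flag_z K sg i) != 0.
Proof. by rewrite flag_zE xm_neq0. Qed.

Lemma row_cochain_sd : row_cochain =1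
  sd (minorc (fun k c => of_poly (a k c)) (fun i => of_poly (flag_z K sg i)) (fun k => of_poly (f k))).
Proof.
move=> t; apply: detc_sd => [k|k|]; last exact: flag_z_neq0.
  rewrite a_sum /of_poly rmorph_sum; apply: eq_bigr => c _; exact: rmorphM.
by rewrite /of_poly tofrac_eq0.
Qed.

(** The degree of the determinant is that of the denominator minus the degrees of the [z_i], that
    is, minus [beta0]: the degree of a section of the canonical sheaf. *)
Lemma row_cochain_cocycle : is_cocycle eta f (scoch eta row_cochain).
Proof.
apply: (scoch_cocycle (b := minorc _ _ _)) row_cochain_sd => t.
set g := \prod_k f (t k).
exists 1%N, (\sum_k d (t k)), (\det (\matrix_(i, j) a (t i) j)); split.
- by apply: is_homog_prod => k _.
- rewrite mulr1n addrC -z_sum; apply: is_homog_det => i j; rewrite mxE; exact: a_homog.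
rewrite expr1 /row_cochain /detc /of_poly -det_map_mx /g rmorph_prod; congr (\det _ / _).
by apply/matrixP=> i j; rewrite !mxE.
Qed.

End PolynomialRows.

(** Selecting rows by [t] multiplies the transpose of [A] by a 0-1 matrix, whose determinant is the
    alternating factor in [omega]. *)
Lemma omegaE (F : 'I_n.+1 -> S) (A : 'M[S]_n.+1) :
  (forall k, F k != 0) ->
  omega eta F (\det A) = scoch eta (row_cochain F (fun k c => A c k)).
Proof.
move=> F0; apply/ffunP=> t; rewrite !ffunE /row_cochain /detc; congr (_ *: _).
have -> : \matrix_(i, j) of_poly (A j (t i)) =
    (\matrix_(i, j) ((t i == j)%:R : ratfun)) *m (map_mx (@tofrac _) A)^T.
  apply/matrixP=> i j; rewrite !mxE (bigD1 (t i)) //= !mxE eqxx mul1r big1 ?addr0 // => k.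
  by rewrite !mxE eq_sym => /negPf ->; rewrite mul0r.
rewrite det_mulmx det_tr det_map_mx -/(of_poly _) mulrA.
have [/injectiveP ti|/injectivePn[i [j ij tij]]] := boolP (injectiveb t).
  by congr (_ / _); rewrite (reindex_inj ti).
rewrite (_ : \det _ = 0) ?mul0r //; apply: (determinant_alternate ij) => k.
by rewrite !mxE tij.
Qed.

End Covers.

Section Trace.

Variables (K : fieldType) (n s : nat) (eta : 'M[int]_(s, n)) (Sigma : {set {set 'I_s}}).
Local Notation S := {mpoly K[s]}.
Variable Tr : functional K n s.
Hypothesis trace : is_trace eta Sigma Tr.

Lemma cocycle0 m (f : 'I_m -> S) : is_cover eta Sigma f -> is_cocycle eta f (0 : cech_cochain K n s m n.+1).
Proof.
case=> hf _; split; last by apply/ffunP=> t; rewrite !ffunE big1 // => i _; rewrite ffunE scaler0.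
move=> t; exists 0; last by rewrite scale0r ffunE.
have /fin_all_exists[d dP] : forall k, exists D, is_homog eta (f (t k)) D by move=> k; case: (hf (t k)).
by apply: in_loc0 (is_homog_prod (fun k _ => dP k)).
Qed.

Lemma trace0 m (f : 'I_m -> S) : is_cover eta Sigma f -> Tr f 0 = 0.
Proof.
move=> hf; have h0 := cocycle0 hf; have := trace_linear trace 1 hf h0 h0.
by rewrite scaler0 addr0 mul1r => /eqP; rewrite -subr_eq0 opprD addrA subrr sub0r oppr_eq0 => /eqP.
Qed.

Lemma traceZ m (f : 'I_m -> S) a c : is_cover eta Sigma f -> is_cocycle eta f c ->
  Tr f (of_poly a%:MP *: c) = a * Tr f c.
Proof.
by move=> hf hc; have := trace_linear trace a hf hc (cocycle0 hf); rewrite addr0 trace0 // addr0.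
Qed.

Lemma trace_sub m m' (f : 'I_m -> S) (f' : 'I_m' -> S) r c :
  is_cover eta Sigma f -> is_cover eta Sigma f' -> (forall i, f' i = f (r i)) ->
  is_cocycle eta f c -> Tr f' (cech_pull r c) = Tr f c.
Proof.
move=> hf hf' e hc; apply: (trace_refine trace) => // i.
by exists 1%N, 1; rewrite expr1 mulr1.
Qed.

End Trace.

Section PolynomialIdeal.

Variables (A : comNzRingType) (m : nat) (f : 'I_m -> A).

Definition in_span (p : A) := exists c : 'I_m -> A, p = \sum_i c i * f i.

Lemma in_span_gen k : in_span (f k).
Proof.
exists (fun i => (i == k)%:R); rewrite (bigD1 k) //= eqxx mul1r big1 ?addr0 // => i /negPf->.
by rewrite mul0r.
Qed.

Lemma in_spanD p p' : in_span p -> in_span p' -> in_span (p + p').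
Proof.
move=> [c ->] [c' ->]; exists (fun i => c i + c' i); rewrite -big_split.
by apply: eq_bigr => i _; rewrite mulrDl.
Qed.

Lemma in_spanM g p : in_span p -> in_span (g * p).
Proof.
move=> [c ->]; exists (fun i => g * c i); rewrite mulr_sumr.
by apply: eq_bigr => i _; rewrite mulrA.
Qed.

Definition congr_span p p' := in_span (p - p').

Lemma congr_span_refl p : congr_span p p.
Proof. by exists (fun _ => 0); rewrite subrr big1 // => i _; rewrite mul0r. Qed.

Lemma congr_spanM p p' g g' : congr_span p p' -> congr_span g g' -> congr_span (p * g) (p' * g').
Proof.
move=> h h'; rewrite /congr_span (_ : _ - _ = p * (g - g') + g' * (p - p')).
  by apply: in_spanD; apply: in_spanM.
by rewrite !mulrBr addrA [g' * p]mulrC subrK [g' * p']mulrC.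
Qed.

Lemma congr_span_exp p p' k : congr_span p p' -> congr_span (p ^+ k) (p' ^+ k).
Proof.
move=> h; elim: k => [|k IH]; rewrite ?expr0 ?exprS; first exact: congr_span_refl.
exact: congr_spanM.
Qed.

Lemma congr_in_span p p' : congr_span p p' -> in_span p' -> in_span p.
Proof. by move=> h h'; rewrite -[p](subrK p'); apply: in_spanD. Qed.

Lemma congr_span_sym p p' : congr_span p p' -> congr_span p' p.
Proof. by move=> h; rewrite /congr_span -opprB -mulN1r; apply: in_spanM. Qed.

End PolynomialIdeal.

Section VertexCovers.

Variables (R : realFieldType) (K : fieldType) (n s q : nat) (eta : 'M[int]_(s, n)).
Variables (Sigma : {set {set 'I_s}}) (smax : {set 'I_s}).
Local Notation S := {mpoly K[s]}.
Hypothesis fan : complete_fan R eta Sigma.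
Variables (Jc : 'I_q -> {set 'I_s}) (eJ : 'I_q -> 'cV[int]_s) (es : 'cV[int]_s).
Hypothesis eJ_ge0 : forall i j, 0 <= eJ i j 0.
Hypothesis eJ_eq0 : forall i j, (eJ i j 0 == 0) = (j \in Jc i).
Hypothesis es_ge0 : forall j, 0 <= es j 0.
Hypothesis es_eq0 : forall j, (es j 0 == 0) = (j \in smax).
Hypothesis Jc_all : forall J, J \in Sigma -> cone_dim R eta J = n -> J = smax \/ exists i, J = Jc i.
Hypothesis vtx_ok : forall k, vtx K eJ es k != 0 /\ exists D, is_homog eta (vtx K eJ es k) D.

Let Y (J : {set 'I_s}) : S := \prod_(j | j \notin J) 'X_j.

(** A maximal cone containing the opposite of the ray misses the ray, by strong convexity. *)
Lemma ray_notin j : exists2 J, J \in Sigma & (cone_dim R eta J = n) /\ j \notin J.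
Proof.
have [J0 J0S hJ0] := fan_cover fan (- row j (etaR R eta)).
have [J [JS dJ J0J]] := cone_in_maximal fan J0S.
exists J => //; split=> //; apply/negP => jJ.
have h1 : in_cone eta J (row j (etaR R eta)).
  exists (fun i => (i == j)%:R); split=> [i|]; first by rewrite ler0n.
  rewrite (bigD1 j) //= eqxx scale1r big1 ?addr0 // => i /andP[_ /negPf->].
  by rewrite scale0r.
have := fan_strongly_convex fan JS h1 (in_coneS J0J hJ0).
by apply/eqP; apply: ray_neq0 fan _.
Qed.

Lemma some_vertex_gt0 j : 0 < es j 0 \/ exists i, 0 < eJ i j 0.
Proof.
have [J JS [dJ jJ]] := ray_notin j.
have [e|[i e]] := Jc_all JS dJ; [left|right; exists i].
  by rewrite lt_neqAle es_ge0 eq_sym es_eq0 -e jJ.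
by rewrite lt_neqAle eJ_ge0 eq_sym eJ_eq0 -e jJ.
Qed.

(** Modulo the binomials all vertex monomials agree, so [x^((q+1) es)] is congruent to the product
    of all of them. Every variable occurs in that product, which is thus a multiple of
    [prod x_j]. *)
Lemma vtx_vertex : in_span (vtx K eJ es) ('X_[mnm_of es] ^+ q.+1) /\
  (forall i, congr_span (vtx K eJ es) 'X_[mnm_of (eJ i)] 'X_[mnm_of es]).
Proof.
have cg i : congr_span (vtx K eJ es) 'X_[mnm_of (eJ i)] 'X_[mnm_of es].
  by have := in_span_gen (vtx K eJ es) (rshift 1 i); rewrite {2}/vtx (unsplitK (inr i)).
split=> //; pose xs : S := 'X_[mnm_of es].
have cgp : congr_span (vtx K eJ es) (xs * \prod_(i < q) 'X_[mnm_of (eJ i)]) (xs ^+ q.+1).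
  rewrite exprS (_ : xs ^+ q = \prod_(i < q) xs); last by rewrite prodr_const card_ord.
  apply: congr_spanM; first exact: congr_span_refl.
  apply: (big_ind2 (congr_span (vtx K eJ es))) => //; first exact: congr_span_refl.
  by move=> *; apply: congr_spanM.
apply: congr_in_span (congr_span_sym cgp) _.
pose b := es + \sum_i eJ i - beta0 s.
have b0 j : 0 <= b j 0.
  have sum0 : 0 <= (\sum_i eJ i) j 0 by rewrite summxE; apply: sumr_ge0.
  rewrite !mxE; case: (some_vertex_gt0 j) => [|[i]] h.
    by move: sum0 h; move: (es j 0) ((\sum_i eJ i) j 0) => x y; lia.
  have : eJ i j 0 <= (\sum_i eJ i) j 0.
    by rewrite summxE (bigD1 i) //= lerDl; apply: sumr_ge0.
  by move: h (es_ge0 j); move: (es j 0) ((\sum_i eJ i) j 0) (eJ i j 0) => x y z; lia.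
have -> : xs * \prod_(i < q) 'X_[mnm_of (eJ i)] = 'X_[mnm_of b] * \prod_j 'X_j.
  apply/eqP; rewrite -tofrac_eq !rmorphM /= -!/(of_poly _) -!xm_poly // -xm_beta0.
  rewrite -xmD /b subrK xmD xm_sum /of_poly rmorph_prod; apply/eqP; congr (_ * _).
  by apply: eq_bigr => i _; rewrite xm_poly.
apply: in_spanM; have := in_span_gen (vtx K eJ es) (lshift q ord0).
by rewrite {2}/vtx (unsplitK (inl ord0)).
Qed.

Lemma cone_power (J : {set 'I_s}) (e : 'cV[int]_s) : (forall j, 0 <= e j 0) -> (forall j, (e j 0 == 0) = (j \in J)) ->
  exists E b, Y J ^+ E = 'X_[mnm_of e] * b.
Proof.
move=> e0 eJ0; pose E := (\sum_j `|e j 0%R|)%N.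
pose ind : 'cV[int]_s := \col_j (j \notin J)%:R.
have b0 j : 0 <= (ind *+ E - e) j 0.
  rewrite !mxE mulmxnE mxE -eJ0; have : (`|e j 0%R| <= E)%N by rewrite /E (bigD1 j) //= leq_addr.
  have := e0 j; case: (eqVneq (e j 0) 0) => [->|] /=; first by rewrite mul0rn subr0.
  by rewrite mulr1n -[1 *+ E]/(E%:R) natz; move: (e j 0) => x; lia.
have YE : of_poly (Y J) = xm K ind.
  rewrite /Y /of_poly rmorph_prod /xm big_mkcond; apply: eq_bigr => j _.
  by rewrite mxE; case: (j \in J); rewrite /= ?expr0z ?expr1z.
exists E, 'X_[mnm_of (ind *+ E - e)].
apply/eqP; rewrite -tofrac_eq rmorphXn rmorphM /= -!/(of_poly _) -!xm_poly //.
by rewrite YE -xmMn -xmD addrC subrK.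
Qed.

Lemma vtx_is_cover : is_cover eta Sigma (vtx K eJ es).
Proof.
split=> // J JS; have [J' [J'S dJ' JJ']] := cone_in_maximal fan JS.
have [h1 h2] := vtx_vertex.
have [e [e0 eJ0 he]] : exists e : 'cV[int]_s, [/\ forall j, 0 <= e j 0,
    forall j, (e j 0 == 0) = (j \in J') & in_span (vtx K eJ es) ('X_[mnm_of e] ^+ q.+1)].
  have [->|[i ->]] := Jc_all J'S dJ'; first by exists es.
  exists (eJ i); split=> //.
  exact: congr_in_span (congr_span_exp _ (h2 i)) h1.
have [E [b YE]] := cone_power e0 eJ0.
have YJ : Y J = \prod_(j | (j \notin J) && (j \in J')) 'X_j * Y J'.
  rewrite /Y (bigID (fun j => j \in J')) /=; congr (_ * _); apply: eq_bigl => j.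
  case: (boolP (j \in J')) => [_|nj]; rewrite ?andbF ?andbT //.
  by apply: contra nj; apply: (subsetP JJ').
exists (E * q.+1)%N.
suff : in_span (vtx K eJ es) (Y J ^+ (E * q.+1)) by [].
rewrite YJ exprMn exprM [Y J' ^+ (E * _)]exprM YE exprMn [_ * b ^+ _]mulrC.
by do 2!apply: in_spanM.
Qed.

End VertexCovers.

(** * Hypersurfaces through the identity of the torus *)

Section TorusHypersurfaces.

Variables (K : fieldType) (n s : nat) (eta : 'M[int]_(s, n)) (P : 'M[int]_n).
Local Notation gamma := (eta *m P).

(** The exponent of the denominator of the character. *)
Definition torus_hyp_deg (l : 'I_n) : 'cV[int]_s := \col_j (if gamma j l < 0 then `|gamma j l| else 0).

Lemma tofrac_prodX (Q : pred 'I_s) (e : 'I_s -> nat) :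
  tofrac (\prod_(j | Q j) 'X_j ^+ e j : {mpoly K[s]}) = xm K (\col_j (if Q j then (e j)%:Z else 0)).
Proof.
rewrite /of_poly rmorph_prod /xm big_mkcond; apply: eq_bigr => j _.
by rewrite mxE; case: (Q j); rewrite ?expr0z //= rmorphXn.
Qed.

Lemma torus_hypE l : of_poly (torus_hyp K eta P l) =
  xm K (torus_hyp_deg l) * (chi K eta P (delta_mx 0 l) - 1).
Proof.
rewrite /torus_hyp /of_poly rmorphB /= !tofrac_prodX chi_delta torus_charE.
rewrite mulrBr mulr1 -xmD; congr (xm K _ - xm K _); apply/colP=> j.
rewrite [LHS]mxE [RHS]mxE [torus_hyp_deg l j 0]mxE [col l _ j 0]mxE.
by move: (gamma j l) => x; case: (ltrP x 0); case: lerP; lia.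
Qed.

Lemma torus_hyp_homog l : is_homog eta (torus_hyp K eta P l) (torus_hyp_deg l).
Proof.
have prodX (Q : pred 'I_s) (e : 'I_s -> nat) :
    is_homog eta (\prod_(j | Q j) 'X_j ^+ e j : {mpoly K[s]}) (\sum_(j | Q j) delta_mx j 0 *+ e j).
  by apply: is_homog_prod => j _; apply: is_homog_exp; rewrite -mdiv1; apply: is_homogX.
have sumE (Q : pred 'I_s) (e : 'I_s -> nat) i :
    (\sum_(j | Q j) (delta_mx j 0 : 'cV[int]_s) *+ e j) i 0 = if Q i then (e i)%:Z else 0.
  rewrite summxE big_mkcond (bigD1 i) //= big1 ?addr0 => [|j ji].
    by case: (Q i) => //; rewrite mulmxnE mxE !eqxx -[RHS]natz.
  by case: (Q j) => //; rewrite mulmxnE mxE eq_sym (negPf ji) mul0rn.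
apply: is_homogD; last first.
  apply: is_homogN; apply: is_homog_lin (prodX _ _).
  suff -> : torus_hyp_deg l = \sum_(j | gamma j l < 0) delta_mx j 0 *+ `|gamma j l|%N by apply: lin_eq_refl.
  by apply/colP=> j; rewrite sumE [LHS]mxE.
apply: is_homog_lin (prodX _ _).
exists (P *m delta_mx l 0); rewrite mulmxA -colE; apply/colP=> j.
rewrite mxE sumE [(- _ : 'cV_s) j 0]mxE [torus_hyp_deg l j 0]mxE [RHS]mxE.
by move: (gamma j l) => x; case: (ltrP x 0); case: lerP; lia.
Qed.

Lemma torus_hyp_neq0 l : col l gamma != 0 -> torus_hyp K eta P l != 0.
Proof.
apply: contraNneq => h; have := torus_hypE l; rewrite h /of_poly rmorph0 => /esym/eqP.
rewrite mulf_eq0 (negPf (xm_neq0 _ _)) subr_eq0 /= => /eqP; rewrite -(xm0 K s) => /xm_inj.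
by rewrite trmx_delta -colE => ->.
Qed.

Lemma torus_hyp_at1 l : (torus_hyp K eta P l).@[fun=> 1] = 0.
Proof.
rewrite mevalB !rmorph_prod !big1 ?subrr // => j _;
  by rewrite rmorphXn /= mevalXU expr1n.
Qed.

End TorusHypersurfaces.

(** * The residue as the trace of a point class *)

Section Conclusion.

Variables (R : realFieldType) (K : fieldType) (n s q : nat) (eta : 'M[int]_(s, n)) (P : 'M[int]_n).
Variables (Sigma : {set {set 'I_s}}) (sg : n.+1.-tuple {set 'I_s}).
Local Notation sgk := (nth setT sg).
Local Notation gamma := (eta *m P).
Local Notation S := {mpoly K[s]}.
Hypothesis fan : complete_fan R eta Sigma.
Hypothesis uP : P \in unitmx.
Hypothesis sgk0 : sgk 0 = set0.
Hypothesis sgk_sub : forall k, (k < n)%N -> sgk k \subset sgk k.+1.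
Hypothesis gamma0 : forall (k : 'I_n) l j, (l <= k)%N -> j \in sgk l -> gamma j k = 0.
Hypothesis gamma_gt0 : forall (k : 'I_n) j, j \in sgk k.+1 -> j \notin sgk k -> 0 < gamma j k.
Hypothesis step_ex : forall k : 'I_n, exists j, (j \in sgk k.+1) && (j \notin sgk k).
Variables (Jc : 'I_q -> {set 'I_s}) (eJ : 'I_q -> 'cV[int]_s) (es : 'cV[int]_s).
Variables (cc : 'I_q -> 'cV[int]_n) (ty : 'I_q -> 'I_n).
Hypothesis eJ_ge0 : forall i j, 0 <= eJ i j 0.
Hypothesis eJ_eq0 : forall i j, (eJ i j 0 == 0) = (j \in Jc i).
Hypothesis es_ge0 : forall j, 0 <= es j 0.
Hypothesis es_eq0 : forall j, (es j 0 == 0) = (j \in sgk n).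
Hypothesis ccE : forall i, gamma *m cc i = eJ i - es.
Hypothesis ty_sub : forall i, sgk (ty i) \subset Jc i.
Hypothesis ty_notin : forall i j, j \in sgk (ty i).+1 -> j \notin sgk (ty i) -> j \notin Jc i.
Hypothesis Jc_all : forall J, J \in Sigma -> cone_dim R eta J = n -> J = sgk n \/ exists i, J = Jc i.
Variables (F : 'I_n.+1 -> S) (A : 'M[S]_n.+1) (alpha : 'I_n.+1 -> 'cV[int]_s).
Hypothesis F_cover : is_cover eta Sigma F.
Hypothesis F_homog : forall j, is_homog eta (F j) (alpha j).
Hypothesis A_homog : forall i j, is_homog eta (A i j) (alpha j - flag_z_deg sg i).
Hypothesis FE : forall j, F j = \sum_i A i j * flag_z K sg i.
Variable Tr : functional K n s.
Hypothesis trace : is_trace eta Sigma Tr.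

Local Notation g := (vtx K eJ es).
Local Notation gdeg := (@vtx_deg s q es).

Let g_neq0 k : g k != 0.
Proof. exact: (vtx_neq0 K sgk_sub step_ex eJ_ge0 eJ_eq0 es_ge0 es_eq0 ty_notin). Qed.

Let g_homog k : is_homog eta (g k) (gdeg k).
Proof. exact: (vtx_homog eJ_ge0 es_ge0 ccE). Qed.

Let g_cover : is_cover eta Sigma g.
Proof.
apply: (vtx_is_cover fan eJ_ge0 eJ_eq0 es_ge0 es_eq0 Jc_all) => k.
by split=> //; exists (gdeg k).
Qed.

Let z_sum : \sum_i flag_z_deg sg i = beta0 s := sum_flag_z_deg sgk0 sgk_sub.

(* The cover by the F_j and the vertex binomials at once: the determinants of
   the coefficients on the z_i form a cocycle restricting to both. *)
Let f1 := glue F g.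
Let a1 := glue (fun j c => A c j) (vtx_row K sg eJ es ty).
Let d1 := glue alpha gdeg.

Let f1_neq0 k : f1 k != 0.
Proof. by apply: (@glue_ind _ _ _ F g (fun p => p != 0)) => // j; case: F_cover => /(_ j)[]. Qed.

Let f1_homog k : is_homog eta (f1 k) (d1 k).
Proof. by rewrite /f1 /d1 /glue; case: split. Qed.

Let a1_homog k c : is_homog eta (a1 k c) (d1 k - flag_z_deg sg c).
Proof. by rewrite /a1 /d1 /glue; case: split => // i; exact: (vtx_row_homog eJ_ge0 eJ_eq0 es_ge0 es_eq0 ccE ty_notin). Qed.

Let a1_sum k : f1 k = \sum_c a1 k c * flag_z K sg c.
Proof. by rewrite /f1 /a1 /glue; case: split => // i; exact: (vtx_row_sum K eJ_ge0 eJ_eq0 es_ge0 es_eq0 ty_notin). Qed.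

Let f1_cover : is_cover eta Sigma f1.
Proof.
apply: (@is_cover_extend _ _ _ _ _ _ _ f1 F (@lshift _ _)) => // [k|k].
  by split=> //; exists (d1 k).
by rewrite /f1 glue_l.
Qed.

Let residue_vtx : residue eta Tr F (\det A) = Tr g (scoch eta (row_cochain g (vtx_row K sg eJ es ty))).
Proof.
have hc := row_cochain_cocycle z_sum f1_neq0 f1_homog a1_homog a1_sum.
transitivity (Tr f1 (scoch eta (row_cochain f1 a1))).
  rewrite /residue omegaE => [|k]; last by case: F_cover => /(_ k)[].
  rewrite -(trace_sub trace f1_cover F_cover (r := @lshift _ _) _ hc) => [|i]; last by rewrite /f1 glue_l.
  congr Tr; rewrite cech_pull_scoch; apply: eq_scoch => t.
  rewrite /row_cochain /detc; congr (\det _ / _).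
    by apply/matrixP=> i j; rewrite !mxE ffunE /a1 glue_l.
  by apply: eq_bigr => i _; rewrite ffunE /f1 glue_l.
rewrite -(trace_sub trace f1_cover g_cover (r := @rshift _ _) _ hc) => [|i]; last by rewrite /f1 glue_r.
congr Tr; rewrite cech_pull_scoch; apply: eq_scoch => t.
rewrite /row_cochain /detc; congr (\det _ / _).
  by apply/matrixP=> i j; rewrite !mxE ffunE /a1 glue_r.
by apply: eq_bigr => i _; rewrite ffunE /f1 glue_r.
Qed.

(* The cover carrying the class of the identity of the torus. *)
Let f3 := glue (torus_hyp K eta P) g.
Let mm3 := glue (fun l : 'I_n => delta_mx 0 l : 'rV[int]_n) (vtx_exp cc).
Let d3 := glue (torus_hyp_deg eta P) gdeg.
Let i3 : 'I_(n + (1 + q)) := rshift n (lshift q ord0).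

Let f3_neq0 k : f3 k != 0.
Proof.
rewrite /f3 /glue; case: split => // l; apply: torus_hyp_neq0.
have [j /andP[j1 j2]] := step_ex l; apply: contraTneq (gamma_gt0 j1 j2) => /colP/(_ j).
by rewrite mxE => ->; rewrite mxE ltxx.
Qed.

Let f3_homog k : is_homog eta (f3 k) (d3 k).
Proof. by rewrite /f3 /d3 /glue; case: split => // l; apply: torus_hyp_homog. Qed.

Let f3_i3 : f3 i3 = \prod_j 'X_j.
Proof. by rewrite /f3 /i3 glue_r /vtx (unsplitK (inl ord0)). Qed.

Let mm3_i3 : mm3 i3 = 0.
Proof. by rewrite /mm3 /i3 glue_r /vtx_exp (unsplitK (inl ord0)). Qed.

Let f3E k : k != i3 -> of_poly (f3 k) = xm K (d3 k) * (chi K eta P (mm3 k) - 1).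
Proof.
case: (split_ordP k) => [l ->|k' ->] ne; rewrite /f3 /d3 /mm3 ?glue_l ?glue_r; first exact: torus_hypE.
apply: (vtx_chi K eJ_ge0 es_ge0 ccE); apply: contra ne; case: (split_ordP k') => [i ->|i ->] //.
by rewrite ord1.
Qed.

Let f3_cover : is_cover eta Sigma f3.
Proof.
apply: (@is_cover_extend _ _ _ _ _ _ _ f3 g (@rshift _ _)) => // [k|k].
  by split=> //; exists (d3 k).
by rewrite /f3 glue_r.
Qed.

Let bounds : exists v L B, [/\ infinitesimal L v, (0 < L)%N, (0 < B)%N,
  (forall u i j, (`|\adj (exps mm3 u) i j| <= L)%N) /\ (forall j k, (`|gamma j k| <= L)%N) &
  forall u mu k, \det (exps mm3 u) != 0 -> in_pip v (exps mm3 u) mu ->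
    forall j, (`|mu 0%R j| + `|mm3 k 0%R j| <= B)%N].
Proof.
(* One shift must serve all tuples, hence the sums over every adjugate and over the rays. In [B],
   [n * C + 1] bounds the parallelepipeds and the last [C] leaves room for translates. *)
pose L1 := (\sum_(u : {ffun 'I_n -> 'I_(n + (1 + q))}) \sum_i \sum_j `|\adj (exps mm3 u) i j|)%N.
pose L2 := (\sum_j \sum_k `|gamma j k|)%N.
pose C := (\sum_k \sum_j `|mm3 k 0%R j|)%N.
have [v vL] := infinitesimal_exists n (L1 + L2).+1.
exists v, (L1 + L2).+1, (n * C + 1 + C)%N; split=> //; first by rewrite addn1.
  split=> [u i j|j k]; apply: leqW.
    by apply: leq_trans (leq_addr _ _); rewrite /L1 (bigD1 u) //= (bigD1 i) //= (bigD1 j) //= -!addnA leq_addr.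
  by apply: leq_trans (leq_addl _ _); rewrite /L2 (bigD1 j) //= (bigD1 k) //= -!addnA leq_addr.
have hC k j : (`|mm3 k 0%R j| <= C)%N.
  by rewrite /C (bigD1 k) //= (bigD1 j) //= -!addnA leq_addr.
move=> u mu k d0 pm j; apply: leq_add => //.
by apply: (in_pip_bound d0 vL.1 _ pm) => i l; rewrite mxE.
Qed.

Lemma is_cocycleZ m r (f : 'I_m -> S) (c : cech_cochain K n s m r) (z : int) :
  (forall k, f k != 0 /\ exists D, is_homog eta (f k) D) ->
  is_cocycle eta f c -> is_cocycle eta f (of_poly (z%:~R : K)%:MP *: c).
Proof.
move=> hf [h1 h2]; split=> [t|].
  have [phi hphi e] := h1 t; exists (of_poly (z%:~R : K)%:MP * phi); last by rewrite ffunE e scalerA.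
  have /fin_all_exists[d dP] : forall k, exists D, is_homog eta (f (t k)) D by move=> k; case: (hf (t k)).
  apply: (in_locZ (is_homog_prod (fun k _ => dP k)) _ (z := z)) hphi.
    by apply/prodf_neq0 => k _; case: (hf (t k)).
  by rewrite /of_poly [_%:MP]rmorph_int rmorph_int.
apply/ffunP=> t; have := congr1 (fun c' : cech_cochain K n s m r.+1 => of_poly (z%:~R : K)%:MP *: c' t) h2.
rewrite /= !ffunE scaler0 => e; rewrite -[RHS]e scaler_sumr; apply: eq_bigr => i _.
by rewrite ffunE !scalerA mulrC.
Qed.

Lemma in_loc_extend f h D E1 E2 phi : is_homog eta f E1 -> is_homog eta h E2 -> f * h != 0 ->
  in_loc eta f D phi -> in_loc eta (f * h : S) D phi.
Proof.
move=> hf hh; rewrite mulf_eq0 negb_or => /andP[f0 h0] [k [E [p [hE hp ->]]]].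
exists k, (E + E2), (p * h ^+ k); split; first exact: is_homogM.
  by rewrite mulrnDl addrA; apply: is_homogM => //; apply: is_homog_exp.
rewrite /of_poly !rmorphM !rmorphXn exprMn invfM mulrACA divff ?mulr1 //.
by rewrite expf_neq0 // tofrac_eq0.
Qed.

Lemma residue_flag : residue eta Tr F (\det A) = 1 \/ residue eta Tr F (\det A) = -1.
Proof.
have [v [L [B [vL L0 B0 [adjL gammaL] boxB]]]] := bounds.
pose cone3 := scoch eta (sd (cone_gen K eta P mm3 v B)).
have cone3_cocycle : is_cocycle eta f3 cone3.
  exact: (cone_gen_cocycle f3_neq0 f3_homog f3_i3 mm3_i3 f3E vL adjL boxB).
(* The first n open sets and the torus form the distinguished tuple. The factor [det P] is the one
   in [point_formE]. *)
have Tr3 : (\det P)%:~R * Tr f3 cone3 = 1.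
  rewrite -(traceZ trace _ f3_cover cone3_cocycle); apply: (trace_point trace) => //.
  exists P, i3, (fun l => lshift (1 + q) l); split; first split=> //.
  - move=> k0; case: (split_ordP k0) => [l ->|k ->]; rewrite /f3 ?glue_l ?glue_r => ne; first exact: torus_hyp_at1.
    rewrite /vtx; case: (split_ordP k) ne => [i ->|i -> _]; first by rewrite ord1 eqxx.
    by rewrite mevalB !mevalX !big1 ?subrr // => j _; rewrite expr1n.
  - by move=> l; rewrite /f3 glue_l.
  split.
  - by apply: is_cocycleZ => // k; split=> //; exists (d3 k).
  - move=> t it; rewrite !ffunE (cone_gen_sd0 f3_neq0 f3E vL adjL boxB it).
    by rewrite scale0r scaler0.
  rewrite point_formE !ffunE (sd_cone_gen_first _ _ _ mm3_i3); first last.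
  - by rewrite ffunE unlift_none.
  - move=> k; rewrite ffunE liftK; apply/eqP => /(congr1 val) /= e.
    by have := ltn_ord k; rewrite e; lia.
  rewrite (cone_gen_basis _ _ _ L0 B0 vL); last first.
    by move=> k; rewrite !ffunE liftK /mm3 glue_l.
  rewrite scalerA; congr (_ * _ *: _).
  by rewrite /of_poly [_%:MP]rmorph_int rmorph_int.
pose coneg := scoch eta (sd (cone_gen K eta P (vtx_exp cc) v B)).
have pullE : cech_pull (@rshift n (1 + q)) cone3 = coneg.
  rewrite cech_pull_scoch; apply: eq_scoch => t; apply: eq_bigr => i _; congr (_ * _).
  rewrite /cone_gen; have -> : exps mm3 (omit [ffun k => rshift n (t k)] i) = exps (vtx_exp cc) (omit t i).
    by apply/matrixP=> k l; rewrite !mxE !ffunE /mm3 glue_r.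
  congr (_ / _ * _); apply: eq_bigr => k _.
  by rewrite !ffunE /mm3 glue_r.
have f3g k : g k = f3 (rshift n k) by rewrite /f3 glue_r.
have coneg_cocycle : is_cocycle eta g coneg.
  have := cech_pull_cocycle (@rshift n (1 + q)) cone3_cocycle; rewrite pullE.
  by move=> [h1 h2]; split=> // t; have := h1 t; under eq_bigr do rewrite /= -f3g.
have Trg : Tr g coneg = Tr f3 cone3.
  by rewrite -pullE; apply: (trace_sub trace f3_cover g_cover).
pose corr := scoch eta (correction K eta P sg eJ es cc ty v B).
have adjLg u i j : (`|\adj (exps (vtx_exp cc) u) i j| <= L)%N.
  have -> : exps (vtx_exp cc) u = exps mm3 [ffun k => rshift n (u k)].
    by apply/matrixP=> k l; rewrite !mxE !ffunE /mm3 glue_r.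
  exact: adjL.
have boxBg u mu : \det (exps (vtx_exp cc) u) != 0 -> in_pip v (exps (vtx_exp cc) u) mu ->
    forall j, (`|mu 0%R j| <= B)%N.
  have -> : exps (vtx_exp cc) u = exps mm3 [ffun k => rshift n (u k)].
    by apply/matrixP=> k l; rewrite !mxE !ffunE /mm3 glue_r.
  by move=> d0 pm j; apply: leq_trans (boxB _ _ i3 d0 pm j); apply: leq_addr.
have corr_reg := correction_regular K sgk0 sgk_sub gamma0 gamma_gt0 step_ex eJ_ge0 eJ_eq0
  es_ge0 es_eq0 ccE ty_sub ty_notin vL adjLg gammaL boxBg.
have corr_cochain : is_cochain eta g corr.
  by move=> u; exists (correction K eta P sg eJ es cc ty v B u); [apply: corr_reg|rewrite ffunE].
have dcorr_cocycle : is_cocycle eta g (cech_d corr).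
  rewrite cech_d_scoch; apply: (@scoch_cocycle _ _ _ _ _ _ _ _ (correction K eta P sg eJ es cc ty v B)) => // t.
  have gt0 : \prod_k g (t k) != 0 by apply/prodf_neq0 => k _.
  have gth : is_homog eta (\prod_k g (t k)) (\sum_k gdeg (t k)) by apply: is_homog_prod => k _.
  apply: (in_loc_sum _ gt0 gth) => i _.
  apply: (in_locZ gth gt0 (z := (-1) ^+ i)); first by rewrite rmorphXn rmorphN1.
  have -> : \prod_k g (t k) = (\prod_k g (omit t i k)) * g (t i) 
    by rewrite (bigD1_ord i) //= mulrC; congr (_ * _); apply: eq_bigr => k _; rewrite ffunE.
  apply: (in_loc_extend (E1 := \sum_k gdeg (omit t i k)) (E2 := gdeg (t i))) => //.
  - by apply: is_homog_prod => k _.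
  - by rewrite mulf_neq0 //; apply/prodf_neq0 => k _.
have rowE : scoch eta (row_cochain g (vtx_row K sg eJ es ty)) =
    of_poly (((-1) ^+ n : int)%:~R : K)%:MP *: coneg + cech_d corr.
  rewrite cech_d_scoch; apply/ffunP=> t; rewrite !ffunE scalerA -scalerDl; congr (_ *: _).
  rewrite (row_cochain_sd g_neq0 (vtx_row_sum K eJ_ge0 eJ_eq0 es_ge0 es_eq0 ty_notin)).
  rewrite /of_poly [_%:MP]rmorph_int rmorph_int /sd mulr_sumr -big_split; apply: eq_bigr => i _.
  rewrite rmorphXn rmorphN1.
  have split (T : comNzRingType) (x y z w : T) : x * z = y * (x * w) + x * (z - y * w) by ring.
  exact: split.
have dcorr0 : Tr g (cech_d corr) = 0.
  have [n0|n_gt0] := posnP n; last exact: (trace_coboundary trace).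
  have empty (j : 'I_n) : False by case: j => j; rewrite n0.
  suff -> : cech_d corr = 0 by exact: (trace0 trace).
  rewrite cech_d_scoch; apply/ffunP=> t; rewrite !ffunE /sd big1 ?scale0r // => i _.
  rewrite (correctionE K sgk0 sgk_sub gamma0 gamma_gt0 step_ex eJ_ge0 eJ_eq0
    es_ge0 es_eq0 ccE ty_sub ty_notin vL adjLg boxBg (J := fun k => False_rect _ (empty k))).
    rewrite [\sum_(mu <- box n B | _) _]big_pred0 ?mulr0 ?mul0r ?mulr0 // => mu.
    by rewrite (_ : mu == _) ?andbF //; apply/eqP/rowP=> j; case: (empty j).
  by move=> k; case: (empty k).
have := trace_linear trace ((-1) ^+ n : int)%:~R g_cover coneg_cocycle dcorr_cocycle.
rewrite -rowE -residue_vtx dcorr0 addr0 Trg => ->.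
(* The remaining sign is [(-1)^n] times the determinant of a unimodular matrix. *)
have dP : (\det P == 1) || (\det P == -1) by move: uP; rewrite unitmxE.
rewrite rmorphXn rmorphN1 -signr_odd.
by case/orP: dP Tr3 => /eqP ->; rewrite ?rmorphN1 ?rmorph1 ?mul1r ?mulN1r;
  [move=> ->|move=> /(congr1 -%R); rewrite opprK => ->];
  case: odd; rewrite ?expr0 ?expr1 ?mul1r ?mulN1r ?mulr1 ?opprK; auto.
Qed.

End Conclusion.

Lemma base_change_homog n s N (eta : 'M[int]_(s, n)) (g : {mpoly (gen_ring N)[s]}) D :
  is_homog eta g D -> is_homog eta (base_change g) D.
Proof.
move=> h a; rewrite mcoeff_msupp mcoeff_map_mpoly tofrac_eq0 -mcoeff_msupp; exact: h.
Qed.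

Lemma base_change_flag_z n s N (sg : n.+1.-tuple {set 'I_s}) i :
  base_change (flag_z (gen_ring N) sg i) = flag_z (gen_field N) sg i.
Proof. by rewrite /base_change rmorph_prod; apply: eq_bigr => j _; rewrite /= map_mpolyX. Qed.

Theorem theorem2p1 (R : realFieldType) (n s N : nat)
    (eta : 'M[int]_(s, n)) (Sigma : {set {set 'I_s}})
    (alpha : 'I_n.+1 -> 'cV[int]_s)
    (ix : 'I_N -> 'I_n.+1 * 'X_{1..s})
    (sg : n.+1.-tuple {set 'I_s})
    (A : 'M[{mpoly (gen_ring N)[s]}]_n.+1)
    (Tr : functional (gen_field N) n s) :
  projective_fan R eta Sigma ->
  (forall i, ample R eta Sigma (alpha i)) ->
  enumerates eta alpha ix ->
  complete_flag R eta Sigma sg ->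
  (forall i j, is_homog eta (A i j) (alpha j - flag_z_deg sg i)) ->
  (forall j, generic_poly ix j = \sum_i A i j * flag_z _ sg i) ->
  is_trace eta Sigma Tr ->
  let res := residue eta Tr (fun j => base_change (generic_poly ix j))
    (base_change (\det A)) in
  res = 1 \/ res = -1.
Proof.
move=> [fan _] ample_alpha ix_enum flag A_homog FE trace.
pose tau := nth setT sg n.
have tauS : tau \in Sigma := flag_mem flag (leqnn n).
have tau_dim : cone_dim R eta tau = n := flag_dim flag (leqnn n).
have [P uP [gamma0 gamma_gt0]] := flag_basis fan flag.
(* Any ample divisor can supply the vertices; the degree of [F_0] is at hand. *)
have [e eP] := ample_vertex (ample_alpha ord0).
pose VC := [set J in Sigma | (cone_dim R eta J == n) && (J != tau)].
pose Jc (i : 'I_#|VC|) : {set 'I_s} := enum_val i.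
have JcP i : [/\ Jc i \in Sigma, cone_dim R eta (Jc i) = n & Jc i != tau].
  by have := enum_valP i; rewrite inE => /and3P[h1 /eqP h2 h3].
(* Two vertex exponents differ by a character, here written in the basis adapted to the flag. *)
have /fin_all_exists[cc ccE] i : exists c : 'cV[int]_n, eta *m P *m c = e (Jc i) - e tau.
  have [h1 h2 _] := JcP i.
  have [[m1 e1] _ _] := eP _ h1 h2; have [[m2 e2] _ _] := eP _ tauS tau_dim.
  exists (invmx P *m (m1 - m2)); rewrite -mulmxA mulKVmx // mulmxBr -e1 -e2.
  by rewrite opprB addrA subrK.
have [ty tyP] := fin_all_exists (fun i => let: And3 h _ h' := JcP i in flag_exit fan flag h h').
have baseE g : base_change g = map_mpoly (@tofrac (gen_ring N)) g by [].
rewrite baseE -det_map_mx.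
apply: (@residue_flag R _ n s #|VC| eta P Sigma sg fan uP (flag0 fan flag) (flag_sub flag)
  gamma0 gamma_gt0 (flag_step_exists flag) Jc (fun i => e (Jc i)) (e tau) cc ty
  _ _ _ _ ccE _ _ _ _ _ alpha) => //.
- by move=> i j; have [h1 h2 _] := JcP i; have [] := eP _ h1 h2.
- by move=> i j; have [h1 h2 _] := JcP i; have [] := eP _ h1 h2.
- by have [] := eP _ tauS tau_dim.
- by have [] := eP _ tauS tau_dim.
- by move=> i; have [] := tyP i.
- by move=> i; have [] := tyP i.
- move=> J JS dJ; have [->|Jt] := eqVneq J tau; [by left|right].
  have JV : J \in VC by rewrite inE JS dJ eqxx.
  by exists (enum_rank_in JV J); rewrite /Jc enum_rankK_in.
- by apply: (generic_is_cover ample_alpha ix_enum fan); exists tau.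
- exact: (generic_homog ix_enum).
- by move=> i j; rewrite mxE; apply: base_change_homog.
- move=> j; rewrite FE [LHS]rmorph_sum; apply: eq_bigr => i _.
  by rewrite [LHS]rmorphM mxE -base_change_flag_z.
Qed.
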